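(* Let $\beta\in(0,\infty)$ and write $\gamma=\tfrac{2}{\beta}$. Then for every $x\in\mathbb{R}$, $$ \lim_{n\to\infty} n^{-\gamma}\,\mathbb{E}^\beta_n\Bigl\{ Z_n(e^{ix/n})\,\overline{Z_n(e^{-ix/n})}\Bigr\} = \pi^{\frac12}\,(2x)^{\frac12-\gamma}\,e^{-ix}\,J_{\gamma-\frac12}(x), $$ where $J_\nu$ denotes the Bessel function of the first kind and order $\nu$.
   Context: For $\beta\in(0,\infty)$ and an integer $n\ge 1$, $\mathbb{E}_n^\beta$ denotes expectation with respect to the circular $\beta$-ensemble of $n$ points $e^{i\theta_1},\dots,e^{i\theta_n}$ on the unit circle: $$ \mathbb{E}_n^\beta(f)=\frac{[\Gamma(\frac12\beta+1)]^n}{\Gamma(\frac12\beta n+1)}\int_{-\pi}^{\pi}\cdots\int_{-\pi}^{\pi} f(e^{i\theta_1},\dots,e^{i\theta_n})\,\bigl|\Delta(e^{i\theta_1},\dots,e^{i\theta_n})\bigr|^\beta\,\frac{d\theta_1}{2\pi}\cdots\frac{d\theta_n}{2\pi}, $$ with $\Delta(z_1,\dots,z_n)=\prod_{1\le j<k\le n}(z_k-z_j)$. The (renormalized) characteristic polynomial is $$ Z_n(z)=\prod_{j=1}^n\bigl(1-z^{-1}e^{i\theta_j}\bigr). $$ Since $z^{-\nu}J_\nu(z)=2^{-\nu}\sum_{m\ge0}\frac{(-1)^m (z/2)^{2m}}{m!\,\Gamma(m+\nu+1)}$ is an entire function of $z$, the expression $(2x)^{-\nu}J_{\nu}(x)$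 with $\nu=\gamma-\frac12$ is understood as $2^{-\nu}$ times the value at $x$ of this entire function (so it is defined for all real $x$, including $x\le 0$). *)

(* Defs.v *)
From HB Require Import structures.
From mathcomp Require Import all_boot all_order all_algebra.
From mathcomp Require Import all_classical all_reals all_analysis.
From mathcomp Require Export complex.

Set Implicit Arguments.
Unset Strict Implicit.
Unset Printing Implicit Defensive.

Import Order.TTheory GRing.Theory Num.Theory.
Import numFieldNormedType.Exports.

Local Open Scope classical_set_scope.
Local Open Scope ring_scope.
Local Open Scope complex_scope.

(* Euler's integral; only meaningful for 0 < s, where it converges. *)
Definition Gamma (R : realType) (s : R) : R :=
  (\int[lebesgue_measure]_(t in `]0%R, +oo[) (t `^ (s - 1) * expR (- t)))%R.

Definition bessel_coef (R : realType) (nu x : R) : R ^nat := fun m =>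
  (-1) ^+ m * (x / 2) ^+ m.*2 / (m`!%:R * Gamma (m%:R + nu + 1)).

(* J_nu x on the half-line 0 < x and for -1 < nu; the latter makes every
   argument of Gamma positive. *)
Definition besselJ (R : realType) (nu x : R) : R :=
  (x / 2) `^ nu * limn (series (bessel_coef nu x)).

(* The entire function z ^ (- nu) J_nu(z), at a real point x of any sign. *)
Definition bessel_entire (R : realType) (nu x : R) : R :=
  2 `^ (- nu) * limn (series (bessel_coef nu x)).

(* (2 x) ^ (- nu) J_nu(x), for every real x; see twox_besselJE. *)
Definition twox_besselJ (R : realType) (nu x : R) : R :=
  2 `^ (- nu) * bessel_entire nu x.

Lemma twox_besselJE (R : realType) (nu x : R) : 0 < x ->
  twox_besselJ nu x = (2 * x) `^ (- nu) * besselJ nu x.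
Proof.
move=> x0; have x0' := ltW x0.
rewrite /twox_besselJ /bessel_entire /besselJ powRM// -!mulrA; congr (_ * _).
rewrite !mulrA; congr (_ * _).
rewrite powRM ?invr_ge0// mulrA -powRD ?addNr ?eqxx ?gt_eqF ?implybT//.
by rewrite powRr0 mul1r -powR_inv1// -powRrM mulN1r.
Qed.

Definition expi (R : realType) (t : R) : R[i] := cos t +i* sin t.

Definition Cintegral (R : realType) (D : set R) (f : R -> R[i]) : R[i] :=
  (\int[lebesgue_measure]_(t in D) complex.Re (f t))%R +i*
  (\int[lebesgue_measure]_(t in D) complex.Im (f t))%R.

(* The iterated integral of f over [-pi, pi]^n against
   (dt_1 / 2 pi) ... (dt_n / 2 pi). *)
Fixpoint torus_integral (R : realType) (n : nat) :
    (n.-tuple R -> R[i]) -> R[i] :=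
  match n return (n.-tuple R -> R[i]) -> R[i] with
  | 0 => fun f => f [tuple]
  | m.+1 => fun f =>
      ((2 * pi)^-1)%:C *
      Cintegral `[- pi, pi]
        (fun t => torus_integral (fun s : m.-tuple R => f [tuple of t :: s]))
  end.

Definition vandermonde_prod (R : realType) (n : nat) (z : n.-tuple R[i]) :
    R[i] :=
  \prod_(j < n) \prod_(k < n | (j < k)%N) (tnth z k - tnth z j).

(* The norm of R[i] takes its values in R[i], hence the real part. *)
Definition circular_expectation (R : realType) (beta : R) (n : nat)
    (f : n.-tuple R[i] -> R[i]) : R[i] :=
  (Gamma (beta / 2 + 1) ^+ n / Gamma (beta / 2 * n%:R + 1))%:C *
  torus_integral (fun t : n.-tuple R =>
    let z := map_tuple (@expi R) t in
    f z * (complex.Re `|vandermonde_prod z| `^ beta)%:C).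

Definition char_poly_circ (R : realType) (n : nat) (e : n.-tuple R[i])
    (z : R[i]) : R[i] :=
  \prod_(j < n) (1 - z^-1 * tnth e j).

(* Main.v *)
(** Writing chord2 t = |1 - e^(it)|^2, the product of the two characteristic
    polynomials is e^(-ix) times the product of chord2 theta_j - chord2 (x/n).
    Integrating by parts against the weight (Aomoto's method, after regularising
    the weight so that it is differentiable) gives recurrences for the averages
    of products of the chord2 theta_j. One family of them turns the expectation
    into a terminating hypergeometric 2F1, i.e. a Gegenbauer polynomial in
    chord2 (x/n). Another one relates the weights with exponents a and a + 1 of
    the product of the chord2 theta_j; combined with a squeeze as a tends to
    infinity it gives the normalisation (Dyson's constant term) by induction
    on n, since one rotated variable of n + 1 contributes the exponent lam = beta/2.
    The limit of the 2F1 is taken termwise by Tannery's theorem, and the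
    prefactor follows from Euler's limit and the duplication formula for Gamma. *)
Require Import Defs.
From HB Require Import structures.
From mathcomp Require Import all_boot all_order all_algebra.
From mathcomp Require Import all_classical all_reals all_analysis.
From mathcomp Require Import perm complex measurable_realfun.
From mathcomp Require Import ring lra.

Set Implicit Arguments.
Unset Strict Implicit.
Unset Printing Implicit Defensive.

Import Order.TTheory GRing.Theory Num.Theory.
Import numFieldNormedType.Exports.

Local Open Scope classical_set_scope.
Local Open Scope ring_scope.
Local Open Scope complex_scope.

(** * Averages over the torus *)

(** The exponent [lam] is an arbitrary positive real. For small [lam] the weight has unbounded
    derivatives where two points meet, so every [chord2] is first replaced by [chord2 + e].
    Integration by parts then produces a kernel close to the cotangent of a half angle. It is odd,
    so symmetrising in two variables replaces it by a divided difference, which stays bounded as [e]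
    tends to 0. Two kinds of test functions occur. Products of the complex factors 1 - e^(i theta)
    move the exponent [a] by 1. Sines times products of chords, at [a = 0], give the moments; there
    an unknown integral of two sines appears, and rotation invariance eliminates it. Unit shifts
    alone determine the average as a function of [a] only up to a 1-periodic factor, whereas the
    induction on n needs the value at [a = lam]. Growth settles this: since [chord2 <= 4], raising
    [a] by d costs at most a factor 4^(n d), and the unit shifts show that this bound is
    asymptotically sharp. *)

Definition bmeas {d} {T : measurableType d} {R : realType} (f : T -> R) :=
  measurable_fun [set: T] f /\ exists M : R, forall x, `|f x| <= M.

Section bmeas.
Context {d} {T : measurableType d} {R : realType}.
Implicit Types f g : T -> R.

Lemma bmeas_cst (c : R) : bmeas (fun _ : T => c).
Proof. by split; [exact: measurable_cst|exists `|c|]. Qed.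

Lemma bmeasD f g : bmeas f -> bmeas g -> bmeas (fun x => f x + g x).
Proof.
move=> [mf [M fM]] [mg [N gN]]; split; first exact: measurable_funD.
by exists (M + N) => x; rewrite (le_trans (ler_normD _ _))// lerD.
Qed.

Lemma bmeasM f g : bmeas f -> bmeas g -> bmeas (fun x => f x * g x).
Proof.
move=> [mf [M fM]] [mg [N gN]]; split; first exact: measurable_funM.
by exists (M * N) => x; rewrite normrM ler_pM.
Qed.

Lemma bmeasN f : bmeas f -> bmeas (fun x => - f x).
Proof.
move=> hf; rewrite (_ : (fun _ => _) = fun x => (-1) * f x).
  exact: bmeasM (bmeas_cst _) hf.
by apply/funext => x; rewrite mulN1r.
Qed.

Lemma bmeasB f g : bmeas f -> bmeas g -> bmeas (fun x => f x - g x).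
Proof. by move=> hf hg; apply: bmeasD => //; exact: bmeasN. Qed.

Lemma bmeas_sum (I : Type) (r : seq I) (P : pred I) (F : I -> T -> R) :
  (forall i, P i -> bmeas (F i)) -> bmeas (fun x => \sum_(i <- r | P i) F i x).
Proof.
move=> hF; elim: r => [|i r IH].
  by under eq_fun do rewrite big_nil; exact: bmeas_cst.
under eq_fun do rewrite big_cons.
by case: (boolP (P i)) => // /hF hi; exact: bmeasD.
Qed.

Lemma bmeas_prod (I : Type) (r : seq I) (P : pred I) (F : I -> T -> R) :
  (forall i, P i -> bmeas (F i)) -> bmeas (fun x => \prod_(i <- r | P i) F i x).
Proof.
move=> hF; elim: r => [|i r IH].
  by under eq_fun do rewrite big_nil; exact: bmeas_cst.
under eq_fun do rewrite big_cons.
by case: (boolP (P i)) => // /hF hi; exact: bmeasM.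
Qed.

End bmeas.

Lemma bmeas_comp {d d'} {T : measurableType d} {T' : measurableType d'}
    {R : realType} (f : T' -> R) (g : T -> T') :
  bmeas f -> measurable_fun [set: T] g -> bmeas (fun x => f (g x)).
Proof.
move=> [mf [M fM]] mg; split; first exact: measurableT_comp.
by exists M => x.
Qed.

Section avg.
Context {R : realType}.
Notation mu := (@lebesgue_measure R).
Let D := `[- pi, pi]%classic : set R.

Definition avg (f : R -> R) : R := (2 * pi)^-1 * (\int[mu]_(t in D) f t)%R.

Let mD : measurable D. Proof. exact: measurable_itv. Qed.

Lemma twopi_gt0 : 0 < 2 * pi :> R.
Proof. by rewrite mulr_gt0// pi_gt0. Qed.

Let muD : lebesgue_measure D = (2 * pi)%:E.
Proof.
rewrite /D lebesgue_measure_itv/= lte_fin.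
have pi0 := pi_gt0 R.
rewrite ifT; last by rewrite gtrN.
by rewrite -EFinB opprK; congr _%:E; lra.
Qed.

Let fmuD : fine (mu D) = 2 * pi.
Proof. by rewrite muD. Qed.

Let int_cstD (M : R) : (\int[mu]_(x in D) (M%:E) = (M * (2 * pi))%:E)%E.
Proof. by rewrite integral_cst// EFinM; congr (_ * _)%E; exact: muD. Qed.

Lemma bmeas_integrable (f : R -> R) : bmeas f -> mu.-integrable D (EFin \o f).
Proof.
move=> [mf [M fM]].
apply: measurable_bounded_integrable => //.
- have : (lebesgue_measure D < +oo)%E by rewrite muD ltry.
  exact.
- exact: measurable_funTS.
- exists M; split; first exact: num_real.
  by move=> x Mx y /= _; rewrite (le_trans (fM y))// ltW.
Qed.

Lemma avg_cst (c : R) : avg (fun=> c) = c.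
Proof.
rewrite /avg Rintegral_cst//.
have -> : fine (lebesgue_measure D) = 2 * pi :> R by rewrite muD.
rewrite mulrCA mulVf ?mulr1//.
by rewrite gt_eqF// twopi_gt0.
Qed.

Lemma avgD (f g : R -> R) : bmeas f -> bmeas g ->
  avg (fun t => f t + g t) = avg f + avg g.
Proof.
by move=> hf hg; rewrite /avg RintegralD// ?mulrDr//; exact: bmeas_integrable.
Qed.

Lemma avgZ (c : R) (f : R -> R) : bmeas f -> avg (fun t => c * f t) = c * avg f.
Proof.
by move=> hf; rewrite /avg RintegralZl// 1?mulrCA//; exact: bmeas_integrable.
Qed.

Lemma avg_le (f g : R -> R) : bmeas f -> bmeas g -> (forall t, f t <= g t) ->
  avg f <= avg g.
Proof.
move=> hf hg fg; rewrite /avg; apply: ler_wpM2l; first by rewrite invr_ge0 ltW// twopi_gt0.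
by apply: le_Rintegral => //; exact: bmeas_integrable.
Qed.

Lemma avg_norm_le (f : R -> R) M : bmeas f -> (forall t, `|f t| <= M) ->
  `|avg f| <= M.
Proof.
move=> hf fM; rewrite ler_norml -{1}(avg_cst (- M)) -{2}(avg_cst M).
apply/andP; split; apply: avg_le => //; try exact: bmeas_cst.
  by move=> t; have := fM t; rewrite ler_norml => /andP[].
by move=> t; have := fM t; rewrite ler_norml => /andP[].
Qed.

Lemma bmeas_pair1 {d d'} {T : measurableType d} {T' : measurableType d'}
   (f : T * T' -> R) (v : T) :
  bmeas f -> bmeas (fun t => f (v, t)).
Proof. by move=> hf; apply: (bmeas_comp hf); exact: measurable_pair1. Qed.

Lemma bmeas_pair2 {d d'} {T : measurableType d} {T' : measurableType d'}
   (f : T * T' -> R) (v : T') :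
  bmeas f -> bmeas (fun t => f (t, v)).
Proof. by move=> hf; apply: (bmeas_comp hf); exact: measurable_pair2. Qed.

Let intE (f : R -> R) : bmeas f ->
  (\int[mu]_(t in D) (f t)%:E)%E = ((\int[mu]_(t in D) f t)%R)%:E.
Proof.
by move=> hf; rewrite /Rintegral fineK//; apply: integrable_fin_num => //; exact: bmeas_integrable.
Qed.

(** Partial averaging stays within the bounded measurable functions, a class that unlike
    integrability is also stable under products; iterated averages therefore need no separate
    integrability arguments. *)
Lemma bmeas_avg {d} {T : measurableType d} (f : T * R -> R) :
  bmeas f -> bmeas (fun v => avg (fun t => f (v, t))).
Proof.
move=> hf; split; last first.
  case: (hf) => mf [M fM]; exists M => v; apply: avg_norm_le => //.
  exact: bmeas_pair1.
case: (hf) => mf [M fM].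
rewrite /avg; apply: measurable_funM; first exact: measurable_cst.
have M0 : 0 <= M by rewrite (le_trans _ (fM (point, 0))).
(* shift by M to apply Tonelli *)
pose g (z : T * R) : \bar R := ((f z + M) * \1_D z.2)%:E.
have g0 z : (0 <= g z)%E.
  rewrite lee_fin mulr_ge0//.
  by have := fM z; rewrite ler_norml => /andP[+ _]; lra.
have mg : measurable_fun [set: T * R] g.
  apply/measurable_EFinP; apply: measurable_funM.
    by apply: measurable_funD => //.
  apply: (@measurableT_comp _ _ _ _ _ _ (\1_D : R -> R)) => //.
have := @measurable_fun_fubini_tonelli_F _ _ T _ R mu g mg g0.
rewrite /fubini_F => mF.
rewrite (_ : (fun v => _) = fun v => fine (\int[mu]_y g (v, y))%E - M * (2 * pi)).
  apply: measurable_funB => //.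
  by apply: (@measurableT_comp _ _ _ _ _ _ fine).
apply/funext => v.
have hs := bmeas_pair1 v hf.
have -> : (\int[mu]_y g (v, y) = \int[mu]_(y in D) (f (v, y) + M)%:E)%E.
  rewrite [RHS]integral_mkcond; apply: eq_integral => y _.
  rewrite /g patchE indicE; case: ifPn => /= _; by rewrite ?mulr1 ?mulr0.
rewrite (_ : fine _ = (\int[mu]_(t in D) (f (v, t) + M))%R)//.
rewrite RintegralD//; [|exact: bmeas_integrable|].
  by rewrite Rintegral_cst// fmuD addrK.
apply: (@bmeas_integrable (fun=> M)); exact: bmeas_cst.
Qed.

Lemma avg_swap (f : R * R -> R) : bmeas f ->
  avg (fun s => avg (fun t => f (s, t))) = avg (fun t => avg (fun s => f (s, t))).
Proof.
move=> hf; case: (hf) => mf [M fM].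
have M0 : 0 <= M by rewrite (le_trans _ (fM (0, 0))).
have hf' : bmeas (fun z : R * R => f (z.2, z.1)).
  by apply: (bmeas_comp hf); exact: measurable_swap.
rewrite /avg.
have h1 : bmeas (fun s => \int[mu]_(t in D) f (s, t)).
  have := bmeasM (bmeas_cst (2 * pi)) (bmeas_avg hf).
  by rewrite /avg; under eq_fun do rewrite mulrA divff ?gt_eqF ?twopi_gt0// mul1r.
have h2 : bmeas (fun t => \int[mu]_(s in D) f (s, t)).
  have := bmeasM (bmeas_cst (2 * pi)) (bmeas_avg hf').
  by rewrite /avg; under eq_fun do rewrite mulrA divff ?gt_eqF ?twopi_gt0// mul1r.
rewrite !RintegralZl//; [|exact: bmeas_integrable..].
do 2 congr (_ * _).
(* [f] is cut off outside the square, so that Fubini's theorem is applied on the whole plane; the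
   bound [M] and the finite measure of the square give integrability. *)
pose g (z : R * R) : \bar R := (f z * (\1_D z.1 * \1_D z.2))%:E.
have mg : measurable_fun [set: R * R] g.
  apply/measurable_EFinP; apply: measurable_funM => //.
  apply: measurable_funM;
  by apply: (@measurableT_comp _ _ _ _ _ _ (\1_D : R -> R)).
have ig : (mu \x mu)%E.-integrable [set: R * R] g.
  apply/integrable12ltyP => //.
  apply: (@le_lt_trans _ _ (\int[mu]_(x in D) ((M * (2 * pi))%:E))%E); last first.
    by rewrite int_cstD ltry.
  rewrite [leRHS]integral_mkcond.
  apply: ge0_le_integral => //.
  - by move=> x _; apply: integral_ge0.
  - apply: (@measurable_fun_fubini_tonelli_F _ _ _ _ _ mu (abse \o g)) => //.
      by apply: measurableT_comp.
    by move=> ? /=.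
  - apply/(measurable_restrictT _ _).1 => //; exact: measurable_cst.
  - move=> x _; rewrite patchE; case: ifPn => [xD|xD].
      apply: (@le_trans _ _ (\int[mu]_(y in D) (M%:E))%E); last first.
        by rewrite int_cstD.
      rewrite [leRHS]integral_mkcond.
      apply: ge0_le_integral => //.
      + apply: measurableT_comp => //; apply: measurableT_comp => //.
      + apply/(measurable_restrictT _ _).1 => //; exact: measurable_cst.
      + move=> y _; rewrite patchE /g abse_EFin /= !indicE xD mul1r.
        case: ifPn => [yD|yD]; rewrite /= ?mulr1 ?mulr0 ?normr0 ?lee_fin//.
    rewrite integral0_eq// => y _.
    by rewrite /g /= indicE (negbTE xD) mul0r mulr0 normr0.
have := Fubini ig.
have -> : (\int[mu]_x \int[mu]_y g (x, y) =
    \int[mu]_(x in D) (\int[mu]_(t in D) f (x, t))%:E)%E.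
  rewrite [RHS]integral_mkcond; apply: eq_integral => x _.
  rewrite patchE; case: ifPn => [xD|xD].
    rewrite -intE; last exact: bmeas_pair1.
    rewrite [RHS]integral_mkcond; apply: eq_integral => y _.
    by rewrite /g /= !indicE xD mul1r patchE; case: ifPn; rewrite ?mulr1 ?mulr0.
  rewrite integral0_eq// => y _.
  by rewrite /g /= indicE (negbTE xD) mul0r mulr0.
have -> : (\int[mu]_y \int[mu]_x g (x, y) =
    \int[mu]_(y in D) (\int[mu]_(t in D) f (t, y))%:E)%E.
  rewrite [RHS]integral_mkcond; apply: eq_integral => x _.
  rewrite patchE; case: ifPn => [xD|xD].
    rewrite -intE; last exact: (bmeas_pair1 _ hf').
    rewrite [RHS]integral_mkcond; apply: eq_integral => y _.
    by rewrite /g /= !indicE xD mulr1 patchE; case: ifPn; rewrite ?mulr1 ?mulr0.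
  rewrite integral0_eq// => y _.
  by rewrite /g /= !indicE (negbTE xD) !mulr0.
by rewrite (intE h1) (intE h2) => -[].
Qed.

Lemma avg_cvg (f_ : nat -> R -> R) (f : R -> R) (M : R) :
  (forall n, measurable_fun setT (f_ n)) -> (forall n t, `|f_ n t| <= M) ->
  (forall t, f_ ^~ t @ \oo --> f t) ->
  avg (f_ n) @[n --> \oo] --> avg f.
Proof.
move=> mf fM ff; rewrite /avg; apply: cvgZr.
have hf n : bmeas (f_ n) by split => //; exists M.
have mlf : measurable_fun setT f.
  by apply: (@measurable_fun_cvg _ _ _ setT f_).
have hlf : bmeas f.
  split => //; exists M => x.
  have /cvg_norm h := ff x.
  by apply: (cvgr_to_le h); apply: nearW => n.
have h : (\int[mu]_(x in D) (f_ n x)%:E @[n --> \oo] -->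
          \int[mu]_(x in D) (f x)%:E)%E.
  apply: (@dominated_cvg _ _ _ mu D mD (fun n t => (f_ n t)%:E) (EFin \o f)
    (fun=> M%:E)) => //.
  - by move=> n; apply/measurable_EFinP; exact: (measurable_funTS (mf n)).
  - by move=> x _; apply: cvg_EFin; [exact: nearW|exact: ff].
  - by apply: (@bmeas_integrable (fun=> M)); exact: bmeas_cst.
  - by move=> n x _; rewrite lee_fin.
apply: fine_cvg; rewrite -intE//.
Qed.

End avg.

(** * Derivatives and translations under the average over one period *)

Section avg_calculus.
Context {R : realType}.
Implicit Types f g : R -> R.
Notation mu := (@lebesgue_measure R).

Lemma avg_derive f f' : continuous f' ->
  (forall t, is_derive t (1 : R) f (f' t)) -> f (- pi) = f pi -> avg f' = 0.
Proof.
move=> cf' df fpi; rewrite /avg /Rintegral.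
have cf : continuous f.
  by move=> t; apply: differentiable_continuous; apply/derivable1_diffP; case: (df t).
rewrite (@continuous_FTC2 _ f' f).
- by rewrite fpi /= subrr mulr0.
- by rewrite gtrN// pi_gt0.
- exact: continuous_subspaceT.
- split.
  + by move=> x _; case: (df x).
  + by apply: cvg_at_right_filter; exact: cf.
  + by apply: cvg_at_left_filter; exact: cf.
- by move=> x _; rewrite derive1E; apply: derive_val.
Qed.

Lemma Rintegral_shift f (a b c : R) : continuous f -> a <= b ->
  (\int[mu]_(t in `[a, b]) f (t + c))%R = (\int[mu]_(t in `[(a + c), (b + c)]) f t)%R.
Proof.
move=> cf ab; rewrite /Rintegral; congr fine.
have dF x : is_derive x (1:R) (fun t : R => t + c) 1.
  by have := is_deriveD (is_derive_id x 1) (is_derive_cst c x 1); rewrite addr0.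
have F'E : derive1 (fun t : R => t + c) = fun=> 1.
  by apply/funext => x; rewrite derive1E; apply: derive_val.
have cF : continuous (fun t : R => t + c) by move=> x; apply: cvgD => //; exact: cvg_cst.
rewrite (@integration_by_substitution_increasing _ (fun t => t + c) f)//.
- by apply: eq_integral => x _; rewrite F'E /= mulr1.
- by move=> x y _ _ xy; rewrite ltrD2r.
- by rewrite F'E => x _; exact: cvg_cst.
- by rewrite F'E; apply: is_cvg_cst.
- by rewrite F'E; apply: is_cvg_cst.
- split.
  + by move=> x _; case: (dF x).
  + by apply: cvg_at_right_filter; exact: cF.
  + by apply: cvg_at_left_filter; exact: cF.
- exact: continuous_subspaceT.
Qed.

Let cts_int f (a b : R) : continuous f -> mu.-integrable `[a, b] (EFin \o f).
Proof.
move=> cf; apply: continuous_compact_integrable; first exact: segment_compact.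
exact: continuous_subspaceT.
Qed.

Lemma Rintegral_split f (a b c : R) : continuous f -> a <= b -> b <= c ->
  (\int[mu]_(t in `[a, c]) f t)%R =
  (\int[mu]_(t in `[a, b]) f t)%R + (\int[mu]_(t in `[b, c]) f t)%R.
Proof.
move=> cf ab bc.
rewrite (@itv_bndbnd_setU _ _ _ (BRight b))//.
rewrite Rintegral_setU//=.
- congr (_ + _); rewrite Rintegral_itv_obnd_cbnd//.
  apply: (integrableS _ _ _ (cts_int b c cf)) => //.
  by apply: subset_itvr; rewrite bnd_simp.
- by rewrite -(@itv_bndbnd_setU _ _ _ (BRight b))//; exact: cts_int.
- rewrite disj_set2E; apply/eqP/seteqP; split => // x [] /=.
  by rewrite !in_itv/= => /andP[_ xb] /andP[]; rewrite ltNge xb.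
Qed.

(** The bound on [c] makes the translated period cross only one end of the original one, so a single
    piece has to be moved back by [2 * pi]. *)
Lemma avg_shift f (c : R) : continuous f -> (forall t, f (t + 2 * pi) = f t) ->
  - pi <= c <= pi -> avg (fun t => f (t + c)) = avg f.
Proof.
move=> cf pf /andP[c1 c2].
have pi0 := pi_gt0 R.
have per a b a' b' : a <= b -> a' = a + 2 * pi -> b' = b + 2 * pi ->
    (\int[mu]_(t in `[a', b']) f t)%R = (\int[mu]_(t in `[a, b]) f t)%R.
  move=> ab -> ->; rewrite -Rintegral_shift//.
  by apply: eq_Rintegral => x _; rewrite pf.
rewrite /avg; congr (_ * _); rewrite Rintegral_shift//; last lra.
have [c0|c0] := leP 0 c.
  rewrite (@Rintegral_split f (- pi + c) pi (pi + c))//; try lra.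
  rewrite (@Rintegral_split f (- pi) (- pi + c) pi)//; try lra.
  by rewrite addrC; congr (_ + _); apply: per; lra.
rewrite (@Rintegral_split f (- pi + c) (- pi) (pi + c))//; try lra.
rewrite (@Rintegral_split f (- pi) (pi + c) pi)//; try lra.
by rewrite addrC; congr (_ + _); apply/esym/per; lra.
Qed.

End avg_calculus.

(** * Iterated averages over n variables *)

Fixpoint tint {R : realType} (n : nat) : (n.-tuple R -> R) -> R :=
  match n return (n.-tuple R -> R) -> R with
  | 0 => fun f => f [tuple]
  | m.+1 => fun f => avg (fun t => tint (fun s : m.-tuple R => f [tuple of t :: s]))
  end.

Definition setc {R : realType} {n} (v : n.-tuple R) (i : 'I_n) (t : R) : n.-tuple R :=
  [tuple (if j == i then t else tnth v j) | j < n].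

Definition swapc {T : Type} {n} (i j : 'I_n) (v : n.-tuple T) : n.-tuple T :=
  [tuple tnth v (tperm i j k) | k < n].

Section tint.
Context {R : realType}.

Lemma bmeas_cons {d} {T : measurableType d} n (f : T * n.+1.-tuple R -> R) :
  bmeas f -> bmeas (fun z : (T * R) * n.-tuple R => f (z.1.1, [tuple of z.1.2 :: z.2])).
Proof.
move=> hf; apply: (bmeas_comp hf).
apply: measurable_fun_pair; first exact: (measurableT_comp measurable_fst measurable_fst).
apply: measurable_cons => //.
exact: (measurableT_comp measurable_snd measurable_fst).
Qed.

Lemma bmeas_tint n {d} {T : measurableType d} (f : T * n.-tuple R -> R) :
  bmeas f -> bmeas (fun v => tint (fun s => f (v, s))).
Proof.
elim: n d T f => [|n IH] d T f hf /=; first exact: (bmeas_pair2 _ hf).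
by have := bmeas_avg (IH _ _ _ (bmeas_cons hf)).
Qed.

Lemma bmeas_cons1 n (f : n.+1.-tuple R -> R) :
  bmeas f -> bmeas (fun z : R * n.-tuple R => f [tuple of z.1 :: z.2]).
Proof.
by move=> hf; apply: (bmeas_comp hf); exact: measurable_cons.
Qed.

Lemma bmeas_cons2 n (f : n.+1.-tuple R -> R) t :
  bmeas f -> bmeas (fun s : n.-tuple R => f [tuple of t :: s]).
Proof. by move=> /bmeas_cons1 /(bmeas_pair1 t). Qed.

Lemma bmeas_tint_cons n (f : n.+1.-tuple R -> R) : bmeas f ->
  bmeas (fun t => tint (fun s : n.-tuple R => f [tuple of t :: s])).
Proof. by move=> /bmeas_cons1 /bmeas_tint. Qed.

Lemma tint_cst n (c : R) : tint ((fun=> c) : n.-tuple R -> R) = c.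
Proof. by elim: n => [//|n IH] /=; rewrite IH avg_cst. Qed.

Lemma tintD n (f g : n.-tuple R -> R) : bmeas f -> bmeas g ->
  tint (fun v => f v + g v) = tint f + tint g.
Proof.
elim: n f g => [//|n IH] f g hf hg /=.
rewrite -avgD; [|exact: bmeas_tint_cons..].
by congr avg; apply/funext => t; rewrite IH//; exact: bmeas_cons2.
Qed.

Lemma tintZ n (c : R) (f : n.-tuple R -> R) : bmeas f ->
  tint (fun v => c * f v) = c * tint f.
Proof.
elim: n f => [//|n IH] f hf /=.
rewrite -avgZ; last exact: bmeas_tint_cons.
by congr avg; apply/funext => t; rewrite IH//; exact: bmeas_cons2.
Qed.

Lemma tintN n (f : n.-tuple R -> R) : bmeas f ->
  tint (fun v => - f v) = - tint f.
Proof.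
move=> hf; rewrite -mulN1r -tintZ//; congr tint; apply/funext => v.
by rewrite mulN1r.
Qed.

Lemma tintB n (f g : n.-tuple R -> R) : bmeas f -> bmeas g ->
  tint (fun v => f v - g v) = tint f - tint g.
Proof. by move=> hf hg; rewrite -tintN// -tintD//; exact: bmeasN. Qed.

Lemma tint_sum n (I : Type) (r : seq I) (P : pred I) (F : I -> n.-tuple R -> R) :
  (forall i, P i -> bmeas (F i)) ->
  tint (fun v => \sum_(i <- r | P i) F i v) = \sum_(i <- r | P i) tint (F i).
Proof.
move=> hF; elim: r => [|i r IH].
  by under eq_fun do rewrite big_nil; rewrite tint_cst big_nil.
rewrite big_cons -IH; under eq_fun do rewrite big_cons.
case: (boolP (P i)) => // /[dup] Pi /hF hi; rewrite tintD//.
exact: bmeas_sum.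
Qed.

Lemma tint_le n (f g : n.-tuple R -> R) : bmeas f -> bmeas g ->
  (forall v, f v <= g v) -> tint f <= tint g.
Proof.
elim: n f g => [|n IH] f g hf hg fg /=; first exact: fg.
apply: avg_le; [exact: bmeas_tint_cons..|].
by move=> t; apply: IH; try exact: bmeas_cons2.
Qed.

Lemma tint_norm_le n (f : n.-tuple R -> R) M : bmeas f ->
  (forall v, `|f v| <= M) -> `|tint f| <= M.
Proof.
move=> hf fM; rewrite ler_norml -{1}(tint_cst n (- M)) -{2}(tint_cst n M).
apply/andP; split; apply: tint_le => //; try exact: bmeas_cst.
  by move=> t; have := fM t; rewrite ler_norml => /andP[].
by move=> t; have := fM t; rewrite ler_norml => /andP[].
Qed.

Lemma tint_cvg n (f_ : nat -> n.-tuple R -> R) (f : n.-tuple R -> R) (M : R) :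
  (forall k, measurable_fun setT (f_ k)) -> (forall k v, `|f_ k v| <= M) ->
  (forall v, f_ ^~ v @ \oo --> f v) ->
  tint (f_ k) @[k --> \oo] --> tint f.
Proof.
elim: n f_ f => [|n IH] f_ f mf fM ff /=; first exact: ff.
have hf k : bmeas (f_ k) by split => //; exists M.
apply: (@avg_cvg _ _ _ M).
- by move=> k; have [] := bmeas_tint_cons (hf k).
- move=> k t; apply: tint_norm_le => //; exact: bmeas_cons2.
- move=> t; apply: IH => //.
  by move=> k; have [] := bmeas_cons2 t (hf k).
Qed.

Lemma avg_tint n (f : R * n.-tuple R -> R) : bmeas f ->
  avg (fun t => tint (fun s => f (t, s))) = tint (fun s => avg (fun t => f (t, s))).
Proof.
elim: n f => [//|n IH] f hf /=.
rewrite (@avg_swap _ (fun z => tint (fun s => f (z.1, [tuple of z.2 :: s])))) /=.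
  congr avg; apply/funext => t.
  apply: (IH (fun z => f (z.1, [tuple of t :: z.2]))).
  apply: (bmeas_comp hf); apply: measurable_fun_pair => //.
  exact: measurable_cons.
exact: (bmeas_tint (bmeas_cons hf)).
Qed.

Lemma measurable_setc n (i : 'I_n) :
  measurable_fun [set: n.-tuple R * R] (fun z => setc z.1 i z.2).
Proof.
apply/measurable_fun_tnthP => j; rewrite /comp /=.
under eq_fun do rewrite tnth_mktuple.
case: (j == i); first exact: measurable_snd.
exact: (measurableT_comp (measurable_tnth j) measurable_fst).
Qed.

Lemma bmeas_setc n (f : n.-tuple R -> R) (i : 'I_n) : bmeas f ->
  bmeas (fun z : n.-tuple R * R => f (setc z.1 i z.2)).
Proof. by move=> hf; apply: (bmeas_comp hf); exact: measurable_setc. Qed.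

(** The i-th entry of [v] is overwritten by [setc], so averaging over it as well changes nothing.
    Any coordinate can thus be made innermost while all tuples keep length n. *)
Lemma tint_coord n (f : n.-tuple R -> R) (i : 'I_n) : bmeas f ->
  tint f = tint (fun v => avg (fun t => f (setc v i t))).
Proof.
elim: n f i => [f []//|n IH] f i hf /=.
have [->|] := eqVneq i ord0.
  have E (a : R) (s : n.-tuple R) t : setc [tuple of a :: s] ord0 t = [tuple of t :: s].
    apply: eq_from_tnth => j; rewrite tnth_mktuple.
    case: (unliftP ord0 j) => [k|] -> //=.
    by rewrite !tnthS.
  under [in RHS]eq_fun do (under eq_fun do (under eq_fun do rewrite E)).
  rewrite avg_cst; apply: (@avg_tint n (fun z => f [tuple of z.1 :: z.2])).
  exact: bmeas_cons1.
rewrite eq_sym => /unlift_some[k -> _].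
congr avg; apply/funext => a; rewrite (IH _ k); last exact: bmeas_cons2.
congr tint; apply/funext => s; congr avg; apply/funext => t; congr f.
apply: eq_from_tnth => j; rewrite tnth_mktuple.
case: (unliftP ord0 j) => [l|] -> //=.
by rewrite !tnthS tnth_mktuple (inj_eq (@lift_inj _ _)).
Qed.

Lemma tint_eq_coord n (f g : n.-tuple R -> R) (i : 'I_n) : bmeas f -> bmeas g ->
  (forall v, avg (fun t => f (setc v i t)) = avg (fun t => g (setc v i t))) ->
  tint f = tint g.
Proof.
move=> hf hg fg; rewrite (tint_coord i hf) (tint_coord i hg).
by congr tint; apply/funext => v.
Qed.

Lemma measurable_swapc n (i j : 'I_n) :
  measurable_fun [set: n.-tuple R] (swapc i j).
Proof.
apply/measurable_fun_tnthP => k; rewrite /comp /=.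
under eq_fun do rewrite tnth_mktuple.
exact: measurable_tnth.
Qed.

Lemma bmeas_swapc n (f : n.-tuple R -> R) (i j : 'I_n) : bmeas f ->
  bmeas (fun v => f (swapc i j v)).
Proof. by move=> hf; apply: (bmeas_comp hf); exact: measurable_swapc. Qed.

Lemma bmeas_avg_setc n (f : n.-tuple R -> R) (i : 'I_n) : bmeas f ->
  bmeas (fun v => avg (fun t => f (setc v i t))).
Proof. by move=> /bmeas_setc hf; exact: bmeas_avg (hf i). Qed.

(** Once both coordinates are innermost, the transposition is Fubini's theorem in two variables. *)
Lemma tint_swapc n (f : n.-tuple R -> R) (i j : 'I_n) : bmeas f ->
  tint (fun v => f (swapc i j v)) = tint f.
Proof.
move=> hf; have [->|ij] := eqVneq i j.
  congr tint; apply/funext => v; congr f; apply: eq_from_tnth => k.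
  by rewrite tnth_mktuple tperm1 perm1.
rewrite (tint_coord i (bmeas_swapc i j hf)) (tint_coord i hf).
apply: (@tint_eq_coord _ _ _ j); [|exact: bmeas_avg_setc|].
  exact: bmeas_avg_setc (bmeas_swapc i j hf).
move=> v.
rewrite (@avg_swap _ (fun z => f (setc (setc v j z.1) i z.2))) /=.
  congr avg; apply/funext => s; congr avg; apply/funext => t; congr f.
  apply: eq_from_tnth => k; rewrite !tnth_mktuple.
  case: tpermP => [->|->|/eqP/negbTE-> /eqP/negbTE->]; rewrite ?eqxx ?[j == i]eq_sym ?(negbTE ij) //.
apply: (bmeas_comp hf).
apply/measurable_fun_tnthP => k; rewrite /comp /=.
under eq_fun do rewrite !tnth_mktuple.
case: (k == i); first exact: measurable_snd.
by case: (k == j); [exact: measurable_fst|exact: measurable_cst].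
Qed.

Lemma tint_derive n (F F' : n.-tuple R -> R) (i : 'I_n) : bmeas F' ->
  (forall v, continuous (fun t => F' (setc v i t))) ->
  (forall v t, is_derive t (1 : R) (fun t => F (setc v i t)) (F' (setc v i t))) ->
  (forall v, F (setc v i (- pi)) = F (setc v i pi)) ->
  tint F' = 0.
Proof.
move=> hF' cF' dF Fpi; rewrite (tint_coord i hF').
under eq_fun do rewrite (avg_derive (cF' _) (dF _) (Fpi _)).
exact: tint_cst.
Qed.

Lemma tint_shift n (f : n.-tuple R -> R) (c : R) : bmeas f -> - pi <= c <= pi ->
  (forall v i, continuous (fun t => f (setc v i t))) ->
  (forall v i t, f (setc v i (t + 2 * pi)) = f (setc v i t)) ->
  tint (fun v => f (map_tuple (+%R^~ c) v)) = tint f.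
Proof.
move=> hf cpi cf pf.
(* Only the first [k] coordinates are translated, so that each step of the induction on [k] concerns
   one variable. *)
pose sh k (v : n.-tuple R) := [tuple (if (j < k)%N then tnth v j + c else tnth v j) | j < n].
have bsh k : bmeas (fun v => f (sh k v)).
  apply: (bmeas_comp hf); apply/measurable_fun_tnthP => j; rewrite /comp /=.
  under eq_fun do rewrite !tnth_mktuple.
  case: (j < k)%N; last exact: measurable_tnth.
  apply: measurable_funD => //; exact: measurable_tnth.
have -> : tint (fun v => f (map_tuple (+%R^~ c) v)) = tint (fun v => f (sh n v)).
  congr tint; apply/funext => v; congr f; apply: eq_from_tnth => j.
  by rewrite tnth_map tnth_mktuple ltn_ord.
have : forall k, (k <= n)%N -> tint (fun v => f (sh k v)) = tint f.
  elim=> [_|k IH kn].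
    congr tint; apply/funext => v; congr f; apply: eq_from_tnth => j.
    by rewrite tnth_mktuple.
  rewrite -IH 1?ltnW//; apply: (@tint_eq_coord _ _ _ (Ordinal kn)) => // v.
  have E t : sh k (setc v (Ordinal kn) t) = setc (sh k v) (Ordinal kn) t.
    apply: eq_from_tnth => j; rewrite !tnth_mktuple.
    have [->|//] := eqVneq j (Ordinal kn).
    by rewrite ltnn.
  under [in RHS]eq_fun do rewrite E.
  rewrite -(avg_shift (cf _ _) _ cpi)//.
  congr avg; apply/funext => t; congr f.
  apply: eq_from_tnth => j; rewrite !tnth_mktuple.
  have [->|jk] := eqVneq j (Ordinal kn); first by rewrite /= ltnSn.
  have -> : (j < k.+1)%N = (j < k)%N; last by [].
  by rewrite ltnS leq_eqVlt -val_eqE /= in jk *; rewrite (negbTE jk).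
by apply.
Qed.

End tint.

Lemma torus_integralE (R : realType) n (f : n.-tuple R -> R[i]) :
  torus_integral f = tint (fun v => complex.Re (f v)) +i* tint (fun v => complex.Im (f v)).
Proof.
elim: n f => [|n IH] f /=; first by case: (f _).
rewrite (_ : (fun t : R => torus_integral _) = fun t : R =>
    tint (fun s : n.-tuple R => complex.Re (f [tuple of t :: s])) +i*
    tint (fun s : n.-tuple R => complex.Im (f [tuple of t :: s]))); last first.
  by apply/funext => t; exact: IH.
by rewrite /Cintegral /avg /=; simpc.
Qed.

(** * The weight and its integrations by parts *)

Definition chord2 {R : realType} (t : R) : R := 2 - 2 * cos t.

(* Every unordered pair occurs twice in the second product, whence lam / 2. *)
Definition cwt {R : realType} n (a lam e : R) (v : n.-tuple R) : R :=
  (\prod_(j < n) (chord2 (tnth v j) + e) `^ a) *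
  \prod_(j < n) \prod_(k < n | k != j) (chord2 (tnth v j - tnth v k) + e) `^ (lam / 2).

(** The logarithmic derivative of [chord2 t + e]. For [e = 0] it is the cotangent of [t / 2], whose
    pole the regularisation removes. *)
Definition cotr {R : realType} (e t : R) : R := 2 * sin t / (chord2 t + e).

(** The logarithmic derivative of [cwt] in the i-th variable; see [is_derive_cwt]. *)
Definition score {R : realType} n (a lam e : R) (i : 'I_n) (v : n.-tuple R) : R :=
  a * cotr e (tnth v i) + lam * \sum_(k < n | k != i) cotr e (tnth v i - tnth v k).

Section chord2.
Context {R : realType}.
Implicit Types t x : R.

Lemma chord2_ge0 t : 0 <= chord2 t.
Proof. by rewrite /chord2; have := cos_le1 t; lra. Qed.

Lemma chord2_le4 t : chord2 t <= 4.
Proof. by rewrite /chord2; have := cos_geN1 t; lra. Qed.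

Lemma chord2N t : chord2 (- t) = chord2 t.
Proof. by rewrite /chord2 cosN. Qed.

Lemma cotrN e t : cotr e (- t) = - cotr e t.
Proof. by rewrite /cotr chord2N sinN mulrN mulNr. Qed.

Lemma continuous_chord2 : continuous (@chord2 R).
Proof.
move=> t; apply: cvgB; first exact: cvg_cst.
by apply: cvgM; [exact: cvg_cst|exact: continuous_cos].
Qed.

Lemma is_derive_chord2 t : is_derive t (1:R) chord2 (2 * sin t).
Proof.
rewrite /chord2; apply: is_derive_eq.
by rewrite !(scaler0, add0r, addr0) /GRing.scale /=; ring.
Qed.

Lemma is_derive_powR_log (f : R -> R) (t p d : R) : 0 < f t ->
  is_derive t (1:R) f (f t * d) ->
  is_derive t (1:R) (fun s => f s `^ p) (f t `^ p * (p * d)).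
Proof.
move=> ft hf.
have := is_derive1_comp (is_derive1_powR p ft) hf.
rewrite /comp => h; apply: is_derive_eq.
have E : f t `^ (p - 1) * f t = f t `^ p.
  by rewrite -[X in _ * X](powRr1 (ltW ft)) -powRD ?subrK// (gt_eqF ft) implybT.
by rewrite -E; ring.
Qed.

(** Derivatives are kept in the form value times logarithmic derivative: the latter add up in a
    product, and no factor has to be divided out, even where it vanishes. *)
Lemma is_derive_prod_log (I : Type) (r : seq I) (P : pred I) (F : I -> R -> R)
    (G : I -> R) t :
  (forall i, P i -> is_derive t (1:R) (F i) (F i t * G i)) ->
  is_derive t (1:R) (fun s => \prod_(i <- r | P i) F i s)
    (\prod_(i <- r | P i) F i t * \sum_(i <- r | P i) G i).
Proof.
move=> hF; elim: r => [|i r IH].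
  rewrite !big_nil mulr0; under eq_fun do rewrite big_nil.
  exact: is_derive_cst.
rewrite !big_cons; under eq_fun do rewrite big_cons.
case: (boolP (P i)) => // /hF Fi.
apply: (is_derive_eq (is_deriveM Fi IH)); rewrite /GRing.scale /=; ring.
Qed.

End chord2.

Section nice.
Context {R : realType} {n : nat}.
Implicit Types f g : n.-tuple R -> R.

(** Continuity in each variable separately is what the fundamental theorem of calculus in one
    variable asks for. *)
Definition ccont f := forall v i, continuous (fun t => f (setc v i t)).

Definition nice f := bmeas f /\ ccont f.

Lemma nice_cst c : nice (fun=> c).
Proof. by split; [exact: bmeas_cst|move=> v i t; exact: cvg_cst]. Qed.

Lemma niceD f g : nice f -> nice g -> nice (fun v => f v + g v).
Proof.
move=> [bf cf] [bg cg]; split; first exact: bmeasD.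
by move=> v i t; apply: cvgD; [exact: cf|exact: cg].
Qed.

Lemma niceM f g : nice f -> nice g -> nice (fun v => f v * g v).
Proof.
move=> [bf cf] [bg cg]; split; first exact: bmeasM.
by move=> v i t; apply: cvgM; [exact: cf|exact: cg].
Qed.

Lemma niceN f : nice f -> nice (fun v => - f v).
Proof.
move=> [bf cf]; split; first exact: bmeasN.
by move=> v i t; apply: cvgN; exact: cf.
Qed.

Lemma niceB f g : nice f -> nice g -> nice (fun v => f v - g v).
Proof. by move=> hf hg; apply: niceD => //; exact: niceN. Qed.

Lemma nice_sum (I : Type) (r : seq I) (P : pred I) (F : I -> n.-tuple R -> R) :
  (forall i, P i -> nice (F i)) -> nice (fun x => \sum_(i <- r | P i) F i x).
Proof.
move=> hF; elim: r => [|i r IH].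
  by under eq_fun do rewrite big_nil; exact: nice_cst.
under eq_fun do rewrite big_cons.
by case: (boolP (P i)) => // /hF hi; exact: niceD.
Qed.

Lemma nice_prod (I : Type) (r : seq I) (P : pred I) (F : I -> n.-tuple R -> R) :
  (forall i, P i -> nice (F i)) -> nice (fun x => \prod_(i <- r | P i) F i x).
Proof.
move=> hF; elim: r => [|i r IH].
  by under eq_fun do rewrite big_nil; exact: nice_cst.
under eq_fun do rewrite big_cons.
by case: (boolP (P i)) => // /hF hi; exact: niceM.
Qed.

(* Composition of a bounded continuous function of one variable with a
   measurable one; the coordinates themselves are not bounded. *)
Lemma nice_comp (phi : R -> R) f (M : R) :
  continuous phi -> (forall x, `|phi x| <= M) ->
  measurable_fun setT f -> ccont f -> nice (fun v => phi (f v)).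
Proof.
move=> cphi phiM mf cf; split.
  split; last by exists M.
  exact: measurableT_comp (continuous_measurable_fun cphi) mf.
move=> v i t; apply: (@continuous_comp _ _ _ (fun t => f (setc v i t)) phi).
  exact: cf.
exact: cphi.
Qed.

Lemma ccont_tnth j : ccont (@tnth n R ^~ j).
Proof.
move=> v i t; under eq_fun do rewrite tnth_mktuple.
by case: (j == i); [exact: cvg_id|exact: cvg_cst].
Qed.

Lemma ccont_tnthB j k : ccont (fun v : n.-tuple R => tnth v j - tnth v k).
Proof. by move=> v i t; apply: cvgB; exact: ccont_tnth. Qed.

Lemma measurable_tnthB j k :
  measurable_fun setT (fun v : n.-tuple R => tnth v j - tnth v k).
Proof. by apply: measurable_funB; exact: measurable_tnth. Qed.

Lemma nice_cos_tnth j : nice (fun v => cos (tnth v j)).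
Proof.
apply: (@nice_comp (@cos R) _ 1); [exact: continuous_cos| |exact: measurable_tnth|exact: ccont_tnth].
by move=> x; rewrite ler_norml cos_geN1 cos_le1.
Qed.

Lemma nice_sin_tnth j : nice (fun v => sin (tnth v j)).
Proof.
apply: (@nice_comp (@sin R) _ 1); [exact: continuous_sin| |exact: measurable_tnth|exact: ccont_tnth].
by move=> x; rewrite ler_norml sin_geN1 sin_le1.
Qed.

Lemma nice_chord2_tnth j : nice (fun v => chord2 (tnth v j)).
Proof.
apply: (@nice_comp (@chord2 R) _ 4); [exact: continuous_chord2| |exact: measurable_tnth|exact: ccont_tnth].
by move=> x; rewrite ger0_norm ?chord2_ge0 ?chord2_le4.
Qed.

End nice.

(** Taking [|x|] makes the power continuous on the whole line, 0 included; as [chord2 + e] is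
    nonnegative, the absolute value can be inserted freely in [ccont_cwt]. The exponent 0 is treated
    apart because 0 to the power 0 is 1. *)
Lemma continuous_norm_powR {R : realType} (p : R) : 0 <= p ->
  continuous (fun x : R => `|x| `^ p).
Proof.
rewrite le_eqVlt => /predU1P[<-|p0] x.
  by under eq_fun do rewrite powRr0; exact: cvg_cst.
have [->|x0] := eqVneq x 0.
  rewrite /continuous_at normr0 powR0 ?gt_eqF//; apply/cvgr0Pnorm_lt => e e0.
  have d0 : 0 < e `^ p^-1 by rewrite powR_gt0.
  have H : \forall y \near (0:R), `|y| < e `^ p^-1 by exact: nbhs0_lt.
  apply: filterS H => y hy; rewrite ger0_norm ?powR_ge0//.
  have -> : e = (e `^ p^-1) `^ p by rewrite -powRrM mulVf ?gt_eqF// powRr1// ltW.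
  by rewrite gt0_ltr_powR// ?nnegrE ?normr_ge0 ?powR_ge0.
apply: (@continuous_comp _ _ _ (fun y : R => `|y|) (fun y : R => y `^ p)).
  exact: norm_continuous.
apply: differentiable_continuous; apply/derivable1_diffP; apply: derivable_powR.
by rewrite in_itv/= normr_gt0 x0.
Qed.

Section cwt.
Context {R : realType} {n : nat} (a lam : R) (a0 : 0 <= a) (lam0 : 0 < lam).
Implicit Types (v : n.-tuple R) (e : R).
Local Notation cwt := (@cwt R n a lam).
Local Notation score := (@score R n a lam).

(** The constant is 4 + 1, from [chord2 <= 4] and [e <= 1]. A bound independent of [e] is what
    dominated convergence asks for as [e] tends to 0. *)
Let pow_chord2_le (p e x : R) : 0 <= p -> 0 <= e <= 1 ->
  `|(chord2 x + e) `^ p| <= 5 `^ p.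
Proof.
move=> p0 /andP[e0 e1]; rewrite ger0_norm ?powR_ge0//.
have h1 := chord2_ge0 x; have h2 := chord2_le4 x.
by apply: ge0_ler_powR => //; rewrite ?nnegrE; lra.
Qed.

Let lam20 : 0 <= lam / 2. Proof. by rewrite divr_ge0// ltW. Qed.

Let cwt_bound : R := (\prod_(j < n) 5 `^ a) * \prod_(j < n) \prod_(k < n | k != j) 5 `^ (lam / 2).

Lemma cwt_le e v : 0 <= e <= 1 -> `|cwt e v| <= cwt_bound.
Proof.
move=> he; rewrite /cwt normrM !normr_prod ler_pM//.
- by apply: prodr_ge0.
- by apply: prodr_ge0.
- by apply: ler_prod => i _; rewrite normr_ge0 pow_chord2_le.
- apply: ler_prod => i _; rewrite normr_ge0 normr_prod.
  by apply: ler_prod => j _; rewrite normr_ge0 pow_chord2_le.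
Qed.

Lemma bmeas_cwt e : 0 <= e <= 1 -> bmeas (cwt e).
Proof.
move=> he.
have mp (p : R) (f : n.-tuple R -> R) : 0 <= p -> measurable_fun setT f ->
    bmeas (fun v => (chord2 (f v) + e) `^ p).
  move=> p0 mf; split; last by exists (5 `^ p) => x; exact: pow_chord2_le.
  apply: (measurableT_comp (@measurable_powR R p)).
  apply: measurable_funD => //.
  exact: measurableT_comp (continuous_measurable_fun continuous_chord2) mf.
rewrite /cwt; apply: bmeasM.
  by apply: bmeas_prod => i _; apply: mp => //; exact: measurable_tnth.
apply: bmeas_prod => i _; apply: bmeas_prod => j _; apply: mp => //.
exact: measurable_tnthB.
Qed.

Lemma ccont_cwt e : 0 <= e -> ccont (cwt e).
Proof.
move=> e0.
have mp (p : R) (f : n.-tuple R -> R) : 0 <= p -> ccont f ->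
    ccont (fun v => (chord2 (f v) + e) `^ p).
  move=> p0 cf v i t.
  have -> : (fun t => (chord2 (f (setc v i t)) + e) `^ p) =
      (fun t => `|chord2 (f (setc v i t)) + e| `^ p).
    by apply/funext => s; rewrite ger0_norm// addr_ge0// chord2_ge0.
  apply: (@continuous_comp _ _ _ (fun t => chord2 (f (setc v i t)) + e) (fun x : R => `|x| `^ p)).
    apply: cvgD; last exact: cvg_cst.
    apply: (@continuous_comp _ _ _ (fun t => (f (setc v i t))) chord2); first exact: cf.
    exact: continuous_chord2.
  exact: continuous_norm_powR.
have hprod (I : Type) (r : seq I) (P : pred I) (F : I -> n.-tuple R -> R) :
    (forall i, ccont (F i)) -> ccont (fun x => \prod_(i <- r | P i) F i x).
  move=> hF v j t; elim: r => [|i r IH].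
    by under eq_fun do rewrite big_nil; exact: cvg_cst.
  under eq_fun do rewrite big_cons.
  case: (boolP (P i)) => // _; apply: cvgM => //; exact: hF.
have h1 := hprod _ (index_enum 'I_n) xpredT _ (fun j => mp a _ a0 (@ccont_tnth R n j)).
have h2 := hprod _ (index_enum 'I_n) xpredT _ (fun j =>
  hprod _ (index_enum 'I_n) (fun k => k != j) _ (fun k => mp (lam / 2) _ lam20 (@ccont_tnthB R n j k))).
by move=> v i t; apply: cvgM; [exact: h1|exact: h2].
Qed.

Lemma cwt_nice e : 0 <= e <= 1 -> nice (cwt e).
Proof.
by move=> /[dup] he /andP[e0 _]; split; [exact: bmeas_cwt|exact: ccont_cwt].
Qed.

Lemma cwt_swapc e i j v : cwt e (swapc i j v) = cwt e v.
Proof.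
rewrite /cwt; congr (_ * _).
  rewrite [RHS](reindex_inj (@perm_inj _ (tperm i j))) /=.
  by apply: eq_bigr => k _; rewrite tnth_mktuple.
rewrite [RHS](reindex_inj (@perm_inj _ (tperm i j))) /=.
apply: eq_bigr => k _.
rewrite [RHS](reindex_inj (@perm_inj _ (tperm i j))) /=.
apply: eq_big => [l|l _]; first by rewrite (inj_eq perm_inj).
by rewrite !tnth_mktuple.
Qed.

Let d_tnth i (v : n.-tuple R) j (t : R) : is_derive t (1:R) (fun s => tnth (setc v i s) j) (j == i)%:R.
Proof.
under eq_fun do rewrite tnth_mktuple.
by case: (j == i); [exact: is_derive_id|exact: is_derive_cst].
Qed.

Lemma is_derive_cwt e i v t : 0 < e ->
  is_derive t (1:R) (fun s => cwt e (setc v i s))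
    (cwt e (setc v i t) * score e i (setc v i t)).
Proof.
move=> e0; rewrite /cwt.
have key (f : R -> R) (d p : R) : is_derive t (1:R) f d ->
    is_derive t (1:R) (fun s => (chord2 (f s) + e) `^ p)
     ((chord2 (f t) + e) `^ p * (p * (cotr e (f t) * d))).
  move=> hf; apply: (@is_derive_powR_log _ (fun s => chord2 (f s) + e)).
    by have := chord2_ge0 (f t); lra.
  have h := is_derive1_comp (is_derive_chord2 (f t)) hf.
  apply: (is_derive_eq (is_deriveD h (is_derive_cst e t 1))); rewrite /cotr addr0; field.
  by have := chord2_ge0 (f t); lra.
have h1 := @is_derive_prod_log R 'I_n (index_enum _) xpredT
  (fun j s => (chord2 (tnth (setc v i s) j) + e) `^ a) _ t
  (fun j _ => key _ _ a (d_tnth i v j t)).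
have h2 := @is_derive_prod_log R 'I_n (index_enum _) xpredT _ _ t (fun j _ =>
  @is_derive_prod_log R 'I_n (index_enum _) (fun k => k != j)
  (fun k s => (chord2 (tnth (setc v i s) j - tnth (setc v i s) k) + e) `^ (lam / 2)) _ t
  (fun k _ => key _ _ (lam / 2) (is_deriveB (d_tnth i v j t) (d_tnth i v k t)))).
apply: (is_derive_eq (is_deriveM h1 h2)).
rewrite /GRing.scale /=.
set P1 := \prod_(j < n) _; set P2 := \prod_(j < n) _.
rewrite [P2 * (P1 * _)]mulrCA -mulrDr -mulrDr -[RHS]mulrA.
do 2 congr (_ * _).
rewrite addrC /score; congr (_ + _).
  rewrite (bigD1 i)//= eqxx mulr1 big1 ?addr0// => j /negbTE ->.
  by rewrite !mulr0.
set c := fun j k => cotr e (tnth (setc v i t) j - tnth (setc v i t) k).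
have cN j k : c j k = - c k j by rewrite /c -cotrN opprB.
(* The i-th variable occurs in row [i] and in column [i] of the double product; as [cotr] is odd
   both contribute the same sum, and the two halves restore [lam]. *)
rewrite (bigD1 i)//=.
rewrite [X in X + _](_ : _ = lam / 2 * \sum_(k < n | k != i) c i k); last first.
  rewrite mulr_sumr; apply: eq_bigr => k /negbTE ->.
  by rewrite eqxx subr0 mulr1.
rewrite [X in _ + X](_ : _ = lam / 2 * \sum_(k < n | k != i) c i k); last first.
  rewrite mulr_sumr; apply: eq_bigr => j ji.
  rewrite (bigD1 i) /=; last by rewrite eq_sym.
  rewrite big1 => [|k /andP[kj /negbTE ki]].
    by rewrite (negbTE ji) eqxx addr0 sub0r mulrN1 -/(c j i) cN opprK.
  by rewrite (negbTE ji) ki subrr !mulr0.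
by rewrite -mulrDl -splitr.
Qed.

End cwt.

Lemma cvg_bigprod {R : realType} (I : Type) (r : seq I) (P : pred I) (F : I -> nat -> R) (l : I -> R) :
  (forall i, P i -> F i @ \oo --> l i) ->
  (\prod_(i <- r | P i) F i k) @[k --> \oo] --> \prod_(i <- r | P i) l i.
Proof. by apply: cvg_big; exact: mul_continuous. Qed.

Lemma cvg_bigsum {R : realType} (I : Type) (r : seq I) (P : pred I) (F : I -> nat -> R) (l : I -> R) :
  (forall i, P i -> F i @ \oo --> l i) ->
  (\sum_(i <- r | P i) F i k) @[k --> \oo] --> \sum_(i <- r | P i) l i.
Proof. by apply: cvg_big; exact: add_continuous. Qed.

(** * Integration by parts in the limit of vanishing regularisation *)

Section aomoto.
Context {R : realType} {n : nat} (a lam : R) (a0 : 0 <= a) (lam0 : 0 < lam).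
Implicit Types (v : n.-tuple R) (f g : n.-tuple R -> R).
Local Notation cwt := (@cwt R n a lam).

(** The regularisation runs through a sequence, to fit dominated convergence; its values lie in ]0,
    1], where the bound on the weight is uniform. *)
Let ek (k : nat) : R := k.+1%:R^-1.

Let ek_gt0 k : 0 < ek k. Proof. by rewrite /ek invr_gt0 ltr0n. Qed.

Let ek_itv k : 0 < ek k <= 1.
Proof. by rewrite ek_gt0 /ek invf_le1 ?ltr0n// ler1n. Qed.

Let ek_itvW k : 0 <= ek k <= 1.
Proof. by have /andP[h ->] := ek_itv k; rewrite ltW. Qed.

Let ek_cvg : ek @ \oo --> 0. Proof. exact: cvg_harmonic. Qed.

Let powR_ek (p x : R) : 0 <= p -> 0 <= x -> (x + ek k) `^ p @[k --> \oo] --> x `^ p.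
Proof.
move=> p0; rewrite le_eqVlt => /predU1P[<-|x0].
  under eq_fun do rewrite add0r.
  have [->|pn0] := eqVneq p 0.
    by under eq_fun do rewrite powRr0; rewrite powRr0; exact: cvg_cst.
  rewrite powR0//; apply: (@cvg_comp _ _ _ ek (fun x : R => x `^ p) _ (0^'+)); last first.
    by apply: powR_cvg0; rewrite lt0r pn0.
  move=> A hA.
  have H : \forall k \near \oo, 0 < ek k -> A (ek k) by exact: ek_cvg hA.
  change (\forall k \near \oo, A (ek k)).
  by apply: filterS H => k; apply; exact: ek_gt0.
have cp : {for x, continuous (fun x : R => x `^ p)}.
  apply: differentiable_continuous; apply/derivable1_diffP; apply: derivable_powR.
  by rewrite in_itv/= x0.
apply: (@continuous_cvg _ _ _ _ _ (fun k => x + ek k) (fun x : R => x `^ p)) => //.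
have : x + ek k @[k --> \oo] --> x + 0.
  by apply: cvgD; [exact: cvg_cst|exact: ek_cvg].
by rewrite addr0.
Qed.

Let lam20 : 0 <= lam / 2. Proof. by rewrite divr_ge0// ltW. Qed.

Let cwt_cvg v : cwt (ek k) v @[k --> \oo] --> cwt 0 v.
Proof.
rewrite /cwt; apply: cvgM.
  by apply: cvg_bigprod => i _; rewrite addr0; apply: powR_ek => //; exact: chord2_ge0.
apply: cvg_bigprod => i _; apply: cvg_bigprod => j _; rewrite addr0.
by apply: powR_ek => //; exact: chord2_ge0.
Qed.

Lemma tint_cwt_cvg f : bmeas f ->
  tint (fun v => f v * cwt (ek k) v) @[k --> \oo] --> tint (fun v => f v * cwt 0 v).
Proof.
move=> [mf [M fM]].
have [B hB] : exists B, forall k v, `|cwt (ek k) v| <= B.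
  by eexists => k v; apply: cwt_le.
apply: (@tint_cvg _ _ _ _ (M * B)).
- move=> k; apply: measurable_funM => //.
  by have [] := @bmeas_cwt R n a lam a0 lam0 (ek k) (ek_itvW k).
- by move=> k v; rewrite normrM ler_pM.
- by move=> v; apply: cvgZr; exact: cwt_cvg.
Qed.

(* The regularised kernel chord2 / (chord2 + e) is bounded by 1; where its
   limit is not 1 the weight vanishes. *)
Lemma tint_kernel_cvg f (c : n.-tuple R -> R) : bmeas f -> measurable_fun setT c ->
  (forall v, chord2 (c v) = 0 -> cwt 0 v = 0) ->
  tint (fun v => f v * (chord2 (c v) / (chord2 (c v) + ek k)) * cwt (ek k) v)
    @[k --> \oo] --> tint (fun v => f v * cwt 0 v).
Proof.
move=> [mf [M fM]] mc hc.
have [B hB] : exists B, forall k v, `|cwt (ek k) v| <= B.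
  by eexists => k v; apply: cwt_le.
have mch : measurable_fun setT (fun v => chord2 (c v)).
  exact: measurableT_comp (continuous_measurable_fun continuous_chord2) mc.
apply: (@tint_cvg _ _ _ _ (M * B)).
- move=> k; apply: measurable_funM => //; last first.
    by have [] := @bmeas_cwt R n a lam a0 lam0 (ek k) (ek_itvW k).
  apply: measurable_funM => //; apply: measurable_funM => //.
  rewrite (_ : (fun v => _) = fun v => (chord2 (c v) + ek k) `^ (-1)); last first.
    by apply/funext => v; rewrite powR_inv1// addr_ge0 ?chord2_ge0// ltW.
  apply: (measurableT_comp (@measurable_powR R (-1))).
  by apply: measurable_funD.
- move=> k v; rewrite normrM ler_pM// normrM -[leRHS]mulr1 ler_pM//.
  have h1 := chord2_ge0 (c v); have h2 := ek_gt0 k.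
  by rewrite ger0_norm ?divr_ge0 ?ler_pdivrMr ?mul1r; lra.
- move=> v; have [h|h] := eqVneq (chord2 (c v)) 0.
    under eq_fun do rewrite h mul0r mulr0 mul0r.
    by rewrite hc// mulr0; exact: cvg_cst.
  apply: cvgM; last exact: cwt_cvg.
  rewrite -[X in _ --> X]mulr1; apply: cvgM; first exact: cvg_cst.
  rewrite -[X in _ --> X](divff h); apply: cvgM; first exact: cvg_cst.
  apply: cvgV => //; rewrite -[X in _ --> X]addr0.
  by apply: cvgD; [exact: cvg_cst|exact: ek_cvg].
Qed.

Let cwt0_edge v i : 0 < a -> chord2 (tnth v i) = 0 -> cwt 0 v = 0.
Proof.
move=> a_gt0 h; rewrite /cwt (bigD1 i)//= h addr0 powR0 ?mul0r//.
by rewrite gt_eqF.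
Qed.

Let cwt0_diag v i k : k != i -> chord2 (tnth v i - tnth v k) = 0 -> cwt 0 v = 0.
Proof.
move=> ki h; rewrite /cwt [X in _ * X](bigD1 i)//= [X in _ * (X * _)](bigD1 k)//= h addr0 powR0.
  by rewrite !mul0r mulr0.
by rewrite gt_eqF// divr_gt0.
Qed.

Let nice_cotr e (c : n.-tuple R -> R) : 0 < e -> measurable_fun setT c -> ccont c ->
  nice (fun v => cotr e (c v)).
Proof.
move=> e0 mc cc; apply: (@nice_comp _ _ (cotr e) _ (2 / e)) => //.
  move=> t; rewrite /cotr; apply: cvgM.
    by apply: cvgM; [exact: cvg_cst|exact: continuous_sin].
  apply: cvgV; first by rewrite gt_eqF//; have := chord2_ge0 t; lra.
  by apply: cvgD; [exact: continuous_chord2|exact: cvg_cst].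
move=> x; rewrite /cotr normrM ler_pM//.
  rewrite normrM (@ger0_norm _ 2)// -[leRHS]mulr1 ler_pM2l//.
  by rewrite ler_norml sin_geN1 sin_le1.
have h := chord2_ge0 x.
by rewrite normfV lef_pV2 ?posrE ?normr_gt0 ?ger0_norm; lra.
Qed.

Let nice_score e i : 0 < e -> nice (@score R n a lam e i).
Proof.
move=> e0; apply: niceD; apply: niceM; try exact: nice_cst.
  by apply: nice_cotr => //; [exact: measurable_tnth|exact: ccont_tnth].
apply: nice_sum => k _.
by apply: nice_cotr => //; [exact: measurable_tnthB|exact: ccont_tnthB].
Qed.

Definition periodic_in (f : n.-tuple R -> R) (i : 'I_n) :=
  forall v, f (setc v i (- pi)) = f (setc v i pi).

Definition partial_in (f f' : n.-tuple R -> R) (i : 'I_n) :=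
  forall v t, is_derive t (1 : R) (fun s => f (setc v i s)) (f' (setc v i t)).

Let cwt_periodic e i : periodic_in (cwt e) i.
Proof.
move=> v; rewrite /cwt.
have E j : chord2 (tnth (setc v i (- pi)) j) = chord2 (tnth (setc v i pi) j).
  by rewrite !tnth_mktuple; case: ifP; rewrite // chord2N.
have E2 j k : chord2 (tnth (setc v i (- pi)) j - tnth (setc v i (- pi)) k)
            = chord2 (tnth (setc v i pi) j - tnth (setc v i pi) k).
  rewrite !tnth_mktuple; case: ifP => _; case: ifP => _ //; rewrite ?subrr//.
    rewrite /chord2 !cosB sinN cosN sinpi; ring.
  rewrite /chord2 !cosB sinN cosN sinpi; ring.
congr (_ * _); first by apply: eq_bigr => j _; rewrite E.
by apply: eq_bigr => j _; apply: eq_bigr => k _; rewrite E2.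
Qed.

Let tint_ibp e f f' i : 0 < e <= 1 -> nice f -> nice f' -> partial_in f f' i ->
  periodic_in f i ->
  tint (fun v => f' v * cwt e v + f v * (cwt e v * score a lam e i v)) = 0.
Proof.
move=> he hf hf' df pf; have /andP[e0 e1] := he.
have hw : nice (cwt e) by apply: cwt_nice; rewrite // e1 ltW.
have hs := nice_score i e0.
have [hb hc] : nice (fun v => f' v * cwt e v + f v * (cwt e v * score a lam e i v)).
  by apply: niceD; apply: niceM => //; apply: niceM.
apply: (@tint_derive _ _ (fun v => f v * cwt e v) _ i) => //.
  move=> v t; apply: (is_derive_eq (is_deriveM (df v t) (is_derive_cwt a lam i v t e0))).
  by rewrite /GRing.scale /=; ring.
by move=> v; rewrite pf cwt_periodic.
Qed.

(* Symmetrising in i and k replaces f by the divided difference h k, so that no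
   singular kernel survives as the regularisation tends to 0. *)
Lemma aomoto f f' g (h : 'I_n -> n.-tuple R -> R) i :
  nice f -> nice f' -> bmeas g -> (forall k, bmeas (h k)) ->
  partial_in f f' i -> periodic_in f i ->
  (0 < a -> forall v, f v * (2 * sin (tnth v i)) = chord2 (tnth v i) * g v) ->
  (forall k v, k != i -> (f v - f (swapc i k v)) * (2 * sin (tnth v i - tnth v k)) =
     chord2 (tnth v i - tnth v k) * h k v) ->
  tint (fun v => f' v * cwt 0 v) + a * tint (fun v => g v * cwt 0 v) +
  lam / 2 * \sum_(k < n | k != i) tint (fun v => h k v * cwt 0 v) = 0.
Proof.
move=> hf hf' hg hh df pf fg fh.
pose T m : R := tint (fun v => f' v * cwt (ek m) v) +
  a * tint (fun v => g v * (chord2 (tnth v i) / (chord2 (tnth v i) + ek m)) * cwt (ek m) v) +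
  lam / 2 * \sum_(k < n | k != i) tint (fun v => h k v *
    (chord2 (tnth v i - tnth v k) / (chord2 (tnth v i - tnth v k) + ek m)) * cwt (ek m) v).
have T0 m : T m = 0.
  rewrite -(tint_ibp (ek_itv m) hf hf' df pf).
  have e0 := ek_gt0 m; set e := ek m in e0 *.
  have bw : bmeas (cwt e) by apply: bmeas_cwt; rewrite // ek_itvW.
  have bc k : bmeas (fun v => cotr e (tnth v i - tnth v k)).
    by apply: (nice_cotr _ _ _).1 => //; [exact: measurable_tnthB|exact: ccont_tnthB].
  have bci : bmeas (fun v => cotr e (tnth v i)).
    by apply: (nice_cotr _ _ _).1 => //; [exact: measurable_tnth|exact: ccont_tnth].
  have bf := hf.1; have bf' := hf'.1.
  rewrite (_ : (fun v => _ + _) = fun v => f' v * cwt e v +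
     (a * (f v * cotr e (tnth v i) * cwt e v) +
      lam * \sum_(k < n | k != i) (f v * cotr e (tnth v i - tnth v k) * cwt e v))); last first.
    apply/funext => v; congr (_ + _); rewrite /score.
    under [in RHS]eq_bigr do rewrite -mulrA [_ * cwt _ _]mulrC mulrA.
    by rewrite -mulr_sumr; ring.
  have b1 : bmeas (fun v => f v * cotr e (tnth v i) * cwt e v).
    by apply: bmeasM => //; apply: bmeasM.
  have b2 k : bmeas (fun v => f v * cotr e (tnth v i - tnth v k) * cwt e v).
    by apply: bmeasM => //; apply: bmeasM.
  have b3 : bmeas (fun v => \sum_(k < n | k != i) (f v * cotr e (tnth v i - tnth v k) * cwt e v)).
    exact: bmeas_sum.
  rewrite tintD; [|exact: bmeasM|by apply: bmeasD; apply: bmeasM => //; exact: bmeas_cst].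
  rewrite tintD; [|by apply: bmeasM => //; exact: bmeas_cst..].
  rewrite !tintZ// tint_sum// /T -addrA; congr (_ + _); congr (_ + _).
    (* For [a = 0] the weight does not vanish at the edge and nothing is assumed about [g]; the
       factor [a] removes the term. *)
    move: a0; rewrite le_eqVlt => /predU1P[<-|a_gt0]; first by rewrite !mul0r.
    congr (a * tint _); apply/funext => v; congr (_ * _).
    by rewrite /cotr [LHS]mulrA [RHS]mulrA fg// [g v * _]mulrC.
  rewrite -mulrA mulr_sumr; congr (_ * _); apply: eq_bigr => k ki.
  (* The weight is symmetric and the kernel odd; averaging the integral with its image under the
     transposition accounts for the factor 1/2 in [lam / 2]. *)
  have := tint_swapc i k (b2 k).
  under eq_fun => v.
    rewrite cwt_swapc !tnth_mktuple tpermL tpermR -opprB cotrN.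
    over.
  move=> sw.
  have bs := bmeas_swapc i k bf.
  rewrite [RHS](_ : _ = 2^-1 * (tint (fun v => f v * cotr e (tnth v i - tnth v k) * cwt e v) +
     tint (fun v => f v * cotr e (tnth v i - tnth v k) * cwt e v))); last first.
    by lra.
  rewrite -{2}sw -tintD//; last first.
    by apply: bmeasM => //; apply: bmeasM => //; exact: bmeasN.
  congr (_ * tint _); apply/funext => v.
  rewrite -mulrDl; congr (_ * _).
  by rewrite mulrN -mulrBl /cotr [LHS]mulrA [RHS]mulrA fh// [h k v * _]mulrC.
have : T @ \oo --> tint (fun v => f' v * cwt 0 v) + a * tint (fun v => g v * cwt 0 v) +
    lam / 2 * \sum_(k < n | k != i) tint (fun v => h k v * cwt 0 v).
  apply: cvgD; first apply: cvgD.
  - by apply: tint_cwt_cvg; exact: hf'.1.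
  - move: a0; rewrite le_eqVlt => /predU1P[a00|a_gt0].
      by rewrite -a00; under eq_fun do rewrite mul0r; rewrite mul0r; exact: cvg_cst.
    apply: cvgZr; apply: tint_kernel_cvg => //; first exact: measurable_tnth.
    by move=> v; exact: cwt0_edge.
  - apply: cvgZr; apply: cvg_bigsum => k ki; apply: tint_kernel_cvg => //.
      exact: measurable_tnthB.
    by move=> v; exact: cwt0_diag.
rewrite (_ : T = fun=> 0); last by apply/funext => m; exact: T0.
by move=> hT; apply/esym; apply: (@cvg_unique _ (@Rhausdorff R) _ _ _ _ (cvg_cst 0)) hT.
Qed.

(* For a = 0 the weight is rotation invariant: its partial derivatives add up to 0. *)
Lemma tint_rotation f (f' : 'I_n -> n.-tuple R -> R) : a = 0 ->
  nice f -> (forall i, nice (f' i)) ->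
  (forall i, partial_in f (f' i) i) -> (forall i, periodic_in f i) ->
  \sum_(i < n) tint (fun v => f' i v * cwt 0 v) = 0.
Proof.
move=> a00 hf hf' df pf.
pose T m : R := \sum_(i < n) tint (fun v => f' i v * cwt (ek m) v).
have T0 m : T m = 0.
  have e0 := ek_gt0 m; rewrite /T; set e := ek m in e0 *.
  have bw : bmeas (cwt e) by apply: bmeas_cwt; rewrite // ek_itvW.
  have bf := hf.1.
  have bs i : bmeas (fun v => f v * (cwt e v * score a lam e i v)).
    by apply: bmeasM => //; apply: bmeasM => //; exact: (nice_score _ _).1.
  have : \sum_(i < n) tint (fun v => f' i v * cwt e v + f v * (cwt e v * score a lam e i v)) = 0.
    by rewrite big1 // => i _; apply: tint_ibp => //; exact: ek_itv.
  under eq_bigr => i _.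
    rewrite (tintD (bmeasM (hf' i).1 bw) (bs i)).
    over.
  rewrite big_split/= -[X in _ + X = _]tint_sum//.
  rewrite [X in _ + X = _](_ : _ = 0) ?addr0//.
  rewrite -[RHS](tint_cst n 0); congr tint; apply/funext => v.
  rewrite -!mulr_sumr [\sum_(_ < _) _](_ : _ = 0) ?mulr0//.
  rewrite /score a00 big_split/= big1 ?add0r => [|i _]; last by rewrite mul0r.
  rewrite -mulr_sumr [X in _ * X](_ : _ = 0) ?mulr0//.
  (* Exchanging the two indices changes the sign of the odd kernel, so the scores of all variables
     cancel. *)
  set S := (LHS); have SN : S = - S.
    rewrite {2}/S (exchange_big_dep xpredT)//= -sumrN; apply: eq_bigr => i _.
    rewrite -sumrN; apply: eq_big => [k|k _]; first by rewrite eq_sym.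
    by rewrite -cotrN opprB.
  by lra.
have : T @ \oo --> \sum_(i < n) tint (fun v => f' i v * cwt 0 v).
  by apply: cvg_bigsum => i _; apply: tint_cwt_cvg; exact: (hf' i).1.
rewrite (_ : T = fun=> 0); last by apply/funext => m; exact: T0.
by move=> hT; apply/esym; apply: (@cvg_unique _ (@Rhausdorff R) _ _ _ _ (cvg_cst 0)) hT.
Qed.

Lemma tint_cwt_swapc f i j : bmeas f ->
  tint (fun v => f (swapc i j v) * cwt 0 v) = tint (fun v => f v * cwt 0 v).
Proof.
move=> bf; rewrite -(@tint_swapc _ _ (fun v => f v * cwt 0 v) i j).
  by congr tint; apply/funext => v; rewrite cwt_swapc.
by apply: bmeasM => //; apply: bmeas_cwt; rewrite // lexx ler01.
Qed.

End aomoto.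

(** * Complex-valued functions and their averages *)

Section complex_parts.
Context {R : realType}.
Implicit Types x y : R[i].

Lemma complexRe_M x y : complex.Re (x * y) =
  complex.Re x * complex.Re y - complex.Im x * complex.Im y.
Proof. by case: x y => [a b] [c d]. Qed.

Lemma complexIm_M x y : complex.Im (x * y) =
  complex.Re x * complex.Im y + complex.Im x * complex.Re y.
Proof. by case: x y => [a b] [c d]. Qed.

Lemma complexRe_D x y : complex.Re (x + y) = complex.Re x + complex.Re y.
Proof. by case: x y => [a b] [c d]. Qed.

Lemma complexIm_D x y : complex.Im (x + y) = complex.Im x + complex.Im y.
Proof. by case: x y => [a b] [c d]. Qed.

Lemma complexRe_N x : complex.Re (- x) = - complex.Re x.
Proof. by case: x. Qed.

Lemma complexIm_N x : complex.Im (- x) = - complex.Im x.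
Proof. by case: x. Qed.

Definition cparts := (complexRe_M, complexIm_M, complexRe_D, complexIm_D,
  complexRe_N, complexIm_N).

Lemma complex_eq x y : complex.Re x = complex.Re y -> complex.Im x = complex.Im y ->
  x = y.
Proof. by case: x y => [a b] [c d] /= -> ->. Qed.

Lemma expiD (s t : R) : expi (s + t) = expi s * expi t.
Proof. by rewrite /expi sinD cosD; simpc; congr (_ +i* _); ring. Qed.

Lemma expiN (t : R) : expi (- t) = (expi t)^*.
Proof. by rewrite /expi sinN cosN. Qed.

Lemma expi_conjM (t : R) : expi t * (expi t)^* = 1.
Proof.
rewrite /expi; simpc.
by rewrite -!expr2 cos2Dsin2; congr (_ +i* _); ring.
Qed.

Lemma chord2_conjM (t : R) : (1 - expi t) * (1 - expi t)^* = (chord2 t)%:C.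
Proof.
rewrite rmorphB rmorph1 mulrBr !mulrBl !mul1r mulr1 expi_conjM /expi /chord2.
by apply: complex_eq; rewrite /=; ring.
Qed.

(** Componentwise, because integration by parts is available for real-valued functions and is
    applied to the two parts separately. *)
Definition cder (t : R) (F : R -> R[i]) (d : R[i]) :=
  is_derive t (1:R) (fun s => complex.Re (F s)) (complex.Re d) /\
  is_derive t (1:R) (fun s => complex.Im (F s)) (complex.Im d).

Lemma cder_cst t c : cder t (fun=> c) 0.
Proof. by split; exact: is_derive_cst. Qed.

Lemma cderM t F G dF dG : cder t F dF -> cder t G dG ->
  cder t (fun s => F s * G s) (dF * G t + F t * dG).
Proof.
move=> [f1 f2] [g1 g2]; split.
  under eq_fun do rewrite complexRe_M.
  apply: (is_derive_eq (is_deriveB (is_deriveM f1 g1) (is_deriveM f2 g2))).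
  by rewrite !cparts /GRing.scale /=; ring.
under eq_fun do rewrite complexIm_M.
apply: (is_derive_eq (is_deriveD (is_deriveM f1 g2) (is_deriveM f2 g1))).
by rewrite !cparts /GRing.scale /=; ring.
Qed.

Lemma cder_expi t : cder t (@expi R) ('i * expi t).
Proof.
split; rewrite /expi /=.
  by apply: is_derive_eq; rewrite /= mul0r mul1r sub0r.
by apply: is_derive_eq; rewrite /= mul0r mul1r add0r.
Qed.

Lemma cder_eq t F d d' : cder t F d -> d = d' -> cder t F d'.
Proof. by move=> h <-. Qed.

Lemma cder_1B t F d : cder t F d -> cder t (fun s => 1 - F s) (- d).
Proof.
move=> [f1 f2]; split.
  under eq_fun do rewrite complexRe_D complexRe_N.
  apply: (is_derive_eq (is_deriveB (is_derive_cst _ t 1) f1)).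
  by rewrite !cparts sub0r.
under eq_fun do rewrite complexIm_D complexIm_N.
apply: (is_derive_eq (is_deriveB (is_derive_cst _ t 1) f2)).
by rewrite !cparts sub0r.
Qed.

Lemma complexRe_conj x : complex.Re x^* = complex.Re x.
Proof. by case: x. Qed.

Lemma complexIm_conj x : complex.Im x^* = - complex.Im x.
Proof. by case: x. Qed.

Lemma cder_conj t F d : cder t F d -> cder t (fun s => (F s)^*) (d^*).
Proof.
move=> [f1 f2]; split.
  under eq_fun do rewrite complexRe_conj.
  by rewrite complexRe_conj.
under eq_fun do rewrite complexIm_conj.
by rewrite complexIm_conj; exact: is_deriveN.
Qed.

End complex_parts.

Section cnice.
Context {R : realType} {n : nat}.
Implicit Types f g : n.-tuple R -> R[i].

Definition cnice f := nice (fun v => complex.Re (f v)) /\ nice (fun v => complex.Im (f v)).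

Lemma cnice_cst c : cnice (fun=> c).
Proof. by split; exact: nice_cst. Qed.

Lemma cniceD f g : cnice f -> cnice g -> cnice (fun v => f v + g v).
Proof.
move=> [f1 f2] [g1 g2]; split.
  by under eq_fun do rewrite complexRe_D; exact: niceD.
by under eq_fun do rewrite complexIm_D; exact: niceD.
Qed.

Lemma cniceN f : cnice f -> cnice (fun v => - f v).
Proof.
move=> [f1 f2]; split.
  by under eq_fun do rewrite complexRe_N; exact: niceN.
by under eq_fun do rewrite complexIm_N; exact: niceN.
Qed.

Lemma cniceM f g : cnice f -> cnice g -> cnice (fun v => f v * g v).
Proof.
move=> [f1 f2] [g1 g2]; split.
  by under eq_fun do rewrite complexRe_M; apply: niceB; exact: niceM.
by under eq_fun do rewrite complexIm_M; apply: niceD; exact: niceM.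
Qed.

Lemma cnice_conj f : cnice f -> cnice (fun v => (f v)^*).
Proof.
move=> [f1 f2]; split.
  by under eq_fun do rewrite complexRe_conj.
by under eq_fun do rewrite complexIm_conj; exact: niceN.
Qed.

Lemma cnice_prod (I : Type) (r : seq I) (P : pred I) (F : I -> n.-tuple R -> R[i]) :
  (forall i, P i -> cnice (F i)) -> cnice (fun x => \prod_(i <- r | P i) F i x).
Proof.
move=> hF; elim: r => [|i r IH].
  by under eq_fun do rewrite big_nil; exact: cnice_cst.
under eq_fun do rewrite big_cons.
by case: (boolP (P i)) => // /hF hi; exact: cniceM.
Qed.

Lemma cnice_expi j : cnice (fun v => expi (tnth v j)).
Proof. by split; [exact: nice_cos_tnth|exact: nice_sin_tnth]. Qed.

Lemma cnice_1Bexpi j : cnice (fun v => 1 - expi (tnth v j)).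
Proof. by apply: cniceD; [exact: cnice_cst|apply: cniceN; exact: cnice_expi]. Qed.

End cnice.

Section cint.
Context {R : realType} {n : nat} (a lam : R) (a0 : 0 <= a) (lam0 : 0 < lam).
Implicit Types f g : n.-tuple R -> R[i].
Local Notation w := (@cwt R n a lam 0).

Definition cint f : R[i] := tint (fun v => complex.Re (f v) * w v) +i*
  tint (fun v => complex.Im (f v) * w v).

Let bw : bmeas w. Proof. by apply: bmeas_cwt; rewrite // lexx ler01. Qed.

Let bM (f : n.-tuple R -> R) : nice f -> bmeas (fun v => f v * w v).
Proof. by move=> [bf _]; exact: bmeasM. Qed.

Lemma cintD f g : cnice f -> cnice g -> cint (fun v => f v + g v) = cint f + cint g.
Proof.
move=> [f1 f2] [g1 g2]; rewrite /cint; simpc; congr (_ +i* _).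
  rewrite -tintD; [|exact: bM..]; congr tint; apply/funext => v.
  by rewrite complexRe_D mulrDl.
rewrite -tintD; [|exact: bM..]; congr tint; apply/funext => v.
by rewrite complexIm_D mulrDl.
Qed.

Lemma cintZ c f : cnice f -> cint (fun v => c * f v) = c * cint f.
Proof.
move=> [f1 f2]; rewrite /cint; apply: complex_eq; rewrite cparts /=.
  rewrite -!tintZ; [|exact: bM..]; rewrite -tintB; last 2 first.
    by apply: bmeasM; [exact: bmeas_cst|exact: bM].
    by apply: bmeasM; [exact: bmeas_cst|exact: bM].
  by congr tint; apply/funext => v; rewrite cparts; ring.
rewrite -!tintZ; [|exact: bM..]; rewrite -tintD; last 2 first.
  by apply: bmeasM; [exact: bmeas_cst|exact: bM].
  by apply: bmeasM; [exact: bmeas_cst|exact: bM].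
by congr tint; apply/funext => v; rewrite cparts; ring.
Qed.

Lemma cint_swapc f i j : cnice f -> cint (fun v => f (swapc i j v)) = cint f.
Proof.
move=> [f1 f2]; congr (_ +i* _).
  by apply: (tint_cwt_swapc a0 lam0 i j f1.1).
by apply: (tint_cwt_swapc a0 lam0 i j f2.1).
Qed.

Lemma cint_conj f : cnice f -> cint (fun v => (f v)^*) = (cint f)^*.
Proof.
move=> [f1 f2]; rewrite /cint /=; congr (_ +i* _).
  by congr tint; apply/funext => v; rewrite complexRe_conj.
rewrite -tintN; last exact: bM.
by congr tint; apply/funext => v; rewrite complexIm_conj mulNr.
Qed.

(** All multipliers in the hypotheses are real, so the real and imaginary parts are two instances of
    [aomoto]. *)
Lemma caomoto f f' g (h : 'I_n -> n.-tuple R -> R[i]) i :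
  cnice f -> cnice f' -> cnice g -> (forall k, cnice (h k)) ->
  (forall v t, cder t (fun s => f (setc v i s)) (f' (setc v i t))) ->
  (forall v, f (setc v i (- pi)) = f (setc v i pi)) ->
  (forall v, f v * (2 * sin (tnth v i))%:C = (chord2 (tnth v i))%:C * g v) ->
  (forall k v, k != i -> (f v - f (swapc i k v)) * (2 * sin (tnth v i - tnth v k))%:C =
     (chord2 (tnth v i - tnth v k))%:C * h k v) ->
  cint f' + a%:C * cint g + (lam / 2)%:C * \sum_(k < n | k != i) cint (h k) = 0.
Proof.
move=> [f1 f2] [f1' f2'] [g1 g2] hh df pf fg fh.
have Re_sum (F : 'I_n -> R[i]) P : complex.Re (\sum_(k < n | P k) F k) = \sum_(k < n | P k) complex.Re (F k).
  by apply: (big_morph (@complex.Re R)) => // x y; rewrite complexRe_D.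
have Im_sum (F : 'I_n -> R[i]) P : complex.Im (\sum_(k < n | P k) F k) = \sum_(k < n | P k) complex.Im (F k).
  by apply: (big_morph (@complex.Im R)) => // x y; rewrite complexIm_D.
apply: complex_eq; rewrite !cparts ?Re_sum ?Im_sum /= !mul0r ?subr0 ?addr0.
  apply: (@aomoto _ _ _ _ a0 lam0 (fun v => complex.Re (f v)) (fun v => complex.Re (f' v))
    (fun v => complex.Re (g v)) (fun k v => complex.Re (h k v)) i) => //.
  - exact: g1.1.
  - by move=> k; exact: (hh k).1.1.
  - by move=> v t; have [] := df v t.
  - by move=> v; rewrite /= pf.
  - by move=> _ v; have := congr1 (@complex.Re R) (fg v); rewrite !cparts /= !mulr0 !mul0r !subr0.
  - move=> k v ki; have := congr1 (@complex.Re R) (fh k v ki).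
    by rewrite !cparts /= !mulr0 !mul0r !subr0.
apply: (@aomoto _ _ _ _ a0 lam0 (fun v => complex.Im (f v)) (fun v => complex.Im (f' v))
    (fun v => complex.Im (g v)) (fun k v => complex.Im (h k v)) i) => //.
- exact: g2.1.
- by move=> k; exact: (hh k).2.1.
- by move=> v t; have [] := df v t.
- by move=> v; rewrite /= pf.
- by move=> _ v; have := congr1 (@complex.Im R) (fg v); rewrite !cparts /= !mulr0 !mul0r ?add0r ?addr0.
- move=> k v ki; have := congr1 (@complex.Im R) (fh k v ki).
  by rewrite !cparts /= !mulr0 !mul0r ?add0r ?addr0.
Qed.

End cint.

Lemma sum_ord_gt {V : nmodType} {n : nat} (i : 'I_n) (c : V) :
  \sum_(k < n | (i < k)%N) c = c *+ (n - i.+1).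
Proof.
rewrite -(big_mkord (fun k => i < k)%N (fun=> c)) (@big_cat_nat _ _ _ i.+1)//=.
rewrite big_nat_cond big1 ?add0r => [|k /andP[/andP[_ ki]]]; last first.
  by rewrite ltnNge -ltnS ki.
rewrite big_nat_cond (eq_bigl (fun k => (i.+1 <= k < n)%N)); last first.
  by move=> k; case: (ltnP i k) => //=; rewrite andbT.
by rewrite -big_nat sumr_const_nat.
Qed.

(** * Raising the exponent a by one *)

Section circ_prod.
Context {R : realType} {n : nat}.
Implicit Types (v : n.-tuple R) (b : bool).

(** With P the product of all 1 - e^(i theta_j), letting [m] run from 0 to n leads from 1 to P if
    [b] is false, and from the conjugate of P to |P|^2 if [b] is true. *)
Definition circ_prod b (m : nat) v : R[i] :=
  \prod_(j < n) (((1 - expi (tnth v j))^*) ^+ b *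
                 (if (j < m)%N then 1 - expi (tnth v j) else 1)).

Lemma circ_prodS b (i : 'I_n) v :
  circ_prod b i.+1 v = circ_prod b i v * (1 - expi (tnth v i)).
Proof.
rewrite /circ_prod (bigD1 i)//= [in RHS](bigD1 i)//= ltnSn ltnn mulr1.
rewrite mulrAC; congr (_ * _ * _); apply: eq_bigr => j ji.
by rewrite ltnS leq_eqVlt val_eqE (negbTE ji).
Qed.

Lemma circ_prod_swapc b m (i k : 'I_n) v : (i < m)%N = (k < m)%N ->
  circ_prod b m (swapc i k v) = circ_prod b m v.
Proof.
move=> ik; rewrite /circ_prod [RHS](reindex_inj (@perm_inj _ (tperm i k))) /=.
apply: eq_bigr => j _; rewrite tnth_mktuple; congr (_ * _).
by case: tpermP => // ->; rewrite ik.
Qed.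

Lemma cnice_circ_prod b m : cnice (circ_prod b m).
Proof.
apply: cnice_prod => j _.
have h1 : cnice (fun v : n.-tuple R => ((1 - expi (tnth v j))^*) ^+ b).
  case: b; last exact: cnice_cst.
  by under eq_fun do rewrite expr1; apply: cnice_conj; exact: cnice_1Bexpi.
have h2 : cnice (fun v : n.-tuple R => if (j < m)%N then 1 - expi (tnth v j) else 1).
  by case: (j < m)%N; [exact: cnice_1Bexpi|exact: cnice_cst].
exact: cniceM h1 h2.
Qed.

Lemma circ_prod_setc b (i : 'I_n) v : exists c : R[i],
  forall s, circ_prod b i (setc v i s) = ((1 - expi s)^*) ^+ b * c.
Proof.
eexists => s; rewrite /circ_prod (bigD1 i)//= ltnn mulr1 tnth_mktuple eqxx.
congr (_ * _); apply: eq_bigr => j ji.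
by rewrite tnth_mktuple (negbTE ji).
Qed.

(** This is (1 - e^(it)) cot (t / 2) = - i (1 + e^(it)) cleared of the denominator [chord2 t], hence
    also valid at the poles of the cotangent. *)
Lemma expi_sin_chord2 (t : R) :
  (1 - expi t) * (2 * sin t)%:C = (chord2 t)%:C * (- 'i * (1 + expi t)).
Proof.
have h : sin t ^+ 2 = (1 - cos t) * (1 + cos t) by rewrite sin2cos2; ring.
rewrite /expi /chord2; apply: complex_eq; rewrite !cparts /=; first by ring.
have -> : 0 - sin t = - sin t by rewrite sub0r.
transitivity (- 2 * sin t ^+ 2); first by ring.
by rewrite h; ring.
Qed.

Lemma expiB_sin_chord2 (s t : R) :
  (expi t - expi s) * (2 * sin (s - t))%:C =
  (chord2 (s - t))%:C * (- 'i * (expi s + expi t)).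
Proof.
have {1 2}-> : expi s = expi t * expi (s - t) by rewrite -expiD addrC subrK.
rewrite -{1}[expi t]mulr1 -mulrBr -mulrA expi_sin_chord2.
by rewrite mulrCA; congr (_ * _); rewrite mulrCA; congr (_ * _); rewrite mulrDr mulr1 addrC.
Qed.

End circ_prod.

Section circ_rec.
Context {R : realType} {n : nat} (a lam : R) (a0 : 0 <= a) (lam0 : 0 < lam).
Local Notation J := (@cint R n a lam).

(** The test function is P (1 - z_i), where P is [circ_prod b i] and z_i = e^(i theta_i). It is
    symmetric in i and any k < i, so only the m = n - i - 1 indices k > i contribute, all equally
    because P does not distinguish them from i. With Q and Z the averages of P and z_i P, the
    outcome is Z (1 + a + lam m) = - (a + b) Q, and the new average is Q - Z. *)
Lemma cint_circ_prod_rec b (i : 'I_n) :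
  J (circ_prod b i.+1) * (1 + a + lam * (n - i.+1)%:R)%:C =
  J (circ_prod b i) * (1 + 2 * a + b%:R + lam * (n - i.+1)%:R)%:C.
Proof.
pose P : n.-tuple R -> R[i] := circ_prod b i.
pose z k (v : n.-tuple R) := expi (tnth v k).
have nP : cnice P by exact: cnice_circ_prod.
have nz k : cnice (z k) by exact: cnice_expi.
have nzP k : cnice (fun v => z k v * P v) by exact: cniceM.
have n1 : cnice (fun v => z i v * P v + b%:R * P v).
  by apply: cniceD => //; apply: cniceM => //; exact: cnice_cst.
have n2 : cnice (fun v => P v + z i v * P v) by exact: cniceD.
have n3 k : cnice (fun v => z i v * P v + z k v * P v) by exact: cniceD.
have nbP : cnice (fun v => b%:R * P v) by apply: cniceM => //; exact: cnice_cst.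
pose Q := J P; pose Z := J (fun v => z i v * P v).
have E1 : J (circ_prod b i.+1) = Q - Z.
  rewrite /Q /Z -[- J _]mulN1r -cintZ// -cintD//; last first.
    by apply: cniceM => //; exact: cnice_cst.
  by congr cint; apply/funext => v; rewrite circ_prodS /P /z; ring.
have E2 (k : 'I_n) : (i < k)%N -> J (fun v => z k v * P v) = Z.
  move=> ik; rewrite /Z -(cint_swapc a0 lam0 i k (nzP k)).
  congr cint; apply/funext => v; rewrite /z tnth_mktuple tpermR /P circ_prod_swapc//.
  by rewrite ltnn ltnNge ltnW.
pose m := (n - i.+1)%N.
have main : - 'i * (Z + b%:R * Q) + a%:C * (- 'i * (Q + Z)) +
    (lam / 2)%:C * (- 'i * (Z *+ 2) *+ m) = 0.
  have <- : J (fun v => - 'i * (z i v * P v + b%:R * P v)) = - 'i * (Z + b%:R * Q).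
    by rewrite cintZ// cintD// cintZ.
  have <- : J (fun v => - 'i * (P v + z i v * P v)) = - 'i * (Q + Z).
    by rewrite cintZ// cintD.
  have <- : \sum_(k < n | k != i) J (fun v => if (i < k)%N then - 'i * (z i v * P v + z k v * P v) else 0)
      = - 'i * (Z *+ 2) *+ m.
    rewrite -sum_ord_gt [RHS]big_mkcond [LHS]big_mkcond /=; apply: eq_bigr => k _.
    case: ifPn => [ki|]; last by rewrite negbK => /eqP ->; rewrite ltnn.
    case: (ltnP i k) => ik.
      by rewrite cintZ// cintD// (E2 k ik).
    transitivity (J (fun v => 0 * P v)); last by rewrite cintZ// mul0r.
    by congr cint; apply/funext => v; rewrite mul0r.
  apply: (@caomoto R n a lam a0 lam0 (circ_prod b i.+1)).
  - exact: cnice_circ_prod.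
  - by apply: cniceM => //; exact: cnice_cst.
  - by apply: cniceM => //; exact: cnice_cst.
  - move=> k; case: (i < k)%N; last exact: cnice_cst.
    by apply: cniceM => //; exact: cnice_cst.
  - move=> v t; have [c hc] := circ_prod_setc b i v.
    under eq_fun do rewrite circ_prodS hc tnth_mktuple eqxx mulrAC.
    rewrite /P hc /z tnth_mktuple eqxx.
    have h := cder_1B (cder_expi t).
    case: b {P nP nzP n1 n2 n3 nbP Q Z E1 E2} c hc => c hc.
      apply: (cder_eq (cderM (cderM (cder_conj h) h) (cder_cst t c))).
      have e1 := expi_conjM t; rewrite expr1 mulr0 addr0.
      have -> : (- ('i * expi t))^* = 'i * (expi t)^* :> R[i].
        by apply: complex_eq; rewrite /=; ring.
      have -> : (1 - expi t)^* = 1 - (expi t)^* by rewrite rmorphB rmorph1.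
      rewrite (_ : true%:R = 1 :> R[i])//.
      set y := (expi t)^* in e1 *; set x := expi t in e1 *.
      (* The relation [x * y = 1], that is |z|^2 = 1, is isolated in one term; the rest is
         polynomial arithmetic. *)
      transitivity (('i * (y - x) + 'i * (x * y - 1)) * c); last by ring.
      by rewrite e1; ring.
    under eq_fun do rewrite expr0 mul1r.
    apply: (cder_eq (cderM h (cder_cst t c))).
    by rewrite expr0 (_ : false%:R = 0 :> R[i])//; ring.
  - move=> v; have [c hc] := circ_prod_setc b i v.
    have e : expi (- pi) = expi pi :> R[i] by rewrite /expi cosN sinN sinpi oppr0.
    by rewrite !circ_prodS !hc !tnth_mktuple eqxx e.
  - move=> v; rewrite circ_prodS -/(P v) -mulrA expi_sin_chord2 /z; ring.
  - move=> k v ki; case: ltnP => ik; last first.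
      rewrite mulr0 circ_prod_swapc ?subrr ?mul0r// ltnSn.
      by rewrite ltnS ik.
    rewrite !circ_prodS circ_prod_swapc; last by rewrite ltnn ltnNge ltnW.
    rewrite tnth_mktuple tpermL -/(P v) -mulrBr -mulrA.
    rewrite (_ : 1 - _ - _ = expi (tnth v k) - expi (tnth v i)); last by ring.
    by rewrite expiB_sin_chord2 /z; ring.
rewrite E1 -/P -/Q -/m.
have i0 : - 'i != 0 :> R[i] by rewrite oppr_eq0 neq0Ci.
have key : (Z + b%:R * Q) + a%:C * (Q + Z) + lam%:C * m%:R * Z = 0.
  apply: (mulfI i0); rewrite mulr0 -[RHS]main -[(Z *+ 2)]mulr_natr -[_ *+ m]mulr_natr.
  have -> : lam%:C = (lam / 2)%:C + (lam / 2)%:C :> R[i].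
    by rewrite -rmorphD -splitr.
  by ring.
apply/eqP; rewrite -subr_eq0 -[X in _ == X]oppr0 -key.
rewrite !rmorphD !rmorphM !rmorph_nat rmorph1; apply/eqP; ring.
Qed.

End circ_rec.

Section weight_shift.
Context {R : realType} {n : nat} (a lam : R) (a0 : 0 <= a) (lam0 : 0 < lam).
Local Notation J := (@cint R n a lam).
Local Notation Q b i := (J (circ_prod b i)).

Let cint_circ_prod_iter b i : (i <= n)%N ->
  Q b i * \prod_(j < i) (1 + a + lam * (n - j.+1)%:R)%:C =
  Q b 0 * \prod_(j < i) (1 + 2 * a + b%:R + lam * (n - j.+1)%:R)%:C.
Proof.
elim: i => [_|i IH lin]; first by rewrite !big_ord0.
rewrite !big_ord_recr /= mulrCA (@cint_circ_prod_rec _ _ _ _ a0 lam0 b (Ordinal lin)) /=.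
by rewrite [LHS]mulrA [X in X * _ = _]mulrC IH 1?ltnW// -mulrA.
Qed.

Let prodC (F : 'I_n -> R) : \prod_(j < n) (F j)%:C = (\prod_(j < n) F j)%:C.
Proof. by rewrite rmorph_prod. Qed.

Lemma cint_circ_prod b :
  Q b n * (\prod_(j < n) (1 + a + lam * j%:R))%:C =
  Q b 0 * (\prod_(j < n) (1 + 2 * a + b%:R + lam * j%:R))%:C.
Proof.
have := cint_circ_prod_iter b (leqnn n).
have rv (F : nat -> R) : \prod_(j < n) F (n - j.+1)%N = \prod_(j < n) F j.
  by rewrite [RHS](reindex_inj rev_ord_inj).
rewrite !prodC (rv (fun m => 1 + a + lam * m%:R)).
by rewrite (rv (fun m => 1 + 2 * a + b%:R + lam * m%:R)).
Qed.

(** Two runs of the recurrence are chained: from 1 to P, then from the conjugate of P to |P|^2. The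
    first ends at a real value, so conjugation lets the second start there; and |P|^2 is the product
    of the [chord2], which raises the exponent of the weight by 1. *)
Lemma tint_cwt_shift :
  tint (@cwt R n (a + 1) lam 0) * \prod_(j < n) (1 + a + lam * j%:R) ^+ 2 =
  tint (@cwt R n a lam 0) * \prod_(j < n) ((1 + 2 * a + lam * j%:R) * (2 + 2 * a + lam * j%:R)).
Proof.
have D0 : \prod_(j < n) (1 + a + lam * j%:R) != 0.
  rewrite gt_eqF// prodr_gt0// => j _.
  have : 0 <= lam * j%:R by rewrite mulr_ge0// ltW.
  by move: a0; lra.
have q00 : Q false 0 = (tint (@cwt R n a lam 0))%:C.
  have E v : circ_prod false 0 v = 1 :> R[i] by rewrite /circ_prod big1// => j _; rewrite mulr1.
  rewrite /cint; congr (_ +i* _); first by congr tint; apply/funext => v; rewrite E mul1r.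
  by rewrite -[RHS](tint_cst n 0); congr tint; apply/funext => v; rewrite E mul0r.
have q0n := cint_circ_prod false.
have q10 : Q true 0 = (Q false n)^*.
  rewrite -cint_conj//; last exact: cnice_circ_prod.
  congr cint; apply/funext => v; rewrite /circ_prod rmorph_prod; apply: eq_bigr => j _.
  by rewrite ltn_ord mulr1 expr1 expr0 mul1r.
have q1n := cint_circ_prod true.
have qtn : Q true n = (tint (@cwt R n (a + 1) lam 0))%:C.
  have E v : circ_prod true n v = (\prod_(j < n) chord2 (tnth v j))%:C :> R[i].
    rewrite /circ_prod -prodC; apply: eq_bigr => j _.
    by rewrite ltn_ord expr1 mulrC chord2_conjM.
  rewrite /cint; congr (_ +i* _).
    congr tint; apply/funext => v; rewrite E /= /cwt mulrA -big_split/=; congr (_ * _).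
    apply: eq_bigr => j _; rewrite addr0.
    by rewrite -[in RHS](@mulr_powRB1 _ _ (a + 1)) ?chord2_ge0 ?addrK// ltr_wpDl.
  by rewrite -[RHS](tint_cst n 0); congr tint; apply/funext => v; rewrite E mul0r.
have : Q false n = (tint (@cwt R n a lam 0) * \prod_(j < n) (1 + 2 * a + lam * j%:R) /
    \prod_(j < n) (1 + a + lam * j%:R))%:C.
  apply: (mulIf (_ : (\prod_(j < n) (1 + a + lam * j%:R))%:C != 0)).
    by rewrite fmorph_eq0.
  rewrite q0n q00 -!rmorphM divfK//.
  by congr (_ * _)%:C; apply: eq_bigr => j _; rewrite addr0.
move=> Qn; move: q1n; rewrite qtn q10 Qn conjc_real -!rmorphM => /(congr1 (@complex.Re R)) /= h.
rewrite prodrXl expr2 mulrA h mulrAC divfK// big_split/= mulrA; congr (_ * _).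
by apply: eq_bigr => j _; ring.
Qed.

End weight_shift.

(** * Moments of products of chords, for a = 0 *)

Section chord_prod.
Context {R : realType} {n : nat} (lam : R) (lam0 : 0 < lam).
Implicit Types v : n.-tuple R.
Local Notation w := (@cwt R n 0 lam 0).

Definition chord_prod (m : nat) v : R := \prod_(j < n | (j < m)%N) chord2 (tnth v j).

Let chord_prod' (m : nat) (k : 'I_n) v : R :=
  \prod_(j < n | (j < m)%N && (j != k)) chord2 (tnth v j).

Let chord_prodS (i : 'I_n) v : chord_prod i.+1 v = chord2 (tnth v i) * chord_prod i v.
Proof.
rewrite /chord_prod (bigD1 i)//=; congr (_ * _); apply: eq_bigl => j.
by rewrite ltnS ltn_neqAle val_eqE andbC.
Qed.

Let chord_prodD1 m (k : 'I_n) v : (k < m)%N ->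
  chord_prod m v = chord2 (tnth v k) * chord_prod' m k v.
Proof. by move=> km; rewrite /chord_prod (bigD1 k). Qed.

Lemma nice_chord_prod m : nice (@chord_prod m).
Proof. by apply: nice_prod => j _; exact: nice_chord2_tnth. Qed.

Let nice_chord_prod' m k : nice (chord_prod' m k).
Proof. by apply: nice_prod => j _; exact: nice_chord2_tnth. Qed.

Let chord_prod_swapc m (i k : 'I_n) v : (i < m)%N = (k < m)%N ->
  chord_prod m (swapc i k v) = chord_prod m v.
Proof.
move=> ik; rewrite /chord_prod [RHS](reindex_inj (@perm_inj _ (tperm i k))) /=.
apply: eq_big => [j|j _]; last by rewrite tnth_mktuple.
by case: tpermP => // ->; rewrite ik.
Qed.

Let chord_prod'_swapc m (i k : 'I_n) v : ~~ (i < m)%N ->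
  chord_prod' m k (swapc i k v) = chord_prod' m k v.
Proof.
move=> im; apply: eq_bigr => j /andP[jm jk]; rewrite tnth_mktuple tpermD// 1?eq_sym//.
by apply: contra im => /eqP <-.
Qed.

Let chord_prod_setc m (i : 'I_n) v s : ~~ (i < m)%N ->
  chord_prod m (setc v i s) = chord_prod m v.
Proof.
move=> im; apply: eq_bigr => j jm; rewrite tnth_mktuple ifF//.
by apply/negbTE; apply: contra im => /eqP <-.
Qed.

Let chord_prod'_setc m (k : 'I_n) v s : chord_prod' m k (setc v k s) = chord_prod' m k v.
Proof.
by apply: eq_bigr => j /andP[jm /negbTE jk]; rewrite tnth_mktuple jk.
Qed.

(** This is (sin s - sin t) cot ((s - t) / 2) = cos s + cos t cleared of its denominator, the
    divided difference when the k-th chord is absent from the product. *)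
Let trig_out (s t : R) :
  (sin s - sin t) * (2 * sin (s - t)) = chord2 (s - t) * (cos s + cos t).
Proof.
have h1 := cos2Dsin2 s; have h2 := cos2Dsin2 t.
rewrite /chord2 sinB cosB; set a := sin s in h1 *; set b := cos s in h1 *.
set c := sin t in h2 *; set d := cos t in h2 *.
transitivity ((2 - 2 * (b * d + a * c)) * (b + d) +
  2 * (d * (b ^+ 2 + a ^+ 2 - 1) + b * (d ^+ 2 + c ^+ 2 - 1))); first by ring.
by rewrite h1 h2; ring.
Qed.

(** The analogue when the product contains the k-th chord, which the transposition moves too. The
    product of two sines enters here. *)
Let trig_in (s t : R) :
  (sin s * chord2 t - sin t * chord2 s) * (2 * sin (s - t)) =
  chord2 (s - t) * (- 2^-1 * (chord2 s * chord2 t) - 2 * (sin s * sin t)).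
Proof.
have h1 := cos2Dsin2 s; have h2 := cos2Dsin2 t.
rewrite /chord2 sinB cosB; set a := sin s in h1 *; set b := cos s in h1 *.
set c := sin t in h2 *; set d := cos t in h2 *.
(* The last two terms are multiples of the Pythagorean relations for s and t; once their multipliers
   are explicit, the identity is polynomial. *)
transitivity ((2 - 2 * (b * d + a * c)) *
   (- 2^-1 * ((2 - 2 * b) * (2 - 2 * d)) - 2 * (a * c)) +
  4 * ((b ^+ 2 + a ^+ 2 - 1) * (d - d ^+ 2 - c ^+ 2) +
       (d ^+ 2 + c ^+ 2 - 1) * (b - 1))); first by field.
by rewrite h1 h2; ring.
Qed.

(** The test function is sin theta_i times the product P of the first i chords. Integration by parts
    relates [C], the average of cos theta_i P, to [A'] and to a sum of sine integrals; [rot]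
    evaluates that sum as - C / 2, and cos = 1 - chord2 / 2 gives C = A - A' / 2. *)
Lemma tint_chord_prod_rec (i : 'I_n) :
  tint (fun v => chord_prod i.+1 v * w v) *
    (2 + 2 * lam * (n - i.+1)%:R + lam + lam * i%:R) =
  4 * tint (fun v => chord_prod i v * w v) * (1 + lam * (n - i.+1)%:R + lam / 2).
Proof.
pose P : n.-tuple R -> R := chord_prod i.
have bw : bmeas w by apply: bmeas_cwt; rewrite // lexx ler01.
pose C := tint (fun v => cos (tnth v i) * P v * w v).
pose S (k : 'I_n) := tint (fun v => sin (tnth v i) * sin (tnth v k) * chord_prod' i k v * w v).
pose A := tint (fun v => P v * w v).
pose A' := tint (fun v => chord_prod i.+1 v * w v).
have nP : nice P by exact: nice_chord_prod.
have ncP k : nice (fun v => cos (tnth v k) * P v).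
  by apply: niceM => //; exact: nice_cos_tnth.
have nsP : nice (fun v => sin (tnth v i) * P v).
  by apply: niceM => //; exact: nice_sin_tnth.
have nss k : nice (fun v => sin (tnth v i) * sin (tnth v k) * chord_prod' i k v).
  by apply: niceM => //; apply: niceM; exact: nice_sin_tnth.
have CE : C = A - A' / 2.
  rewrite /A' mulrC -tintZ; last by apply: bmeasM => //; exact: (nice_chord_prod _).1.
  rewrite -tintB; last 2 first.
    by apply: bmeasM => //; exact: nP.1.
    by apply: bmeasM; [exact: bmeas_cst|apply: bmeasM => //; exact: (nice_chord_prod _).1].
  by congr tint; apply/funext => v; rewrite chord_prodS -/(P v) /chord2; field.
have dP v t : is_derive t (1:R) (fun s => sin (tnth (setc v i s) i) * P (setc v i s))
    (cos (tnth (setc v i t) i) * P (setc v i t)).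
  rewrite /P !chord_prod_setc ?ltnn// tnth_mktuple eqxx.
  under eq_fun do rewrite tnth_mktuple eqxx chord_prod_setc ?ltnn//.
  apply: (is_derive_eq (is_deriveM (is_derive_sin t) (is_derive_cst (chord_prod i v) t 1))).
  by rewrite /GRing.scale /=; ring.
have sin_per : periodic_in (fun v => sin (tnth v i) * P v) i.
  by move=> v; rewrite /P !chord_prod_setc ?ltnn// !tnth_mktuple eqxx sinN sinpi oppr0.
(* rotation invariance evaluates the sum of the sine integrals *)
have rot : C + 2 * \sum_(k < n | (k < i)%N) S k = 0.
  pose f' (k : 'I_n) : n.-tuple R -> R := if k == i then fun v => cos (tnth v i) * P v else
    if (k < i)%N then fun v => 2 * (sin (tnth v i) * sin (tnth v k) * chord_prod' i k v)
    else fun=> 0.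
  have : \sum_(k < n) tint (fun v => f' k v * w v) = 0.
    apply: (@tint_rotation R n 0 lam (lexx 0) lam0 (fun v => sin (tnth v i) * P v) f' erefl nsP).
    - move=> k; rewrite /f'; case: (k == i); first exact: ncP.
      by case: (k < i)%N; [apply: niceM => //; exact: nice_cst|exact: nice_cst].
    - move=> k v t; rewrite /f'; have [->|ki] := eqVneq k i; first exact: dP.
      case: ltnP => ki'.
        under eq_fun do rewrite /P (chord_prodD1 _ ki') chord_prod'_setc !tnth_mktuple eqxx eq_sym (negbTE ki).
        rewrite chord_prod'_setc !tnth_mktuple eqxx eq_sym (negbTE ki).
        apply: (is_derive_eq (is_deriveM (is_derive_cst (sin (tnth v i)) t 1)
          (is_deriveM (is_derive_chord2 t) (is_derive_cst (chord_prod' i k v) t 1)))).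
        by rewrite /GRing.scale /=; ring.
      under eq_fun do rewrite /P chord_prod_setc -?leqNgt// tnth_mktuple eq_sym (negbTE ki).
      exact: is_derive_cst.
    - move=> k; have [->|ki] := eqVneq k i; first exact: sin_per.
      move=> v; rewrite !tnth_mktuple eq_sym (negbTE ki); congr (_ * _).
      apply: eq_bigr => j _; rewrite !tnth_mktuple; case: (j == k) => //.
      exact: chord2N.
  rewrite (bigD1 i)//= [f' i]/f' eqxx -/C => H; rewrite -[RHS]H; apply: (congr1 (+%R C)); apply/esym.
  rewrite mulr_sumr big_mkcond [RHS]big_mkcond; apply: eq_bigr => k _ /=.
  rewrite /f'; have [->|ki] := eqVneq k i; first by rewrite ltnn.
  case: ifPn => _; last by rewrite -[RHS](tint_cst n 0); congr tint; apply/funext => v; rewrite mul0r.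
  rewrite -tintZ; last by apply: bmeasM => //; exact: (nss k).1.
  by congr tint; apply/funext => v; rewrite !mulrA.
pose m := (n - i.+1)%N.
have Ck (k : 'I_n) : (i < k)%N -> tint (fun v => cos (tnth v k) * P v * w v) = C.
  move=> ik; rewrite /C -(@tint_cwt_swapc R n 0 lam (lexx 0) lam0 _ i k (ncP k).1).
  congr tint; apply/funext => v; rewrite tnth_mktuple tpermR /P chord_prod_swapc//.
  by rewrite ltnn ltnNge ltnW.
have main : C + lam / 2 * (C *+ 2 *+ m - A' / 2 *+ i - 2 * \sum_(k < n | (k < i)%N) S k) = 0.
  pose h (k : 'I_n) : n.-tuple R -> R := if (i < k)%N then
      fun v => cos (tnth v i) * P v + cos (tnth v k) * P v
    else fun v => - 2^-1 * chord_prod i.+1 v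
      - 2 * (sin (tnth v i) * sin (tnth v k) * chord_prod' i k v).
  have -> : C *+ 2 *+ m - A' / 2 *+ i - 2 * \sum_(k < n | (k < i)%N) S k =
     \sum_(k < n | k != i) tint (fun v => h k v * w v).
    rewrite [RHS](bigID (fun k : 'I_n => i < k)%N) /= -addrA; congr (_ + _).
      rewrite -sum_ord_gt; apply: eq_big => [k|k ik].
        by have [->|//] := eqVneq k i; rewrite ltnn.
      rewrite /h ik; under eq_fun do rewrite mulrDl.
      by rewrite tintD ?(Ck k ik)//; apply: bmeasM => //; exact: (ncP _).1.
    have -> : A' / 2 *+ i = \sum_(k < n | (k < i)%N) A' / 2.
      rewrite -(big_mkord (fun k => k < i)%N (fun=> A' / 2)).
      rewrite (@big_cat_nat _ _ _ i)//=; last exact: ltnW.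
      rewrite [X in _ + X]big_nat_cond [X in _ + X]big1 ?addr0; last first.
        by move=> k /andP[/andP[ik _]]; rewrite ltnNge ik.
      rewrite big_nat_cond (eq_bigl (fun k => (0 <= k < i)%N)) => [|k]; last first.
        by case: (k < i)%N; rewrite ?andbT ?andbF.
      by rewrite -big_nat sumr_const_nat subn0.
    rewrite mulr_sumr -!sumrN -big_split/=; apply: eq_big => [k|k ki].
      by rewrite -leqNgt ltn_neqAle val_eqE.
    rewrite /h ltnNge (ltnW ki) /=.
    rewrite (_ : (fun v => _) = fun v => - 2^-1 * (chord_prod i.+1 v * w v) -
      2 * (sin (tnth v i) * sin (tnth v k) * chord_prod' i k v * w v)); last first.
      by apply/funext => v; ring.
    have b1 : bmeas (fun v => chord_prod i.+1 v * w v).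
      by apply: bmeasM => //; exact: (nice_chord_prod _).1.
    have b2 : bmeas (fun v => sin (tnth v i) * sin (tnth v k) * chord_prod' i k v * w v).
      by apply: bmeasM => //; exact: (nss k).1.
    rewrite tintB; [|by apply: bmeasM => //; exact: bmeas_cst..].
    by rewrite !tintZ// -/A' mulNr [_ / 2]mulrC.
  (* The edge term of [aomoto], which is zero for [a = 0] and [g = 0], is inserted to match its
     conclusion. *)
  have -> : C = C + 0 * tint (fun v => 0 * w v) by rewrite mul0r addr0.
  apply: (@aomoto R n 0 lam (lexx 0) lam0 (fun v => sin (tnth v i) * P v) _ (fun=> 0) h i) => //.
  - exact: bmeas_cst.
  - move=> k; rewrite /h; case: (i < k)%N.
      by apply: bmeasD; exact: (ncP _).1.
    apply: bmeasB; apply: bmeasM; try exact: bmeas_cst.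
      exact: (nice_chord_prod _).1.
    exact: (nss k).1.
  - by rewrite ltxx.
  - move=> k v ki; rewrite /h; case: ltnP => ik.
      rewrite /P chord_prod_swapc; last by rewrite ltnn ltnNge ltnW.
      rewrite tnth_mktuple tpermL -mulrBl -mulrDl mulrAC trig_out; ring.
    have ki' : (k < i)%N by rewrite ltn_neqAle ik val_eqE ki.
    rewrite chord_prodS /P !(chord_prodD1 _ ki') chord_prod'_swapc ?ltnn//.
    rewrite !tnth_mktuple tpermL tpermR.
    have := trig_in (tnth v i) (tnth v k).
    set c := chord2 _; set d := chord2 _; set e := chord2 _; set p := chord_prod' _ _ _.
    by move=> E; transitivity ((sin (tnth v i) * c - sin (tnth v k) * d) *
       (2 * sin (tnth v i - tnth v k)) * p); [ring|rewrite E; ring].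
have SE : 2 * \sum_(k < n | (k < i)%N) S k = - C by apply/eqP; rewrite -addr_eq0 addrC rot.
move: main; rewrite SE CE -/m -/A -/A' -[_ *+ 2]mulr_natr -[_ *+ m]mulr_natr -[_ *+ i]mulr_natr.
by set x := m%:R; set y := i%:R => H; lra.
Qed.

End chord_prod.

(** * The Gamma function *)

Section gamma_integral.
Context {R : realType}.
Notation mu := (@lebesgue_measure R).
Implicit Types s t y : R.

(** The intervals [1/(k+1), k+1] exhaust the half-line and avoid the singularity at 0 that the
    integrand has for [s < 1]; on them it is continuous. *)
Let lo (k : nat) : R := k.+1%:R^-1.
Let hi (k : nat) : R := k.+1%:R.

Let lo_gt0 k : 0 < lo k. Proof. by rewrite invr_gt0 ltr0n. Qed.
Let hi_ge1 k : 1 <= hi k. Proof. by rewrite ler1n. Qed.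
Let lo_le1 k : lo k <= 1. Proof. by rewrite invf_le1 ?ler1n// ltr0n. Qed.
Let lo_le_hi k : lo k <= hi k. Proof. exact: le_trans (lo_le1 k) (hi_ge1 k). Qed.
Let lo_decr k : lo k.+1 <= lo k. Proof. by rewrite lef_pV2 ?posrE ?ltr0n// ler_nat. Qed.
Let hi_incr k : hi k <= hi k.+1. Proof. by rewrite ler_nat. Qed.

Let exhaust_ex t : 0 < t -> exists k, lo k <= t <= hi k.
Proof.
move=> t0; pose k := (Num.truncn t + Num.truncn t^-1)%N.
exists k; apply/andP; split.
  rewrite -[leRHS]invrK lef_pV2 ?posrE ?invr_gt0 ?ltr0n//.
  by rewrite (le_trans (ltW (truncnS_gt t^-1)))// ler_nat ltnS leq_addl.
by rewrite (le_trans (ltW (truncnS_gt t)))// ler_nat ltnS leq_addr.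
Qed.

Lemma exhaust_cvg (l h : nat -> R) (f : R -> R) :
  (forall k, 0 < l k) -> (forall k, l k.+1 <= l k) -> (forall k, h k <= h k.+1) ->
  (forall t, 0 < t -> exists k, l k <= t <= h k) ->
  measurable_fun setT f -> (forall t, 0 < t -> 0 <= f t) ->
  (\int[mu]_(t in `[l k, h k]) (f t)%:E)%E @[k --> \oo] -->
  (\int[mu]_(t in `]0%R, +oo[) (f t)%:E)%E.
Proof.
move=> l0 ldecr hincr ex mf f0.
have -> : `]0%R, +oo[%classic = \bigcup_k `[l k, h k]%classic :> set R.
  apply/seteqP; split => [t /=|t [k _] /=]; rewrite !in_itv/= ?andbT.
    by move=> /ex[k hk]; exists k => //=; rewrite in_itv.
  by move=> /andP[+ _]; apply: lt_le_trans.
apply: ge0_nondecreasing_set_cvg_integral => //.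
- apply/nondecreasing_seqP => k; rewrite subsetEset => t /=; rewrite !in_itv/=.
  by move=> /andP[h1 h2]; rewrite (le_trans (ldecr k))// (le_trans h2).
- by move=> k; apply/measurable_EFinP; exact: measurable_funTS.
- move=> k t /=; rewrite in_itv/= lee_fin => /andP[lt _]; apply: f0.
  exact: lt_le_trans lt.
Qed.

Definition gamma_fun s t := t `^ (s - 1) * expR (- t).

Let Ik s k := (\int[mu]_(t in `[lo k, hi k]) gamma_fun s t)%R.

Lemma gamma_fun_ge0 s t : 0 <= gamma_fun s t.
Proof. by rewrite mulr_ge0 ?powR_ge0 ?expR_ge0. Qed.

Lemma measurable_gamma_fun s : measurable_fun setT (gamma_fun s).
Proof.
apply: measurable_funM; first exact: measurable_powR.
exact: measurableT_comp.
Qed.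

Let powR_cts s t : 0 < t -> {for t, continuous (fun x : R => x `^ s)}.
Proof.
move=> t0; apply: differentiable_continuous; apply/derivable1_diffP.
by apply: derivable_powR; rewrite in_itv/= t0.
Qed.

Let gamma_fun_cts s t : 0 < t -> {for t, continuous (gamma_fun s)}.
Proof.
move=> t0; apply: cvgM; first exact: powR_cts.
apply: (@continuous_comp _ _ _ (fun x : R => - x) expR); first exact: continuousN.
exact: continuous_expR.
Qed.

Let within_cts (f : R -> R) (a b : R) : 0 < a ->
  (forall t, 0 < t -> {for t, continuous f}) -> {within `[a, b], continuous f}.
Proof.
move=> a0 cf; apply: continuous_in_subspaceT => t; rewrite inE/= in_itv/= => /andP[at_ _].
by apply: cf; exact: lt_le_trans at_.
Qed.

Let Ik_int s k : mu.-integrable `[lo k, hi k] (EFin \o gamma_fun s).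
Proof.
apply: continuous_compact_integrable; first exact: segment_compact.
by apply: within_cts => // t; exact: gamma_fun_cts.
Qed.

Let intZ (i : interval R) (c : R) (f : R -> R) :
  mu.-integrable [set` i] (EFin \o f) -> mu.-integrable [set` i] (EFin \o (fun t => c * f t)).
Proof.
by move=> hf; have := integrableZl _ c hf; move=> /(_ (measurable_itv i)); apply: eq_integrable.
Qed.

Let intD (i : interval R) (f g : R -> R) :
  mu.-integrable [set` i] (EFin \o f) -> mu.-integrable [set` i] (EFin \o g) ->
  mu.-integrable [set` i] (EFin \o (fun t => f t + g t)).
Proof.
by move=> hf hg; have := integrableD _ hf hg; move=> /(_ (measurable_itv i)); apply: eq_integrable.
Qed.

Let IkE s k : (\int[mu]_(t in `[lo k, hi k]) (gamma_fun s t)%:E)%E = (Ik s k)%:E.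
Proof.
rewrite /Ik /Rintegral fineK//.
by apply: integrable_fin_num => //; exact: Ik_int.
Qed.

Let Ik_cvgE s : (Ik s k)%:E @[k --> \oo] --> (\int[mu]_(t in `]0%R, +oo[) (gamma_fun s t)%:E)%E.
Proof.
under eq_fun do rewrite -IkE.
apply: exhaust_cvg => //; first exact: measurable_gamma_fun.
by move=> t _; exact: gamma_fun_ge0.
Qed.

(** [Gamma] is the real value of an extended integral and would take a default value if that were
    infinite; a bound on the truncated integrals rules this out. *)
Let Ik_cvg s M : (forall k, Ik s k <= M) -> Ik s k @[k --> \oo] --> Gamma s.
Proof.
move=> hM; have h := @Ik_cvgE s.
have hf : (\int[mu]_(t in `]0%R, +oo[) (gamma_fun s t)%:E)%E \is a fin_num.
  rewrite ge0_fin_numE; last first.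
    by apply: integral_ge0 => t _; rewrite lee_fin gamma_fun_ge0.
  apply: (@le_lt_trans _ _ M%:E); last by rewrite ltry.
  apply: (@cvge_to_le _ _ _ _ _ _ _ h); apply: nearW => k.
  by rewrite lee_fin.
by move: h; rewrite -(fineK hf) => /fine_cvg.
Qed.

Let is_derive_pow_exp s t : 0 < t ->
  is_derive t (1:R) (fun x : R => x `^ s * expR (- x)) (s * gamma_fun s t - gamma_fun (s + 1) t).
Proof.
move=> t0.
have h1 := is_derive1_powR s t0.
have h2 : is_derive t (1:R) (fun x : R => expR (- x)) (- expR (- t)).
  have := is_derive1_comp (is_derive_expR (- t)) (is_deriveN (is_derive_id t (1:R))).
  by rewrite mulrN1.
apply: (is_derive_eq (is_deriveM h1 h2)).
by rewrite /GRing.scale /= /gamma_fun addrK; ring.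
Qed.

(** Valid for every real [s]. At [s = 0] the left side vanishes and the identity evaluates [Ik 1 k]
    in closed form, which is how [bounded1] and [Gamma1] start. *)
Let Ik_rec s k : s * Ik s k = Ik (s + 1) k + (hi k `^ s * expR (- hi k) - lo k `^ s * expR (- lo k)).
Proof.
(* For [k = 0] both ends are 1 and the interval is a point, whereas the fundamental theorem of
   calculus asks for a nondegenerate interval. *)
case: k => [|k].
  have z (f : R -> R) : (\int[mu]_(t in `[lo 0, hi 0]) f t)%R = 0.
    by rewrite /lo /hi invr1 set_itv1 Rintegral_set1.
  by rewrite /Ik !z /lo /hi invr1 subrr mulr0 addr0.
have lohi : lo k.+1 < hi k.+1.
  by rewrite (@lt_le_trans _ _ 1)// invf_lt1 ?ltr0n// ltr1n.
have c1 t : 0 < t -> {for t, continuous (fun t => s * gamma_fun s t - gamma_fun (s + 1) t)}.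
  move=> t0; apply: cvgB; last exact: gamma_fun_cts.
  by apply: cvgM; [exact: cvg_cst|exact: gamma_fun_cts].
have cF t : 0 < t -> {for t, continuous (fun x : R => x `^ s * expR (- x))}.
  move=> t0; apply: differentiable_continuous; apply/derivable1_diffP.
  by case: (is_derive_pow_exp s t0).
have := @continuous_FTC2 R (fun t => s * gamma_fun s t - gamma_fun (s + 1) t)
  (fun x : R => x `^ s * expR (- x)) _ _ lohi.
move=> /(_ (within_cts (lo_gt0 _) c1)) H.
have : (\int[mu]_(t in `[lo k.+1, hi k.+1]) (s * gamma_fun s t - gamma_fun (s + 1) t))%R =
    hi k.+1 `^ s * expR (- hi k.+1) - lo k.+1 `^ s * expR (- lo k.+1).
  rewrite /Rintegral H//.
    split.
    - move=> t; rewrite in_itv/= => /andP[h _].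
      by case: (is_derive_pow_exp s (lt_trans (lo_gt0 _) h)).
    - by apply: cvg_at_right_filter; exact: cF.
    - by apply: cvg_at_left_filter; apply: cF; exact: lt_trans lohi.
  move=> t; rewrite in_itv/= => /andP[h _]; rewrite derive1E.
  by have := is_derive_pow_exp s (lt_trans (lo_gt0 _) h) => ?; apply: derive_val.
rewrite RintegralB//; last exact: (intZ s (Ik_int s k.+1)).
rewrite RintegralZl//.
by rewrite -/(Ik s k.+1) -/(Ik (s + 1) k.+1) => <-; ring.
Qed.

(** The inequality x <= e^x at x = t / (2 s), raised to the power 2 s. At [t = hi k] the factor
    [t^-1] is [lo k], so both boundary terms are controlled by the same null sequence. *)
Let pow_exp_bound s t : 0 < s -> 0 < t -> t `^ s * expR (- t) <= (2 * s) `^ (2 * s) * t^-1 `^ s.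
Proof.
move=> s0 t0; have s20 : 0 < 2 * s by rewrite mulr_gt0.
have h : t / (2 * s) <= expR (t / (2 * s)).
  by rewrite (le_trans _ (expR_ge1Dx _))// lerDr.
have q0 : 0 <= t / (2 * s) by rewrite divr_ge0 ?ltW.
have := @ge0_ler_powR _ (2 * s) (ltW s20) (t / (2 * s)) (expR (t / (2 * s))).
rewrite !nnegrE expR_ge0 q0 => /(_ isT isT h).
rewrite -expRM divfK ?gt_eqF// => h2.
have tE : t `^ s * t `^ s <= (2 * s) `^ (2 * s) * expR t.
  have -> : t `^ s * t `^ s = t `^ (2 * s).
    by rewrite -powRD ?(gt_eqF t0) ?implybT// mulr_natl mulr2n.
  rewrite -{1}[t](@divfK _ (2 * s)) ?gt_eqF//.
  by rewrite (powRM _ q0 (ltW s20)) [leRHS]mulrC ler_wpM2r// powR_ge0.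
have ts0 : 0 < t `^ s by exact: powR_gt0.
rewrite expRN ler_pdivrMr ?expR_gt0//.
rewrite -(powR_inv1 (ltW t0)) -powRrM mulN1r powRN mulrAC ler_pdivlMr//.
Qed.

Let lo_to0 : lo @ \oo --> 0. Proof. exact: cvg_harmonic. Qed.

Let lo_pow s : 0 < s -> lo k `^ s @[k --> \oo] --> 0.
Proof.
move=> s0; apply: (@cvg_comp _ _ _ lo (fun x : R => x `^ s) _ (0^'+)); last exact: powR_cvg0.
move=> A hA.
have H : \forall k \near \oo, 0 < lo k -> A (lo k) by exact: lo_to0 hA.
change (\forall k \near \oo, A (lo k)).
by apply: filterS H => k; apply.
Qed.

Let bdry_le s k : 0 < s ->
  hi k `^ s * expR (- hi k) <= (2 * s) `^ (2 * s) * lo k `^ s.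
Proof.
move=> s0; have := @pow_exp_bound s (hi k) s0 _; apply.
exact: lt_le_trans (hi_ge1 k).
Qed.

Let lo_bdry_le s k : 0 < s -> lo k `^ s * expR (- lo k) <= lo k `^ s.
Proof.
move=> s0; rewrite ler_piMr ?powR_ge0// expR_le1 oppr_le0.
exact: ltW.
Qed.

Let pos_mul s t u : 0 <= t `^ s * expR u.
Proof. by rewrite mulr_ge0 ?powR_ge0 ?expR_ge0. Qed.

Let bdry_cvg s : 0 < s ->
  hi k `^ s * expR (- hi k) - lo k `^ s * expR (- lo k) @[k --> \oo] --> 0.
Proof.
move=> s0; rewrite -[X in _ --> X]subr0; apply: cvgB.
  apply: (@squeeze_cvgr _ _ _ _ (fun=> 0) (fun k => (2 * s) `^ (2 * s) * lo k `^ s)).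
  - by apply: nearW => k; rewrite pos_mul bdry_le.
  - exact: cvg_cst.
  - rewrite -[X in _ --> X](mulr0 ((2 * s) `^ (2 * s))).
    by apply: cvgM; [exact: cvg_cst|exact: lo_pow].
apply: (@squeeze_cvgr _ _ _ _ (fun=> 0) (fun k => lo k `^ s)).
- by apply: nearW => k; rewrite pos_mul lo_bdry_le.
- exact: cvg_cst.
- exact: lo_pow.
Qed.

Let pow1 s : (1 : R) `^ s = 1. Proof. by rewrite powR1. Qed.

Let lo_pow_le1 s k : 0 < s -> lo k `^ s <= 1.
Proof.
move=> s0; rewrite -[leRHS](pow1 s); apply: ge0_ler_powR; rewrite ?nnegrE ?lo_le1 ?ler01//; exact: ltW.
Qed.

Let bounded s := exists M, forall k, Ik s k <= M.

Let bounded1 : bounded 1.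
Proof.
exists 1 => k; have := Ik_rec 0 k; rewrite mul0r add0r !powRr0 !mul1r.
have : expR (- lo k) <= 1 by rewrite expR_le1 oppr_le0 ltW.
by have := expR_ge0 (- hi k); lra.
Qed.

Let boundedS s : 0 < s -> bounded s -> bounded (s + 1).
Proof.
move=> s0 [M hM]; exists (s * M + 1) => k.
have := Ik_rec s k; have := hM k; have := pos_mul s (hi k) (- hi k).
have := lo_bdry_le k s0; have := lo_pow_le1 k s0.
move=> h1 h2 h3 h4 h5.
have : s * Ik s k <= s * M by rewrite ler_pM2l.
by lra.
Qed.

Let bounded_pred s : 0 < s -> bounded (s + 1) -> bounded s.
Proof.
move=> s0 [M hM]; exists ((M + (2 * s) `^ (2 * s)) / s) => k.
rewrite ler_pdivlMr// mulrC Ik_rec.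
have h1 := hM k; have h2 := bdry_le k s0; have h3 := pos_mul s (lo k) (- lo k).
have h4 : (2 * s) `^ (2 * s) * lo k `^ s <= (2 * s) `^ (2 * s).
  by rewrite ler_piMr ?powR_ge0// lo_pow_le1.
by lra.
Qed.

Let bounded_nat m : bounded m.+1%:R.
Proof.
elim: m => [|m IH]; first exact: bounded1.
by rewrite -natr1; apply: boundedS.
Qed.

(** With m the integer part of s - 1, t^(s-1) is at most t^0 for t <= 1 and at most t^(m+1) beyond;
    so two integer exponents dominate. Values [s < 1] are reached afterwards by one step down the
    recurrence. *)
Let bounded_ge1 s : 1 <= s -> bounded s.
Proof.
move=> s1; pose m := Num.truncn (s - 1).
have [M1 h1] := bounded1; have [M2 h2] := bounded_nat m.+1.
exists (M1 + M2) => k.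
apply: (@le_trans _ _ (Ik 1 k + Ik m.+2%:R k)); last by apply: lerD.
rewrite -RintegralD//.
apply: le_Rintegral => //.
  by apply: intD => //; exact: Ik_int.
move=> t; rewrite /= in_itv/= => /andP[tlo _].
have t0 : 0 < t by exact: lt_le_trans tlo.
rewrite /gamma_fun -mulrDl ler_wpM2r ?expR_ge0// subrr powRr0.
have [t1|t1] := leP t 1.
  rewrite (@le_trans _ _ 1)// ?lerDl ?powR_ge0//.
  rewrite -[leRHS](pow1 (s - 1)); apply: ge0_ler_powR; rewrite ?nnegrE ?subr_ge0// ltW//.
rewrite (@le_trans _ _ (t `^ (m.+2%:R - 1)))// ?lerDr//.
apply: ler_powR; first exact: ltW.
rewrite -natr1 addrK; exact/ltW/truncnS_gt.
Qed.

Let bounded_gt0 s : 0 < s -> bounded s.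
Proof.
move=> s0; apply: bounded_pred => //; apply: bounded_ge1.
by rewrite lerDr ltW.
Qed.

Let Ik_Gamma s : 0 < s -> Ik s k @[k --> \oo] --> Gamma s.
Proof. by move=> /bounded_gt0[M hM]; exact: (Ik_cvg hM). Qed.

Lemma GammaS s : 0 < s -> Gamma (s + 1) = s * Gamma s.
Proof.
move=> s0; have h1 : s * Ik s k @[k --> \oo] --> s * Gamma s.
  by apply: cvgM; [exact: cvg_cst|exact: Ik_Gamma].
have h2 : s * Ik s k @[k --> \oo] --> Gamma (s + 1) + 0.
  under eq_fun do rewrite Ik_rec.
  by apply: cvgD; [apply: Ik_Gamma; rewrite addr_gt0|exact: bdry_cvg].
rewrite addr0 in h2.
exact: (@cvg_unique _ (@Rhausdorff R) _ _ _ _ h2 h1).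
Qed.

Lemma Gamma1 : Gamma 1 = 1 :> R.
Proof.
have h1 := Ik_Gamma ltr01.
have h2 : Ik 1 k @[k --> \oo] --> (1 : R).
  have -> : Ik 1 = fun k => expR (- lo k) - expR (- hi k).
    apply/funext => k; have := Ik_rec 0 k; rewrite mul0r add0r !powRr0 !mul1r; lra.
  rewrite -[X in _ --> X]subr0; apply: cvgB.
    rewrite -[X in _ --> X]expR0 -oppr0.
    apply: (@continuous_cvg _ _ _ _ _ (fun k => - lo k) expR); first exact: continuous_expR.
    by apply: cvgN; exact: lo_to0.
  by have := @cvgn_expR R; rewrite -(cvg_shiftS (fun n => expR (- n%:R))).
exact: (@cvg_unique _ (@Rhausdorff R) _ _ _ _ h1 h2).
Qed.

(* Weighted arithmetic-geometric mean, from the tangent of the exponential at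
   [s * ln u]. *)
Let powR_le_tangent s u : 0 <= s <= 1 -> 0 < u -> u `^ s <= 1 - s + s * u.
Proof.
move=> /andP[s0 s1] u0; rewrite /powR gt_eqF//; set c := s * ln u.
have h1 : expR c * (1 + (ln u - c)) <= u.
  have uE : u = expR c * expR (ln u - c) by rewrite -expRD addrC subrK lnK.
  by rewrite [leRHS]uE ler_wpM2l ?expR_ge0// expR_ge1Dx.
have h2 : expR c * (1 - c) <= 1.
  rewrite -[leRHS]expR0 -[in leRHS](subrr c) expRD.
  by rewrite ler_wpM2l ?expR_ge0// expR_ge1Dx.
have : s * (expR c * (1 + (ln u - c))) <= s * u by rewrite ler_wpM2l.
have : (1 - s) * (expR c * (1 - c)) <= 1 - s.
  by rewrite -[leRHS]mulr1 ler_wpM2l// subr_ge0.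
have : s * (expR c * (1 + (ln u - c))) + (1 - s) * (expR c * (1 - c)) =
   expR c * (1 - c + s * ln u) by ring.
rewrite -/c subrK mulr1; lra.
Qed.

(** Wendel's inequality. The tangent bound is used at u = t / y, because with this choice [GammaS]
    collapses the integrated right side to exactly [y ^ s * Gamma y]. *)
Lemma Gamma_shift_le y s : 0 < y -> 0 <= s <= 1 -> Gamma (y + s) <= y `^ s * Gamma y.
Proof.
move=> y0 hs; have /andP[s0 s1] := hs.
have ys0 : 0 < y + s by rewrite ltr_pwDl.
have -> : y `^ s * Gamma y = y `^ s * ((1 - s) * Gamma y + s / y * Gamma (y + 1)).
  by rewrite GammaS//; field; rewrite gt_eqF.
have h2 : y `^ s * ((1 - s) * Ik y k + s / y * Ik (y + 1) k) @[k --> \oo] -->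
    y `^ s * ((1 - s) * Gamma y + s / y * Gamma (y + 1)).
  apply: cvgM; first exact: cvg_cst.
  by apply: cvgD; apply: cvgM; [exact: cvg_cst|exact: Ik_Gamma|exact: cvg_cst
    |apply: Ik_Gamma; rewrite addr_gt0].
apply: (ler_cvg_to (Ik_Gamma ys0) h2); apply: nearW => k.
have i1 := Ik_int y k; have i2 := Ik_int (y + 1) k; have i3 := Ik_int (y + s) k.
have mI := measurable_itv `[lo k, hi k].
have i4 : mu.-integrable `[lo k, hi k] (EFin \o (fun t => (1 - s) * gamma_fun y t)).
  exact: intZ.
have i5 : mu.-integrable `[lo k, hi k] (EFin \o (fun t => s / y * gamma_fun (y + 1) t)).
  exact: intZ.
have i6 : mu.-integrable `[lo k, hi k] (EFin \o (fun t => (1 - s) * gamma_fun y t + s / y * gamma_fun (y + 1) t)).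
  exact: intD.
have i7 : mu.-integrable `[lo k, hi k] (EFin \o (fun t => y `^ s * ((1 - s) * gamma_fun y t + s / y * gamma_fun (y + 1) t))).
  exact: intZ.
rewrite -!RintegralZl// -RintegralD// -RintegralZl//.
apply: le_Rintegral => // t; rewrite /= in_itv/= => /andP[tlo _].
have t0 : 0 < t by exact: lt_le_trans tlo.
have u0 : 0 < t / y by rewrite divr_gt0.
have := powR_le_tangent hs u0.
have -> : gamma_fun (y + s) t = gamma_fun y t * (y `^ s * (t / y) `^ s).
  rewrite -powRM ?ltW// mulrCA divff ?gt_eqF// mulr1 /gamma_fun mulrAC -powRD.
    by rewrite addrAC.
  by rewrite (gt_eqF t0) implybT.
have -> : gamma_fun (y + 1) t = t * gamma_fun y t.
  by rewrite /gamma_fun addrK mulrA mulr_powRB1// ltW.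
move=> h; rewrite mulrCA ler_wpM2l ?powR_ge0//.
have -> : (1 - s) * gamma_fun y t + s / y * (t * gamma_fun y t) =
    gamma_fun y t * (1 - s + s * (t / y)) by ring.
by rewrite ler_wpM2l ?gamma_fun_ge0.
Qed.

(** The substitution t = x^2 gives twice the Gaussian integral over the half-line; the exhausting
    intervals on the two sides correspond under squaring. *)
Lemma Gamma_half : Gamma 2^-1 = Num.sqrt pi :> R.
Proof.
have half0 : 0 < 2^-1 :> R by [].
pose l k := lo k ^+ 2; pose h k := hi k ^+ 2.
have l0 k : 0 < l k by rewrite exprn_gt0.
have H1 : (\int[mu]_(t in `[l k, h k]) (gamma_fun 2^-1 t)%:E)%E @[k --> \oo] -->
  (\int[mu]_(t in `]0%R, +oo[) (gamma_fun 2^-1 t)%:E)%E.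
  apply: exhaust_cvg => //.
  - by move=> k; rewrite /l ler_sqr ?nnegrE ?(ltW (lo_gt0 _)).
  - by move=> k; rewrite /h ler_sqr ?nnegrE ?(le_trans ler01 (hi_ge1 _)).
  - move=> t t0; have [k /andP[h1 h2]] := exhaust_ex t0; exists k; apply/andP; split.
      by rewrite (le_trans _ h1)// /l expr2 ler_piMl// ?(ltW (lo_gt0 _)).
    by rewrite (le_trans h2)// /h expr2 ler_peMl// (le_trans ler01 (hi_ge1 _)).
  - exact: measurable_gamma_fun.
  - by move=> t _; exact: gamma_fun_ge0.
have H2 : (\int[mu]_(t in `[lo k, hi k]) (2 * gauss_fun t)%:E)%E @[k --> \oo] -->
  (\int[mu]_(t in `]0%R, +oo[) (2 * gauss_fun t)%:E)%E.
  apply: exhaust_cvg => //.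
  - by apply: measurable_funM => //; exact: measurable_gauss_fun.
  - by move=> t _; rewrite mulr_ge0// gauss_fun_ge0.
have E k : (\int[mu]_(t in `[l k, h k]) (gamma_fun 2^-1 t)%:E)%E =
   (\int[mu]_(t in `[lo k, hi k]) (2 * gauss_fun t)%:E)%E.
  have dF x : is_derive x (1:R) (fun x : R => x ^+ 2) (2 * x).
    by apply: is_derive_eq; rewrite /GRing.scale /= mulr1 mulr_natl.
  have F'E : derive1 (fun x : R => x ^+ 2) = fun x => 2 * x.
    by apply/funext => x; rewrite derive1E; apply: derive_val.
  have cF' : continuous (fun x : R => 2 * x).
    by move=> x; apply: cvgM; [exact: cvg_cst|exact: cvg_id].
  have cF : continuous (fun x : R => x ^+ 2) by exact: exprn_continuous.
  rewrite /l /h.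
  rewrite (@integration_by_substitution_increasing _ (fun x => x ^+ 2) (gamma_fun 2^-1)).
  - apply: eq_integral => x; rewrite inE/= in_itv/= => /andP[xlo _].
    have x0 : 0 < x by exact: lt_le_trans xlo.
    congr (_%:E); rewrite F'E.
    change (gamma_fun 2^-1 (x ^+ 2) * (2 * x) = 2 * gauss_fun x).
    rewrite /gamma_fun /gauss_fun.
    have -> : (x ^+ 2) `^ (2^-1 - 1) = x^-1.
      rewrite -powR_mulrn ?ltW// -powRrM (_ : 2 * (2^-1 - 1) = - 1).
        by rewrite powR_inv1// ltW.
      by lra.
    by field; rewrite gt_eqF.
  - exact: lo_le_hi.
  - move=> x y; rewrite !in_itv/= => /andP[x0 _] /andP[y0 _] xy.
    by rewrite ltr_sqr ?nnegrE// (le_trans _ x0, le_trans _ y0)// ltW.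
  - by rewrite F'E => x _; exact: cF'.
  - by rewrite F'E; apply/cvg_ex; eexists; apply: cvg_at_right_filter; exact: cF'.
  - by rewrite F'E; apply/cvg_ex; eexists; apply: cvg_at_left_filter; exact: cF'.
  - split.
    + by move=> x _; case: (dF x).
    + by apply: cvg_at_right_filter; exact: cF.
    + by apply: cvg_at_left_filter; exact: cF.
  - by apply: within_cts; [exact: l0|move=> t; exact: gamma_fun_cts].
rewrite /Gamma /Rintegral -/(gamma_fun 2^-1).
have -> : (\int[mu]_(t in `]0%R, +oo[) (gamma_fun 2^-1 t)%:E =
    \int[mu]_(t in `]0%R, +oo[) (2 * gauss_fun t)%:E)%E.
  apply: (@cvg_unique _ _ _ _ _ _ H1); first exact: ereal_hausdorff.
  by rewrite (funext E).
rewrite integral_itv_obnd_cbnd; last first.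
  apply/measurable_EFinP; apply: measurable_funTS; apply: measurable_funM => //.
  exact: measurable_gauss_fun.
under eq_integral do rewrite EFinM.
rewrite ge0_integralZl//=.
- by rewrite integral0y_gauss -EFinM /= mulrC divfK.
- by apply/measurable_EFinP; apply: measurable_funTS; exact: measurable_gauss_fun.
- by move=> x _; rewrite lee_fin gauss_fun_ge0.
Qed.

End gamma_integral.

(** * Euler's limit and the duplication formula *)

Lemma dbl_cvg : N.*2.+1 @[N --> \oo] --> \oo.
Proof.
move=> A [m _ mA]; exists m => // N /= mN; apply: mA => /=.
by rewrite (leq_trans mN)// -addnn -addnS leq_addr.
Qed.

Definition poch {R : realType} (s : R) (N : nat) : R := \prod_(i < N) (s + i%:R).

Section gamma_asymptotics.
Context {R : realType}.
Implicit Types s y : R.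

(** For y in ]0, 1], [Gamma_shift_le] with exponent 1 - y reads 1 <= y^(1-y) Gamma y, since Gamma 1
    = 1; [GammaS] then carries positivity upwards. *)
Lemma Gamma_gt0 s : 0 < s -> 0 < Gamma s.
Proof.
move=> s0; have small y : 0 < y <= 1 -> 0 < Gamma y.
  move=> /andP[y0 y1]; have := @Gamma_shift_le R y (1 - y) y0.
  rewrite (_ : y + (1 - y) = 1) ?Gamma1; last by ring.
  rewrite subr_ge0 y1 gerBl (ltW y0) => /(_ isT) h.
  by have := lt_le_trans ltr01 h; rewrite pmulr_rgt0// powR_gt0.
have gen m : forall y, 0 < y <= m.+1%:R -> 0 < Gamma y.
  elim: m => [//|m IH] y /andP[y0 ym].
  have [y1|y1] := leP y 1; first by apply: small; rewrite y0.
  rewrite -(subrK 1 y) GammaS ?subr_gt0// mulr_gt0 ?subr_gt0//.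
  by apply: IH; rewrite subr_gt0 y1 lerBlDr natr1.
by apply: (gen (Num.truncn s)); rewrite s0 ltW// truncnS_gt.
Qed.

Lemma poch_gt0 s N : 0 < s -> 0 < poch s N.
Proof. by move=> s0; apply: prodr_gt0 => i _; rewrite ltr_wpDr. Qed.

Lemma pochS s N : poch s N.+1 = poch s N * (s + N%:R).
Proof. by rewrite /poch big_ord_recr. Qed.

Lemma Gamma_poch s N : 0 < s -> Gamma (s + N%:R) = poch s N * Gamma s.
Proof.
move=> s0; elim: N => [|N IH]; first by rewrite addr0 /poch big_ord0 mul1r.
rewrite -natr1 addrA GammaS; last by rewrite ltr_wpDr.
by rewrite IH pochS mulrCA mulrA.
Qed.

Lemma Gamma_nat N : Gamma N.+1%:R = N`!%:R :> R.
Proof.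
elim: N => [|N IH]; first by rewrite Gamma1.
by rewrite -natr1 GammaS ?ltr0n// IH factS natrM.
Qed.

Let ratio s N : R := Gamma (N.+1%:R + s) / (N`!%:R * N.+1%:R `^ s).

Let fact_neq0 N : N`!%:R != 0 :> R.
Proof. by rewrite pnatr_eq0 -lt0n fact_gt0. Qed.

Let powR_cvg1 (u : nat -> R) p : u @ \oo --> (1 : R) -> u n `^ p @[n --> \oo] --> (1 : R).
Proof.
move=> hu; rewrite -[X in _ --> X](_ : (1 : R) `^ p = 1); last by rewrite powR1.
apply: (@continuous_cvg _ _ _ _ _ u (fun x : R => x `^ p)) => //.
apply: differentiable_continuous; apply/derivable1_diffP.
by apply: derivable_powR; rewrite in_itv/= ltr01.
Qed.

Let ratio1_cvg s : (N.+1%:R + s) / N.+1%:R @[N --> \oo] --> (1 : R).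
Proof.
have -> : (fun N : nat => (N.+1%:R + s) / N.+1%:R) = fun N => 1 + s * N.+1%:R^-1.
  by apply/funext => N; rewrite mulrDl divff ?pnatr_eq0.
rewrite -[X in _ --> X]addr0; apply: cvgD; first exact: cvg_cst.
rewrite -[X in _ --> X](mulr0 s); apply: cvgM; first exact: cvg_cst.
exact: cvg_harmonic.
Qed.

(** [Gamma_shift_le] at N + 1 with exponent s bounds the ratio by 1. At N + 1 + s with exponent 1 -
    s it bounds Gamma (N + 2) = (N + 1) N! from above, hence the ratio from below. *)
Let ratio_cvg01 s : 0 <= s <= 1 -> ratio s N @[N --> \oo] --> (1 : R).
Proof.
move=> /andP[s0 s1].
have n0 N : 0 < N.+1%:R :> R by rewrite ltr0n.
have ns0 N : 0 < N.+1%:R + s :> R by rewrite ltr_wpDr.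
have den0 N : 0 < N`!%:R * N.+1%:R `^ s by rewrite mulr_gt0 ?ltr0n ?fact_gt0// powR_gt0.
apply: (@squeeze_cvgr _ _ _ _ (fun N => (((N.+1%:R + s) / N.+1%:R)^-1) `^ (1 - s)) (fun=> 1)).
- apply: nearW => N; rewrite /ratio ler_pdivrMr// mul1r; apply/andP; split; last first.
    by rewrite -Gamma_nat mulrC; apply: Gamma_shift_le; rewrite // s0.
  rewrite ler_pdivlMr//.
  have := @Gamma_shift_le R (N.+1%:R + s) (1 - s) (ns0 N).
  rewrite subr_ge0 s1 gerBl s0 => /(_ isT).
  have -> : N.+1%:R + s + (1 - s) = N.+1%:R + 1 by ring.
  rewrite GammaS// Gamma_nat => h.
  rewrite invf_div powRM ?invr_ge0 ?(ltW (n0 N)) ?(ltW (ns0 N))//.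
  have -> : (N.+1%:R + s)^-1 `^ (1 - s) = ((N.+1%:R + s) `^ (1 - s))^-1.
    by rewrite -(powR_inv1 (ltW (ns0 N))) -powRrM mulN1r powRN.
  have E1 : N.+1%:R `^ (1 - s) * N.+1%:R `^ s = N.+1%:R :> R.
    by rewrite -powRD ?subrK ?powRr1 ?(ltW (n0 N))// (gt_eqF (n0 N)) implybT.
  rewrite (_ : _ * _ * _ = (N.+1%:R `^ (1 - s) * N.+1%:R `^ s) * N`!%:R /
    (N.+1%:R + s) `^ (1 - s)); last by ring.
  by rewrite E1 ler_pdivrMr ?powR_gt0// [leRHS]mulrC.
- apply: powR_cvg1; rewrite -[X in _ --> X]invr1; apply: cvgV; first exact: oner_neq0.
  exact: ratio1_cvg.
- exact: cvg_cst.
Qed.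

Let ratio_cvg s : 0 <= s -> ratio s N @[N --> \oo] --> (1 : R).
Proof.
move=> s0; have gen m : forall y, 0 <= y <= m.+1%:R -> ratio y N @[N --> \oo] --> (1 : R).
  elim: m => [|m IH] y /andP[y0 ym]; first by apply: ratio_cvg01; rewrite y0.
  have [y1|y1] := leP y 1; first by apply: ratio_cvg01; rewrite y0.
  have -> : ratio y = fun N => ratio (y - 1) N * ((N.+1%:R + (y - 1)) / N.+1%:R).
    apply/funext => N; rewrite /ratio.
    have n0 : 0 < N.+1%:R :> R by rewrite ltr0n.
    have -> : N.+1%:R + y = N.+1%:R + (y - 1) + 1 by ring.
    rewrite GammaS; last by rewrite ltr_wpDr// subr_ge0 ltW.
    have -> : N.+1%:R `^ y = N.+1%:R `^ (y - 1) * N.+1%:R.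
      rewrite -[X in _ * X](powRr1 (ltW n0)) -powRD ?subrK//.
      by rewrite (gt_eqF n0) implybT.
    have p0 : N.+1%:R `^ (y - 1) != 0 :> R by rewrite gt_eqF// powR_gt0.
    by field; rewrite nat1r p0 fact_neq0 pnatr_eq0.
  rewrite -[X in _ --> X]mulr1; apply: cvgM; last exact: ratio1_cvg.
  by apply: IH; rewrite subr_ge0 (ltW y1) lerBlDr natr1.
by apply: (gen (Num.truncn s)); rewrite s0 ltW// truncnS_gt.
Qed.

Lemma poch_cvg s : 0 < s ->
  poch s N.+1 / (N`!%:R * N.+1%:R `^ s) @[N --> \oo] --> (Gamma s)^-1.
Proof.
move=> s0; have := ratio_cvg (ltW s0).
have -> : (fun N => poch s N.+1 / (N`!%:R * N.+1%:R `^ s)) = fun N => ratio s N * (Gamma s)^-1.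
  apply/funext => N; rewrite /ratio addrC Gamma_poch//.
  by rewrite [_ * Gamma s / _]mulrAC mulfK// gt_eqF// Gamma_gt0.
move=> h; rewrite -[X in _ --> X]mul1r; apply: cvgM => //; exact: cvg_cst.
Qed.

Lemma poch_double s N : poch (2 * s) N.*2 = 4 ^+ N * (poch s N * poch (s + 2^-1) N).
Proof.
elim: N => [|N IH]; first by rewrite /poch !big_ord0 expr0 !mulr1.
by rewrite doubleS !pochS IH exprS -!natr1 -muln2 natrM; field.
Qed.

Lemma Gamma_duplication s : 0 < s ->
  Gamma s * Gamma (s + 2^-1) * 2 `^ (2 * s) = 2 * Num.sqrt pi * Gamma (2 * s).
Proof.
(* [W] does not depend on [y], so its limit gives the same constant for all [y > 0]; comparison with
   y = 1/2 identifies it as 2 sqrt pi. *)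
pose W N : R := 4 ^+ N.+1 * N`!%:R ^+ 2 * N.+1%:R `^ 2^-1 / (N.*2.+1)`!%:R.
have cvgW y : 0 < y -> W @ \oo --> Gamma y * Gamma (y + 2^-1) * 2 `^ (2 * y) / Gamma (2 * y).
  move=> y0; have y20 : 0 < 2 * y by rewrite mulr_gt0.
  have yh0 : 0 < y + 2^-1 by rewrite addr_gt0.
  have h1 := poch_cvg y0; have h2 := poch_cvg yh0.
  have h3 : poch (2 * y) N.*2.+2 / (N.*2.+1`!%:R * N.*2.+2%:R `^ (2 * y)) @[N --> \oo]
      --> (Gamma (2 * y))^-1.
    exact: (cvg_comp _ _ dbl_cvg (poch_cvg y20)).
  have E : W = fun N => (poch (2 * y) N.*2.+2 / (N.*2.+1`!%:R * N.*2.+2%:R `^ (2 * y))) *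
      (2 `^ (2 * y)) / ((poch y N.+1 / (N`!%:R * N.+1%:R `^ y)) *
        (poch (y + 2^-1) N.+1 / (N`!%:R * N.+1%:R `^ (y + 2^-1)))).
    apply/funext => N; rewrite -doubleS poch_double /W.
    have n0 : 0 < N.+1%:R :> R by rewrite ltr0n.
    have -> : N.+1.*2%:R = 2 * N.+1%:R :> R by rewrite -mul2n natrM.
    rewrite powRM ?ltW//.
    have -> : N.+1%:R `^ (2 * y) = N.+1%:R `^ y * N.+1%:R `^ y.
      by rewrite -powRD ?(gt_eqF n0) ?implybT// mulr_natl mulr2n.
    rewrite powRD; last by rewrite (gt_eqF n0) implybT.
    have p1 := poch_gt0 N.+1 y0; have p2 := poch_gt0 N.+1 yh0.
    have p3 : 0 < N.+1%:R `^ y :> R by rewrite powR_gt0.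
    have p4 : 0 < N.+1%:R `^ 2^-1 :> R by rewrite powR_gt0.
    have p5 : 0 < 2 `^ (2 * y) :> R by rewrite powR_gt0.
    field.
    by rewrite !(gt_eqF p1, gt_eqF p2, gt_eqF p3, gt_eqF p4, gt_eqF p5) !fact_neq0.
  rewrite E.
  have -> : Gamma y * Gamma (y + 2^-1) * 2 `^ (2 * y) / Gamma (2 * y) =
     (Gamma (2 * y))^-1 * 2 `^ (2 * y) / ((Gamma y)^-1 * (Gamma (y + 2^-1))^-1).
    move: (Gamma y) (Gamma (y + 2^-1)) (Gamma (2 * y)) => g1 g2 g3.
    by rewrite invfM !invrK; ring.
  apply: cvgM; first by apply: cvgM => //; exact: cvg_cst.
  apply: cvgV; first by rewrite mulf_neq0// invr_neq0// gt_eqF// Gamma_gt0.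
  exact: (cvgM h1 h2).
move=> s0.
have half0 : 0 < 2^-1 :> R by [].
have := @cvg_unique _ (@Rhausdorff R) _ _ _ _ (cvgW _ s0) (cvgW _ half0).
have -> : 2 * 2^-1 = 1 :> R by rewrite divff.
have -> : 2^-1 + 2^-1 = 1 :> R by rewrite [RHS]splitr mul1r.
rewrite (powRr1 (ler0n _ 2)) Gamma1 Gamma_half invr1 !mulr1 => h.
have G0 : Gamma (2 * s) != 0 by rewrite gt_eqF// Gamma_gt0// mulr_gt0.
by rewrite -[LHS](divfK G0) h [Num.sqrt _ * _]mulrC.
Qed.

End gamma_asymptotics.

(** * Dyson's normalisation *)

Section succ_integral.
Context {R : realType} {n : nat} (lam : R) (lam0 : 0 < lam).

Lemma tint_cwt_succ : tint (@cwt R n.+1 0 lam 0) = tint (@cwt R n lam lam 0).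
Proof.
have powD x : 0 <= x -> x `^ (lam / 2) * x `^ (lam / 2) = x `^ lam :> R.
  rewrite le_eqVlt => /predU1P[<-|x0].
    by rewrite !powR0 ?mul0r// gt_eqF// divr_gt0.
  by rewrite -powRD -?splitr// (gt_eqF x0) implybT.
have E t (s : n.-tuple R) : cwt 0 lam 0 [tuple of t :: s] =
    cwt lam lam 0 (map_tuple (+%R^~ (- t)) s) :> R.
  rewrite /cwt [X in X * _]big1 ?mul1r => [|j _]; last by rewrite powRr0.
  rewrite big_ord_recl big_mkcond /= big_ord_recl /= mul1r.
  under [X in _ * X]eq_bigr => j _.
    rewrite big_mkcond big_ord_recl /=.
    over.
  rewrite big_split /= mulrA -big_split /=; congr (_ * _).
    apply: eq_bigr => j _; rewrite !tnthS tnth_map /= !addr0.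
    by rewrite -(opprB (tnth s j)) chord2N powD// chord2_ge0.
  apply: eq_bigr => j _; rewrite -big_mkcond /=.
  apply: eq_big => [k|k _]; first by rewrite (inj_eq (@lift_inj _ _)).
  by rewrite !tnthS !tnth_map /=; congr ((chord2 _ + _) `^ _); ring.
(* After rotation by [- t] the inner average no longer depends on [t]; only [t] in [- pi, pi] is
   considered, the range of translations that [tint_shift] accepts. *)
rewrite /= -[RHS]avg_cst /avg; congr (_ * _); apply: eq_Rintegral => t.
rewrite inE/= in_itv/= => /andP[t1 t2].
under eq_fun do rewrite E.
apply: tint_shift.
- by apply: bmeas_cwt => //; [exact: ltW|rewrite lexx ler01].
- by rewrite lerN2 t2 lerNl t1.
- by apply: ccont_cwt => //; exact: ltW.
- move=> v i s; rewrite /cwt.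
  have c2 x : chord2 (x + 2 * pi) = chord2 x :> R.
    by rewrite /chord2 [2 * pi]mulr_natl cosD2pi.
  have E1 j : chord2 (tnth (setc v i (s + 2 * pi)) j) = chord2 (tnth (setc v i s) j).
    by rewrite !tnth_mktuple; case: ifP.
  have E2 j k : chord2 (tnth (setc v i (s + 2 * pi)) j - tnth (setc v i (s + 2 * pi)) k)
            = chord2 (tnth (setc v i s) j - tnth (setc v i s) k).
    rewrite !tnth_mktuple; case: ifP => _; case: ifP => _ //; rewrite ?subrr//.
      by rewrite addrAC c2.
    by rewrite -chord2N opprB addrAC c2 -chord2N opprB.
  congr (_ * _); first by apply: eq_bigr => j _; rewrite E1.
  by apply: eq_bigr => j _; apply: eq_bigr => k _; rewrite E2.
Qed.

End succ_integral.

(** * From integer shifts of the exponent to its value lam *)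

Section morris.
Context {R : realType} {n : nat} (lam : R) (lam0 : 0 < lam).
Local Notation M a := (tint (@cwt R n a lam 0)).
Context (M0 : 0 < M 0).

(** Raising the exponent multiplies the integrand by n factors chord2^(b-a), each at most 4^(b-a).
    This compares exponents whose difference is not an integer. *)
Let cwt_mono (a b : R) : 0 <= a -> a <= b -> M b <= M a * (4 `^ (b - a)) ^+ n.
Proof.
move=> a0 ab; have b0 : 0 <= b by exact: le_trans ab.
have hI : is_true ((0 : R) <= (0 : R) <= (1 : R)) by rewrite lexx ler01.
rewrite mulrC -tintZ; last exact: bmeas_cwt.
apply: tint_le.
- exact: bmeas_cwt.
- by apply: bmeasM; [exact: bmeas_cst|exact: bmeas_cwt].
move=> v; rewrite /cwt mulrA ler_wpM2r//.
  by apply: prodr_ge0 => i _; apply: prodr_ge0 => j _; rewrite powR_ge0.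
rewrite -[n in _ ^+ n]card_ord -prodr_const -big_split /=.
apply: ler_prod => j _; rewrite powR_ge0 /= addr0.
have x0 := chord2_ge0 (tnth v j); have x4 := chord2_le4 (tnth v j).
move: x0; rewrite le_eqVlt => /predU1P[<-|x0].
  (* Where [chord2] vanishes the exponents cannot be subtracted: the case [b = a], possibly 0, is
     trivial, and otherwise b > 0 makes the left side 0. *)
  have [->|bn0] := eqVneq b a; first by rewrite subrr powRr0 mul1r.
  by rewrite powR0 ?mulr_ge0 ?powR_ge0// gt_eqF// (le_lt_trans a0)// lt_neqAle eq_sym bn0.
have -> : chord2 (tnth v j) `^ b = chord2 (tnth v j) `^ (b - a) * chord2 (tnth v j) `^ a.
  by rewrite -powRD ?subrK// (gt_eqF x0) implybT.
rewrite ler_wpM2r ?powR_ge0//.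
move: (chord2 _) x0 x4 => x x0 x4.
by apply: ge0_ler_powR; rewrite ?nnegrE ?subr_ge0 ?(ltW x0)//.
Qed.

Let M_step (a : R) : 0 <= a ->
  M (a + 1) * \prod_(j < n) (1 + a + lam * j%:R) ^+ 2 =
  M a * \prod_(j < n) ((1 + 2 * a + lam * j%:R) * (2 + 2 * a + lam * j%:R)).
Proof. by move=> a0; exact: tint_cwt_shift. Qed.

Let lamj j : 0 <= lam * j%:R :> R. Proof. by rewrite mulr_ge0// ltW. Qed.

(** A unit shift of [a] raises 1 + 2 a by 2, so the two factors of successive steps are consecutive
    and fill a Pochhammer symbol of length 2 N. *)
Let M_poch (a : R) N : 0 <= a ->
  M (a + N%:R) * \prod_(j < n) poch (1 + a + lam * j%:R) N ^+ 2 =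
  M a * \prod_(j < n) poch (1 + 2 * a + lam * j%:R) N.*2.
Proof.
move=> a0; elim: N => [|N IH].
  rewrite addr0; congr (_ * _); apply: eq_bigr => j _.
  by rewrite /poch !big_ord0 expr1n.
have := @M_step (a + N%:R); rewrite addr_ge0// => /(_ isT) h.
rewrite -natr1 addrA.
under eq_bigr do rewrite pochS exprMn.
under [in RHS]eq_bigr do rewrite doubleS !pochS.
rewrite big_split /= mulrCA.
have -> : M (a + N%:R + 1) * \prod_(j < n) (1 + a + lam * j%:R + N%:R) ^+ 2 =
   M (a + N%:R) * \prod_(j < n) ((1 + 2 * a + lam * j%:R + N.*2%:R) *
     (1 + 2 * a + lam * j%:R + N.*2.+1%:R)).
  rewrite [X in _ * X = _](eq_bigr (fun j : 'I_n => (1 + (a + N%:R) + lam * j%:R) ^+ 2)); last first.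
    by move=> j _; congr (_ ^+ 2); ring.
  rewrite h; congr (_ * _); apply: eq_bigr => j _.
  by rewrite -natr1 -mul2n natrM; congr (_ * _); ring.
rewrite mulrCA mulrA IH -mulrA -big_split /=; congr (_ * _); apply: eq_bigr => j _.
by rewrite mulrA.
Qed.

(** Positivity starts from [M0], which the induction on n in [tint_cwt_dyson] supplies through the
    closed form. *)
Let M_gt0 N : 0 < M N%:R.
Proof.
have := @M_poch 0 N (lexx 0); rewrite add0r => h.
have p (c : R) : 0 < c -> forall K, 0 < \prod_(j < n) poch (c + lam * j%:R) K.
  by move=> c0 K; apply: prodr_gt0 => j _; apply: poch_gt0; rewrite ltr_wpDr.
have q : 0 < \prod_(j < n) poch (1 + 0 + lam * j%:R) N ^+ 2.
  by rewrite prodrXl exprn_gt0// p// addr0.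
by rewrite -(pmulr_lgt0 _ q) h pmulr_rgt0// mulr0 p// addr0.
Qed.

Let inv_cvg0 (c : R) : 0 <= c -> (1 + N%:R + c)^-1 @[N --> \oo] --> (0 : R).
Proof.
move=> c0; apply: (@squeeze_cvgr _ _ _ _ (fun=> 0) (fun N => N.+1%:R^-1)).
- apply: nearW => N; have N0 : 0 < N.+1%:R :> R by rewrite ltr0n.
  rewrite nat1r invr_ge0 addr_ge0//= lef_pV2 ?posrE ?lerDl//.
  by rewrite ltr_wpDr.
- exact: cvg_cst.
- exact: cvg_harmonic.
Qed.

Let tau m N : R := M (N + m)%:R / (M N%:R * (4 `^ m%:R) ^+ n).

(** In the unit shift (1 + 2a + lam j) (2 + 2a + lam j) / (1 + a + lam j)^2 tends to 4 as [a] grows,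
    so at integers the bound of [cwt_mono] is asymptotically an equality. *)
Let tau_cvg m : tau m @ \oo --> (1 : R).
Proof.
elim: m => [|m IH].
  have -> : tau 0 = fun=> 1; last exact: cvg_cst.
  apply/funext => N; rewrite /tau addn0 powRr0 expr1n mulr1 divff//.
  by rewrite gt_eqF// M_gt0.
(* The j-th factor of the unit shift at N + m divided by 4, each of its two quotients being written
   as 1 minus a null sequence. *)
pose f N (j : 'I_n) : R := (1 - (1 + lam * j%:R) / 2 * (1 + N%:R + (m%:R + lam * j%:R))^-1) *
  (1 - lam * j%:R / 2 * (1 + N%:R + (m%:R + lam * j%:R))^-1).
have E : tau m.+1 = fun N => tau m N * \prod_(j < n) f N j.
  apply/funext => N; rewrite /tau.
  have h := @M_step (N + m)%:R (ler0n _ _).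
  have q : \prod_(j < n) (1 + (N + m)%:R + lam * j%:R) ^+ 2 != 0.
    rewrite prodrXl expf_neq0// gt_eqF// prodr_gt0// => j _.
    by rewrite ltr_wpDr// ltr_wpDr.
  have -> : M (N + m.+1)%:R = M (N + m)%:R * \prod_(j < n) (4 * f N j).
    apply: (mulIf q); rewrite addnS -natr1 h -mulrA -big_split /=; congr (_ * _).
    apply: eq_bigr => j _; rewrite /f natrD; field.
    rewrite gt_eqF//; have := lamj j; have := ler0n R N; have := ler0n R m.
    by move: (lam * j%:R) => c; lra.
  have -> : 4 `^ m.+1%:R = 4 `^ m%:R * 4 :> R.
    by rewrite -[m.+1%:R]natr1 powRD ?powRr1// pnatr_eq0 implybT.
  rewrite big_split /= prodr_const card_ord exprMn.
  by field; rewrite !expf_neq0 ?gt_eqF ?powR_gt0 ?M_gt0.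
rewrite E -[X in _ --> X]mulr1; apply: cvgM => //.
rewrite [X in _ --> X](_ : 1 = \prod_(j < n) (1 : R)); last by rewrite big1.
apply: (@cvg_bigprod _ _ _ _ (fun j N => f N j) (fun=> 1)) => j _.
rewrite -[X in _ --> X]mulr1.
have i0 : 0 <= m%:R + lam * j%:R :> R by rewrite addr_ge0.
apply: cvgM; rewrite -[X in _ --> X]subr0; apply: cvgB; try exact: cvg_cst.
  rewrite -[X in _ --> X](mulr0 ((1 + lam * j%:R) / 2)).
  by apply: cvgM; [exact: cvg_cst|exact: inv_cvg0].
rewrite -[X in _ --> X](mulr0 (lam * j%:R / 2)).
by apply: cvgM; [exact: cvg_cst|exact: inv_cvg0].
Qed.

(** [cwt_mono] from N to N + lam bounds the quotient by 1. From N + lam to N + m, with m an integer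
    above lam, it bounds it below by [tau m N]. *)
Let kappa_cvg : M (lam + N%:R) / (M N%:R * (4 `^ lam) ^+ n) @[N --> \oo] --> (1 : R).
Proof.
pose m := (Num.truncn lam).+1.
have lm : lam <= m%:R by rewrite ltW// truncnS_gt.
have p4 (x : R) : 0 < (4 `^ x) ^+ n by rewrite exprn_gt0// powR_gt0.
apply: (@squeeze_cvgr _ _ _ _ (tau m) (fun=> 1)); [|exact: tau_cvg|exact: cvg_cst].
apply: nearW => N; apply/andP; split; last first.
  rewrite ler_pdivrMr ?mul1r ?mulr_gt0//.
  have := @cwt_mono N%:R (lam + N%:R) (ler0n _ _); rewrite addrK; apply.
  by rewrite lerDr ltW.
rewrite /tau ler_pdivrMr ?mulr_gt0//.
have := @cwt_mono (lam + N%:R) (N + m)%:R.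
have -> : (N + m)%:R = m%:R + N%:R :> R by rewrite natrD addrC.
rewrite lerD2r lm addr_ge0 ?(ltW lam0)// => /(_ isT isT) h.
apply: (le_trans h).
rewrite -[leRHS]mulrA [leRHS](_ : _ = M (lam + N%:R) * ((4 `^ m%:R) ^+ n / (4 `^ lam) ^+ n)); last first.
  have := M_gt0 N; have := p4 lam => u1 u2.
  by field; rewrite !gt_eqF// powR_gt0.
have -> : m%:R + N%:R - (lam + N%:R) = m%:R - lam by ring.
rewrite powRB; last by rewrite pnatr_eq0 implybT.
by rewrite expr_div_n.
Qed.

(* [M_poch] turns M lam / M 0 into M (lam + N) / M N times Pochhammer ratios; the
   former is asymptotic to 4^(lam n), squeezed between values at integer shifts. *)
Lemma tint_cwt_lam : M lam = M 0 * \prod_(j < n)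
  (Gamma (1 + lam * j.+2%:R) * Gamma (1 + lam * j%:R) / Gamma (1 + lam * j.+1%:R) ^+ 2).
Proof.
pose L j : R := 1 + lam * j%:R.
have L0 j : 0 < L j by rewrite ltr_wpDr.
have LS j : 1 + lam + lam * j%:R = L j.+1 by rewrite /L -natr1; ring.
have LSS j : 1 + 2 * lam + lam * j%:R = L j.+2 by rewrite /L -!natr1; ring.
pose G s N : R := poch s N.+1 / (N`!%:R * N.+1%:R `^ s).
have Gc s : 0 < s -> G s @ \oo --> (Gamma s)^-1 by exact: poch_cvg.
have Gc2 s : 0 < s -> G s N.*2.+1 @[N --> \oo] --> (Gamma s)^-1.
  by move=> s0; exact: (cvg_comp _ _ dbl_cvg (Gc s s0)).
pose f N (j : 'I_n) := G (L j) N.*2.+1 / G (L j.+2) N.*2.+1 * (G (L j.+1) N / G (L j) N) ^+ 2.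
(* The left side does not depend on [N], so it equals the limit of the right side. *)
have E N : M lam / M 0 = M (lam + N.+1%:R) / (M N.+1%:R * (4 `^ lam) ^+ n) * \prod_(j < n) f N j.
  have h1 := @M_poch lam N.+1 (ltW lam0).
  have h2 := @M_poch 0 N.+1 (lexx 0).
  rewrite add0r in h2.
  rewrite (eq_bigr (fun j : 'I_n => poch (L j.+1) N.+1 ^+ 2)) in h1; last by move=> j _; rewrite LS.
  rewrite [in RHS](eq_bigr (fun j : 'I_n => poch (L j.+2) N.+1.*2)) in h1; last by move=> j _; rewrite LSS.
  rewrite (eq_bigr (fun j : 'I_n => poch (L j) N.+1 ^+ 2)) in h2; last by move=> j _; rewrite addr0.
  rewrite [in RHS](eq_bigr (fun j : 'I_n => poch (L j) N.+1.*2)) in h2; last by move=> j _; rewrite mulr0 addr0.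
  have p m K : 0 < \prod_(j < n) poch (L (j + m)%N) K.
    by apply: prodr_gt0 => j _; apply: poch_gt0.
  set A1 := \prod_(j < n) poch (L j.+1) N.+1 ^+ 2 in h1.
  set A2 := \prod_(j < n) poch (L j.+2) N.+1.*2 in h1.
  set B1 := \prod_(j < n) poch (L j) N.+1 ^+ 2 in h2.
  set B2 := \prod_(j < n) poch (L j) N.+1.*2 in h2.
  have A10 : 0 < A1 by apply: prodr_gt0 => j _; rewrite exprn_gt0// poch_gt0.
  have A20 : 0 < A2 by apply: prodr_gt0 => j _; rewrite poch_gt0.
  have B10 : 0 < B1 by apply: prodr_gt0 => j _; rewrite exprn_gt0// poch_gt0.
  have B20 : 0 < B2 by apply: prodr_gt0 => j _; rewrite poch_gt0.
  (* The powers of [N.+1] in the normalisations [G] cancel; the doubled index leaves one factor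
     4^lam for each j. *)
  have -> : \prod_(j < n) f N j = (4 `^ lam) ^+ n * (B2 / A2 * (A1 / B1)).
    have -> : (4 `^ lam) ^+ n = \prod_(j < n) (4 `^ lam) by rewrite prodr_const card_ord.
    rewrite /A1 /A2 /B1 /B2 -!prodf_div -!big_split /=; apply: eq_bigr => j _.
    have a1 := poch_gt0 N.+1 (L0 j.+1); have a2 := poch_gt0 N.+1.*2 (L0 j.+2).
    have b1 := poch_gt0 N.+1 (L0 j); have b2 := poch_gt0 N.+1.*2 (L0 j).
    rewrite /f /G -doubleS.
    have x0 : 0 < N.+1%:R :> R by rewrite ltr0n.
    have -> : N.+1.*2%:R = 2 * N.+1%:R :> R by rewrite -mul2n natrM.
    have e1 : L j.+1 = L j + lam by rewrite /L -natr1; ring.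
    have e2 : L j.+2 = L j + lam + lam by rewrite /L -!natr1; ring.
    rewrite [N.+1%:R `^ L j.+1](_ : _ = N.+1%:R `^ L j * N.+1%:R `^ lam); last first.
      by rewrite e1 powRD// (gt_eqF x0) implybT.
    rewrite [(2 * N.+1%:R) `^ L j.+2](_ : _ = (2 * N.+1%:R) `^ L j *
       (4 `^ lam * (N.+1%:R `^ lam * N.+1%:R `^ lam))); last first.
      have y0 : 0 < 2 * N.+1%:R :> R by rewrite mulr_gt0.
      rewrite e2 !powRD ?(gt_eqF y0) ?implybT// -mulrA; congr (_ * _).
      rewrite -!powRM ?ltW// ?mulr_ge0 ?ltW//.
      by congr (_ `^ _); ring.
    have c1 : 0 < N.+1%:R `^ L j :> R by rewrite powR_gt0.
    have c2 : 0 < N.+1%:R `^ lam :> R by rewrite powR_gt0.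
    have c3 : 0 < (2 * N.+1%:R) `^ L j :> R by rewrite powR_gt0// mulr_gt0.
    have c4 : 0 < 4 `^ lam :> R by rewrite powR_gt0.
    have c5 : N`!%:R != 0 :> R by rewrite pnatr_eq0 -lt0n fact_gt0.
    have c6 : N.*2.+1`!%:R != 0 :> R by rewrite pnatr_eq0 -lt0n fact_gt0.
    move: (N.+1%:R `^ L j) c1 (N.+1%:R `^ lam) c2 ((2 * N.+1%:R) `^ L j) c3 (4 `^ lam) c4.
    move: (poch (L j) N.+1.*2) b2 (poch (L j.+2) N.+1.*2) a2 (poch (L j) N.+1) b1 (poch (L j.+1) N.+1) a1.
    move: (N`!%:R) c5 (N.*2.+1`!%:R) c6 => u1 v1 u2 v2 u3 v3 u4 v4 u5 v5 u6 v6 u7 v7 u8 v8 u9 v9 u10 v10.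
    by field; rewrite v1 v2 !gt_eqF.
  have c4 : 0 < (4 `^ lam) ^+ n :> R by rewrite exprn_gt0// powR_gt0.
  have mN := M_gt0 N.+1.
  have k1 : M lam = M (lam + N.+1%:R) * A1 / A2 by rewrite h1 mulfK// gt_eqF.
  have k2 : M 0 = M N.+1%:R * B1 / B2 by rewrite h2 mulfK// gt_eqF.
  rewrite k1 k2.
  move: (M (lam + N.+1%:R)) (M N.+1%:R) mN ((4 `^ lam) ^+ n) c4 A1 A10 A2 A20 B1 B10 B2 B20 {h1 h2 k1 k2}.
  move=> u1 u2 v2 u3 v3 u4 v4 u5 v5 u6 v6 u7 v7.
  by field; rewrite !gt_eqF.
have lim : M lam / M 0 @[N --> \oo] --> 1 * \prod_(j < n)
    ((Gamma (L j))^-1 / (Gamma (L j.+2))^-1 * ((Gamma (L j.+1))^-1 / (Gamma (L j))^-1) ^+ 2).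
  have Gn0 j : (Gamma (L j))^-1 != 0 by rewrite invr_neq0// gt_eqF// Gamma_gt0.
  rewrite (_ : (fun N : nat => M lam / M 0) = fun N => M (lam + N.+1%:R) /
     (M N.+1%:R * (4 `^ lam) ^+ n) * \prod_(j < n) f N j); last by apply/funext => N; exact: E.
  apply: cvgM.
    by have := kappa_cvg; rewrite -(cvg_shiftS (fun N => M (lam + N%:R) / (M N%:R * (4 `^ lam) ^+ n))).
  apply: (@cvg_bigprod _ _ _ _ (fun j N => f N j)) => j _; apply: cvgM.
    by apply: cvgM; [exact: Gc2|apply: cvgV => //; exact: Gc2].
  have c : (fun N => G (L j.+1) N / G (L j) N) @ \oo --> (Gamma (L j.+1))^-1 / (Gamma (L j))^-1.
    by apply: cvgM; [exact: Gc|apply: cvgV => //; exact: Gc].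
  by under eq_fun do rewrite expr2; rewrite expr2; exact: cvgM.
have := @cvg_unique _ (@Rhausdorff R) _ _ _ _ (cvg_cst (M lam / M 0)) lim.
move=> h; rewrite -[LHS](divfK (lt0r_neq0 M0)) h mul1r mulrC; congr (_ * _).
apply: eq_bigr => j _; rewrite -/(L j) -/(L j.+1) -/(L j.+2).
have := Gamma_gt0 (L0 j); have := Gamma_gt0 (L0 j.+1); have := Gamma_gt0 (L0 j.+2).
move: (Gamma (L j)) (Gamma (L j.+1)) (Gamma (L j.+2)) => u1 u2 u3 v3 v2 v1.
by field; rewrite !gt_eqF.
Qed.

End morris.

Lemma tint_cwt_dyson {R : realType} (lam : R) (lam0 : 0 < lam) n :
  tint (@cwt R n 0 lam 0) = Gamma (1 + lam * n%:R) / Gamma (1 + lam) ^+ n.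
Proof.
pose G j : R := Gamma (1 + lam * j%:R).
have G0 j : 0 < G j by apply: Gamma_gt0; rewrite ltr_wpDr// mulr_ge0// ltW.
have G1 : Gamma (1 + lam) = G 1%N by rewrite /G mulr1.
rewrite G1 -/(G n).
(* The factors are second quotients of [G], so their product telescopes; with G 0 = 1 it is exactly
   the quotient that leads from n to n + 1 variables. *)
have tel m : \prod_(j < m) (G j.+2 * G j / G j.+1 ^+ 2) = G m.+1 * G 0%N / (G m * G 1%N).
  elim: m => [|m IH].
    move: (G 0%N) (G 1%N) (G0 0%N) (G0 1%N) => u v u0 v0.
    by rewrite big_ord0 [v * _]mulrC divff// mulf_neq0// gt_eqF.
  rewrite big_ord_recr /= IH.
  move: (G m) (G m.+1) (G m.+2) (G 0%N) (G 1%N) (G0 m) (G0 m.+1) (G0 m.+2) (G0 0%N) (G0 1%N).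
  by move=> u1 u2 u3 u4 u5 v1 v2 v3 v4 v5; field; rewrite !gt_eqF.
have G00 : G 0%N = 1 by rewrite /G mulr0 addr0 Gamma1.
elim: n => [|n IH].
  by rewrite /= /cwt !big_ord0 mulr1 G00 expr0 divr1.
rewrite tint_cwt_succ// tint_cwt_lam//; last first.
  by rewrite IH divr_gt0// exprn_gt0.
rewrite IH -/(G 0%N) tel G00 exprS.
move: (G n) (G n.+1) (G 1%N) (G0 n) (G0 n.+1) (G0 1%N) => u1 u2 u3 v1 v2 v3.
by field; rewrite expf_neq0 !gt_eqF.
Qed.

(** * The expectation as a hypergeometric sum *)

Lemma powR_prod {R : realType} (I : Type) (r : seq I) (P : pred I) (F : I -> R) (p : R) :
  (forall i, P i -> 0 <= F i) ->
  (\prod_(i <- r | P i) F i) `^ p = \prod_(i <- r | P i) F i `^ p.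
Proof.
move=> F0; elim: r => [|i r IH]; first by rewrite !big_nil powR1.
rewrite !big_cons; case: ifPn => // Pi.
by rewrite powRM ?IH ?F0// prodr_ge0.
Qed.

Lemma prod_neq_gt {R : comNzRingType} n (F : 'I_n -> 'I_n -> R) :
  (forall j k, F j k = F k j) ->
  \prod_(j < n) \prod_(k < n | k != j) F j k = \prod_(j < n) \prod_(k < n | (j < k)%N) F j k ^+ 2.
Proof.
move=> sF.
rewrite (eq_bigr (fun j : 'I_n => \prod_(k < n | (j < k)%N) F j k * \prod_(k < n | (k < j)%N) F j k)); last first.
  move=> j _; rewrite (bigID (fun k : 'I_n => (j < k)%N)) /=; congr (_ * _); apply: eq_bigl => k.
    by have [->|] := eqVneq k j; rewrite ?ltnn.
  by rewrite -leqNgt [in RHS]ltn_neqAle val_eqE.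
rewrite big_split /= [X in _ * X](exchange_big_dep xpredT)//= -big_split /=.
apply: eq_bigr => j _; rewrite -big_split /=; apply: eq_bigr => k _.
by rewrite [F k j]sF expr2.
Qed.

Section expectation.
Context {R : realType}.
Implicit Types beta lam x : R.

Lemma norm_expiB (s t : R) : `|expi s - expi t| = (Num.sqrt (chord2 (t - s)))%:C.
Proof.
rewrite normc_def; congr (Num.sqrt _)%:C; rewrite /expi /chord2 cosB /=.
have h1 := cos2Dsin2 s; have h2 := cos2Dsin2 t.
transitivity (cos s ^+ 2 + sin s ^+ 2 + (cos t ^+ 2 + sin t ^+ 2) -
  2 * (cos t * cos s + sin t * sin s)); first by ring.
by rewrite h1 h2; ring.
Qed.

(** A chord is the square root of [chord2], so an unordered pair carries exponent beta / 2; this is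
    why [lam] is beta / 2. *)
Lemma vandermonde_cwt beta n (t : n.-tuple R) :
  complex.Re `|vandermonde_prod (map_tuple (@expi R) t)| `^ beta = cwt 0 (beta / 2) 0 t.
Proof.
rewrite /vandermonde_prod.
have -> : `|\prod_(j < n) \prod_(k < n | (j < k)%N)
    (tnth (map_tuple (@expi R) t) k - tnth (map_tuple (@expi R) t) j)| =
    (\prod_(j < n) \prod_(k < n | (j < k)%N) Num.sqrt (chord2 (tnth t j - tnth t k)))%:C.
  rewrite normr_prod rmorph_prod; apply: eq_bigr => j _.
  rewrite normr_prod rmorph_prod; apply: eq_bigr => k _.
  by rewrite !tnth_map norm_expiB.
rewrite [complex.Re _]/= powR_prod; last first.
  by move=> j _; apply: prodr_ge0 => k _; exact: sqrtr_ge0.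
rewrite /cwt [X in X * _]big1 ?mul1r => [|j _]; last by rewrite powRr0.
rewrite prod_neq_gt; last by move=> j k; rewrite -(opprB (tnth t j)) chord2N.
apply: eq_bigr => j _; rewrite powR_prod; last by move=> k _; exact: sqrtr_ge0.
apply: eq_bigr => k _; rewrite addr0 -powR12_sqrt ?chord2_ge0// -powRrM.
rewrite -powR_mulrn ?powR_ge0// -powRrM; congr (_ `^ _); lra.
Qed.

(** Conjugation turns the second factor into 1 - e^(-iy) e^(-i theta). The product is then 1 - 2 cos
    theta e^(-iy) + e^(-2iy), that is e^(-iy) (2 cos y - 2 cos theta). *)
Lemma char_polyM n (t : n.-tuple R) (y : R) :
  let e := map_tuple (@expi R) t in
  char_poly_circ e (expi y) * (char_poly_circ e (expi (- y)))^* =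
  expi (- (y * n%:R)) * (\prod_(j < n) (chord2 (tnth t j) - chord2 y))%:C.
Proof.
have expiX m : expi (- (y * m%:R)) = expi (- y) ^+ m :> R[i].
  elim: m => [|m IH]; first by rewrite mulr0 oppr0 /expi cos0 sin0.
  by rewrite exprS -IH -expiD -natr1; congr expi; ring.
rewrite /= /char_poly_circ rmorph_prod -big_split expiX /=.
rewrite -[n in _ ^+ n]card_ord -prodr_const rmorph_prod -big_split /=.
apply: eq_bigr => j _; rewrite tnth_map.
have inv (s : R) : (expi s)^-1 = expi (- s) :> R[i].
  have e1 : expi s * expi (- s) = 1 :> R[i] by rewrite expiN; exact: expi_conjM.
  have e0 : expi s != 0 :> R[i].
    by apply/eqP => z; move: e1; rewrite z mul0r => /eqP; rewrite eq_sym oner_eq0.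
  by apply: (mulfI e0); rewrite e1 divff.
have eN (s : R) : Num.conj (expi s) = expi (- s) by rewrite expiN.
rewrite !inv opprK rmorphB rmorphM rmorph1 [X in _ * X = _]/= !eN.
have h1 : expi y * expi (- y) = 1 :> R[i] by rewrite expiN; exact: expi_conjM.
have h2 : expi (tnth t j) * expi (- tnth t j) = 1 :> R[i] by rewrite expiN; exact: expi_conjM.
have -> : (chord2 (tnth t j) - chord2 y)%:C = expi y + expi (- y) -
    (expi (tnth t j) + expi (- tnth t j)).
  by rewrite /chord2 /expi !cosN !sinN; apply: complex_eq; rewrite /=; ring.
transitivity (1 - expi (- y) * (expi (tnth t j) + expi (- tnth t j)) +
  expi (- y) ^+ 2 * (expi (tnth t j) * expi (- tnth t j))); first by ring.
rewrite h2.
transitivity (expi y * expi (- y) - expi (- y) * (expi (tnth t j) + expi (- tnth t j)) +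
  expi (- y) ^+ 2); first by rewrite h1 mulr1.
by ring.
Qed.

End expectation.

Lemma sum_binS {R : comNzRingType} k (T : nat -> R) :
  \sum_(m < k.+2) 'C(k.+1, m)%:R * T m =
  \sum_(m < k.+1) 'C(k, m)%:R * T m + \sum_(m < k.+1) 'C(k, m)%:R * T m.+1.
Proof.
rewrite big_ord_recl /= bin0 mul1r.
under eq_bigr => m _ do rewrite /bump /= add1n binS natrD mulrDl.
rewrite big_split /= addrA; congr (_ + _).
transitivity (\sum_(m < k.+2) 'C(k, m)%:R * T m).
  by rewrite [RHS]big_ord_recl /= bin0 mul1r.
by rewrite big_ord_recr /= bin_small// mul0r addr0.
Qed.

(** * The average of the shifted product as a hypergeometric sum *)

Section chord_moments.
Context {R : realType} {n : nat} (lam : R) (lam0 : 0 < lam).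
Implicit Types v : n.-tuple R.
Local Notation w := (@cwt R n 0 lam 0).
Let A m : R := tint (fun v : n.-tuple R => chord_prod m v * w v).

(** One factor [chord2 - c] is expanded at a time and the resulting chord is moved by symmetry into
    the first block. This gives Pascal's recurrence and avoids a sum over subsets. *)
Let mix (c : R) (i k : nat) v : R := \prod_(j < n)
  (if (j < i)%N then chord2 (tnth v j) else
   if (j < i + k)%N then chord2 (tnth v j) - c else 1).

Let nice_mix c i k : nice (mix c i k).
Proof.
apply: nice_prod => j _; case: (j < i)%N; first exact: nice_chord2_tnth.
case: (j < i + k)%N; last exact: nice_cst.
by apply: niceB; [exact: nice_chord2_tnth|exact: nice_cst].
Qed.

Let B c i k : R := tint (fun v => mix c i k v * w v).

Let bw : bmeas w. Proof. by apply: bmeas_cwt; rewrite // lexx ler01. Qed.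

Let B_rec c i k : (i + k < n)%N -> B c i k.+1 = B c i.+1 k - c * B c i k.
Proof.
move=> ikn; have iN : (i < n)%N by exact: leq_ltn_trans (leq_addr k i) ikn.
pose l : 'I_n := Ordinal ikn; pose i' : 'I_n := Ordinal iN.
have bB m p : bmeas (fun v => mix c m p v * w v).
  by apply: bmeasM => //; exact: (nice_mix _ _ _).1.
have E1 v : mix c i k.+1 v = mix c i k v * chord2 (tnth v l) - c * mix c i k v.
  have li : (i + k < i)%N = false by apply/negbTE; rewrite -leqNgt leq_addr.
  have R1 : mix c i k v = \prod_(j < n | j != l) (if (j < i)%N then chord2 (tnth v j) else
      if (j < i + k)%N then chord2 (tnth v j) - c else 1).
    by rewrite /mix (bigD1 l)//= li ltnn mul1r.
  have -> : mix c i k.+1 v = (chord2 (tnth v l) - c) * mix c i k v.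
    rewrite R1 /mix (bigD1 l)//= li addnS ltnSn; congr (_ * _); apply: eq_bigr => j jl.
    rewrite ltnS [(j <= i + k)%N]leq_eqVlt.
    by have -> : (j == i + k :> nat)%N = false by apply/negbTE; exact: jl.
  by ring.
(* Exchanging positions i and i + k puts the new chord at the end of the first block and the
   displaced factor into the free place; for k = 0 the positions coincide. *)
have E2 v : mix c i k (swapc i' l v) * chord2 (tnth (swapc i' l v) l) = mix c i.+1 k v.
  rewrite tnth_mktuple tpermR /mix.
  rewrite (reindex_inj (@perm_inj _ (tperm i' l))) /=.
  under eq_bigr do rewrite tnth_mktuple tpermK.
  rewrite (bigD1 i')//= tpermL /= [in RHS](bigD1 i')//= ltnSn.
  have li : (i + k < i)%N = false by apply/negbTE; rewrite -leqNgt leq_addr.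
  rewrite li ltnn mul1r mulrC; congr (_ * _); apply: eq_bigr => j ji.
  have ji' : (j == i :> nat) = false by apply/negbTE; exact: ji.
  rewrite [in RHS]ltnS [in RHS]leq_eqVlt ji' /= addSn ltnS.
  case: tpermP => [e|e|_ /eqP jl].
  - by rewrite e eqxx in ji.
  - rewrite e /= ltnn leqnn li.
    have k0 : (0 < k)%N.
      by rewrite lt0n; apply/eqP => k0; move: ji'; rewrite e /= k0 addn0 eqxx.
    by rewrite -[X in (X < _)%N]addn0 ltn_add2l k0.
  - have jl' : (j == i + k :> nat)%N = false by apply/negbTE; exact: jl.
    by rewrite [(j <= i + k)%N]leq_eqVlt jl'.
rewrite /B.
have b1 : bmeas (fun v => mix c i k v * chord2 (tnth v l)).
  by apply: bmeasM; [exact: (nice_mix _ _ _).1|exact: (nice_chord2_tnth _).1].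
rewrite -(_ : tint (fun v => mix c i k v * chord2 (tnth v l) * w v) = tint (fun v => mix c i.+1 k v * w v)).
  rewrite -tintZ// -tintB//; last 2 first.
    exact: bmeasM.
    by apply: bmeasM; [exact: bmeas_cst|].
  by congr tint; apply/funext => v; rewrite E1; ring.
rewrite -(tint_cwt_swapc (lexx 0) lam0 i' l b1).
by congr tint; apply/funext => v; rewrite E2.
Qed.

Let B0E c i : (i <= n)%N -> B c i 0 = A i.
Proof.
move=> lin; congr tint; apply/funext => v; congr (_ * _).
rewrite /mix /chord_prod [RHS]big_mkcond; apply: eq_bigr => j _.
by rewrite addn0; case: (j < i)%N.
Qed.

Let B_sum c k : forall i, (i + k <= n)%N ->
  B c i k = \sum_(m < k.+1) 'C(k, m)%:R * (- c) ^+ m * A (i + k - m)%N.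
Proof.
elim: k => [|k IH] i ikn.
  by rewrite big_ord_recl big_ord0 addr0 bin0 expr0 !mul1r subn0 addn0 B0E// -(addn0 i).
rewrite B_rec; last by rewrite -addnS.
rewrite IH; last by rewrite addSnnS.
rewrite IH; last by rewrite addnS in ikn; exact: ltnW.
under [RHS]eq_bigr do rewrite -mulrA.
rewrite (sum_binS _ (fun m => (- c) ^+ m * A (i + k.+1 - m)%N)); congr (_ + _).
  by apply: eq_bigr => m _; rewrite addSnnS mulrA.
rewrite mulr_sumr -sumrN; apply: eq_bigr => m _.
rewrite addnS subSS exprS; ring.
Qed.

Lemma tint_chord_binomial (c : R) :
  tint (fun v : n.-tuple R => \prod_(j < n) (chord2 (tnth v j) - c) * w v) =
  \sum_(m < n.+1) 'C(n, m)%:R * (- c) ^+ m * A (n - m)%N.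
Proof.
transitivity (B c 0 n); last exact: (@B_sum c n 0 (leqnn n)).
congr tint; apply/funext => v; congr (_ * _); apply: eq_bigr => j _.
by rewrite /= ltn_ord.
Qed.

Let g : R := lam^-1.
Let g0 : 0 < g. Proof. by rewrite invr_gt0. Qed.

(** [tint_chord_prod_rec] at index n - m - 1, divided by lam, has the coefficients 2 g + n + m and 4
    (g + 1/2 + m). They grow by 1 with m, so descending from the top moment builds Pochhammer
    symbols. *)
Lemma chord_moment_ratio m : (m <= n)%N ->
  A (n - m)%N * (4 ^+ m * poch (g + 2^-1) m) = A n * poch (2 * g + n%:R) m.
Proof.
elim: m => [_|m IH mn]; first by rewrite subn0 /poch !big_ord0 expr0 !mulr1.
have nm : (n - m.+1 < n)%N by rewrite ltn_subrL (leq_trans _ mn).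
have := @tint_chord_prod_rec R n lam lam0 (Ordinal nm).
rewrite /= -/(A (n - m.+1)%N) -/(A (n - m.+1).+1) -subSn// subSS.
have -> : (n - (n - m) = m)%N by rewrite subKn// ltnW.
move=> h.
rewrite !pochS exprS.
have IH' := IH (ltnW mn).
have e : (n - m.+1)%:R = n%:R - m%:R - 1 :> R by rewrite natrB// -natr1; ring.
have lg : lam * g = 1 by rewrite mulfV// gt_eqF.
have l1 : A (n - m)%N * (2 * g + n%:R + m%:R) = 4 * A (n - m.+1)%N * (g + 2^-1 + m%:R).
  have ln0 : lam != 0 by rewrite gt_eqF.
  apply: (mulfI ln0).
  have -> : lam * (A (n - m)%N * (2 * g + n%:R + m%:R)) =
    A (n - m)%N * (2 * (lam * g) + 2 * lam * m%:R + lam + lam * (n%:R - m%:R - 1)) by ring.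
  have -> : lam * (4 * A (n - m.+1)%N * (g + 2^-1 + m%:R)) =
    4 * A (n - m.+1)%N * (lam * g + lam * m%:R + lam / 2) by field.
  by rewrite lg -e mulr1 h.
transitivity (A (n - m.+1)%N * 4 * (g + 2^-1 + m%:R) * (4 ^+ m * poch (g + 2^-1) m)).
  by ring.
rewrite [A (n - m.+1)%N * 4]mulrC -l1 mulrAC.
rewrite IH'; ring.
Qed.

(** The case m = n of the ratio, simplified by computing (2g)_(2n) both as (2g)_n (2g + n)_n and as
    4^n (g)_n (g + 1/2)_n. *)
Lemma chord_moment_top : A n * poch g n = A 0 * poch (2 * g) n.
Proof.
have := chord_moment_ratio (leqnn n); rewrite subnn => h.
have p m : poch (2 * g) (m + n) = poch (2 * g) n * poch (2 * g + n%:R) m.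
  elim: m => [|m IH]; first by rewrite add0n /poch big_ord0 mulr1.
  by rewrite addSn !pochS IH natrD; ring.
have := p n; rewrite addnn poch_double => h2.
have q1 := poch_gt0 n g0.
have q2 : 0 < poch (g + 2^-1) n by apply: poch_gt0; rewrite addr_gt0.
have q3 : 0 < poch (2 * g + n%:R) n by apply: poch_gt0; rewrite ltr_wpDr// mulr_gt0.
apply: (mulIf (lt0r_neq0 q3)).
rewrite mulrAC -h -[RHS]mulrA -h2; ring.
Qed.

(** The sum is 2F1(- n, n + 2 g; g + 1/2; c / 4), proportional to the Gegenbauer polynomial of
    degree n and parameter g at 1 - c / 2, which is cos y for c = chord2 y. *)
Lemma tint_chord_sum (c : R) :
  tint (fun v : n.-tuple R => \prod_(j < n) (chord2 (tnth v j) - c) * w v) =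
  tint w * (poch (2 * g) n / poch g n) *
  \sum_(m < n.+1) 'C(n, m)%:R * (- (c / 4)) ^+ m * (poch (2 * g + n%:R) m / poch (g + 2^-1) m).
Proof.
have q1 := poch_gt0 n g0.
have An : A n = tint w * (poch (2 * g) n / poch g n).
  rewrite mulrA -[LHS](mulfK (lt0r_neq0 q1)) chord_moment_top; congr (_ * _ / _).
  by congr tint; apply/funext => v; rewrite /chord_prod big1 ?mul1r.
rewrite tint_chord_binomial -An mulr_sumr; apply: eq_bigr => m _.
have mn : (m <= n)%N by rewrite -ltnS.
have q2 : 0 < poch (g + 2^-1) m by apply: poch_gt0; rewrite addr_gt0.
have h := chord_moment_ratio mn.
have q4 : 0 < 4 ^+ m :> R by rewrite exprn_gt0.
have -> : A (n - m)%N = A n * poch (2 * g + n%:R) m / (4 ^+ m * poch (g + 2^-1) m).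
  by rewrite -h mulfK// mulf_neq0// gt_eqF.
rewrite -mulNr expr_div_n.
by field; rewrite !gt_eqF.
Qed.

End chord_moments.

(** * The limit *)

Lemma tannery {R : realType} (a : nat -> nat -> R) (b M : nat -> R) :
  (forall m, a n m @[n --> \oo] --> b m) -> (forall n m, `|a n m| <= M m) ->
  cvgn (series M) ->
  cvgn (series b) /\ \sum_(m < n.+1) a n m @[n --> \oo] --> limn (series b).
Proof.
move=> ab aM cM.
have M0 m : 0 <= M m by exact: le_trans (normr_ge0 _) (aM 0%N m).
have bM m : `|b m| <= M m.
  have /cvg_norm h := ab m.
  by apply: (cvgr_to_le h); apply: nearW => n.
have cb : cvgn (series b).
  apply: normed_cvg; apply: (series_le_cvg _ _ bM cM) => // m.
have ndM : nondecreasing_seq (series M).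
  by apply/nondecreasing_seqP => n; rewrite seriesSr lerDl.
have tail (u : nat -> R) K L : (forall m, `|u m| <= M m) -> (K <= L)%N ->
    `|\sum_(m < L) u m - \sum_(m < K) u m| <= series M L - series M K.
  move=> uM KL.
  have E (v : nat -> R) : \sum_(m < L) v m - \sum_(m < K) v m = \sum_(K <= m < L) v m.
    by rewrite -!(big_mkord xpredT v) (@big_cat_nat _ _ _ K 0 L)//= [X in X - _]addrC addrK.
  rewrite /series /= !big_mkord !E (le_trans (ler_norm_sum _ _ _))//.
  by apply: ler_sum => m _.
split => //; apply/cvgrPdist_le => e e0.
have e30 : 0 < e / 3 by rewrite divr_gt0.
have /cvgrPdist_le /(_ _ e30) [K _ hK] := cM.
have tailK L : (K <= L)%N -> series M L - series M K <= e / 3.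
  move=> KL; have h1 := nondecreasing_cvgn_le ndM cM L.
  have := hK K (leqnn K); rewrite ler_norml => /andP[_ h2].
  by rewrite (le_trans _ h2)// lerD2r.
have limb : `|limn (series b) - \sum_(m < K) b m| <= e / 3.
  have h : `|series b L - \sum_(m < K) b m| @[L --> \oo] --> `|limn (series b) - \sum_(m < K) b m|.
    by apply: cvg_norm; apply: cvgB => //; exact: cvg_cst.
  apply: (cvgr_to_le h); exists K => // L /= KL.
  by rewrite /series /= big_mkord (le_trans (tail _ _ _ bM KL))// tailK.
have finK : \sum_(m < K) a n m @[n --> \oo] --> \sum_(m < K) b m.
  by apply: (@cvg_bigsum _ _ _ _ (fun (m : 'I_K) n => a n m)) => m _; exact: ab.
have /cvgrPdist_le /(_ _ e30) [N _ hN] := finK.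
exists (maxn K N) => // n /=; rewrite geq_max => /andP[Kn Nn].
have h1 := hN n Nn.
have h2 : `|\sum_(m < n.+1) a n m - \sum_(m < K) a n m| <= e / 3.
  by rewrite (le_trans (tail _ _ _ (aM n) (leqW Kn)))// tailK// leqW.
rewrite (_ : limn _ - _ = (limn (series b) - \sum_(m < K) b m) +
  (\sum_(m < K) b m - \sum_(m < K) a n m) - (\sum_(m < n.+1) a n m - \sum_(m < K) a n m)); last by ring.
rewrite (le_trans (ler_normB _ _))//.
have := ler_normD (limn (series b) - \sum_(m < K) b m) (\sum_(m < K) b m - \sum_(m < K) a n m).
move: h1 h2 limb => /=; lra.
Qed.

Section limit.
Context {R : realType}.

(** Since chord2 t = 4 sin^2 (t / 2), this is the derivative at h = 0 of sin (h x / 2), taken along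
    h = 1 / (n + 1) and squared. *)
Lemma chord2_scaling (x : R) :
  n.+1%:R ^+ 2 * chord2 (x / n.+1%:R) @[n --> \oo] --> x ^+ 2.
Proof.
have E n : n.+1%:R ^+ 2 * chord2 (x / n.+1%:R) = 4 * (n.+1%:R * sin (n.+1%:R^-1 * (x / 2))) ^+ 2.
  rewrite exprMn mulrCA; congr (_ * _); rewrite /chord2.
  have -> : x / n.+1%:R = (n.+1%:R^-1 * (x / 2)) *+ 2.
    by rewrite -mulr_natr; field; rewrite nat1r pnatr_eq0.
  by rewrite cos_mulr2n cos2sin2 -mulr_natr; ring.
rewrite (funext E).
have dg : is_derive (0 : R) (1 : R) (fun h : R => sin (h * (x / 2))) (x / 2).
  have h1 : is_derive (0 : R) (1 : R) (fun h : R => h * (x / 2)) (x / 2).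
    apply: (is_derive_eq (is_deriveM (is_derive_id (0 : R) (1 : R))
      (is_derive_cst (x / 2) (0 : R) (1 : R)))).
    by rewrite /GRing.scale /= mul0r add0r mulr1.
  apply: (is_derive_eq (@is_derive1_comp _ sin (fun h : R => h * (x / 2)) 0 _ _ (is_derive_sin _) h1)).
  by rewrite mul0r cos0 mul1r.
have lim : n.+1%:R * sin (n.+1%:R^-1 * (x / 2)) @[n --> \oo] --> x / 2.
  have [dd dv] := dg.
  have toz : n.+1%:R^-1 @[n --> \oo] --> (0 : R)^'.
    move=> A hA.
    have H : \forall n \near \oo, n.+1%:R^-1 != 0 :> R -> A (n.+1%:R^-1 : R) by exact: cvg_harmonic hA.
    change (\forall n \near \oo, A (n.+1%:R^-1 : R)).
    by apply: filterS H => n; apply; rewrite invr_neq0// pnatr_eq0.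
  have := cvg_comp _ _ toz dd; rewrite -/(derive _ _ _) dv.
  apply: cvg_trans; apply: near_eq_cvg; apply: nearW => n.
  by rewrite /= /GRing.scale /= mulr1 addr0 mul0r sin0 subr0 invrK.
have -> : x ^+ 2 = 4 * (x / 2 * (x / 2)) by field.
apply: cvgM; first exact: cvg_cst.
by under eq_fun do rewrite expr2; exact: cvgM.
Qed.

Context (gam x : R) (gam0 : 0 < gam).

Let y n : R := chord2 (x / n.+1%:R) / 4.
Let a n m : R := 'C(n.+1, m)%:R * (- y n) ^+ m *
  (poch (2 * gam + n.+1%:R) m / poch (gam + 2^-1) m).
Let gh0 : 0 < gam + 2^-1. Proof. by rewrite addr_gt0. Qed.
Let b m : R := Gamma (gam + 2^-1) * bessel_coef (gam - 2^-1) x m.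
(** Pairs the r-th factor of the falling factorial in the binomial with the r-th factor of the
    Pochhammer symbol and one power of the argument. Each [phi n r] has a limit in n and all are
    bounded by one constant, which provides both the termwise limit and the majorant. The truncated
    subtraction makes it 0 at r = n + 1, as the binomial requires. *)
Let phi n r : R := (n.+1 - r)%N%:R * (2 * gam + n.+1%:R + r%:R) * - y n.

Let aE n m : a n m = (\prod_(r < m) phi n r) / (m`!%:R * poch (gam + 2^-1) m).
Proof.
have f0 : m`!%:R != 0 :> R by rewrite pnatr_eq0 -lt0n fact_gt0.
have p0 := poch_gt0 m gh0.
rewrite /phi !big_split /= prodr_const card_ord -/(poch _ m).
have -> : \prod_(r < m) (n.+1 - r)%N%:R = 'C(n.+1, m)%:R * m`!%:R :> R.
  by rewrite -natrM bin_ffact ffact_prod natr_prod.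
by rewrite /a; field; rewrite f0 gt_eqF.
Qed.

Let bE m : b m = (\prod_(r < m) (- (x ^+ 2 / 4))) / (m`!%:R * poch (gam + 2^-1) m).
Proof.
rewrite /b /bessel_coef prodr_const card_ord.
have -> : m%:R + (gam - 2^-1) + 1 = gam + 2^-1 + m%:R by lra.
rewrite Gamma_poch//.
have f0 : m`!%:R != 0 :> R by rewrite pnatr_eq0 -lt0n fact_gt0.
have p0 := poch_gt0 m gh0; have G0 := Gamma_gt0 gh0.
have -> : (- (x ^+ 2 / 4)) ^+ m = (-1) ^+ m * (x ^+ 2 / 4) ^+ m.
  by rewrite -exprMn mulN1r.
rewrite -mul2n exprM.
have -> : (x / 2) ^+ 2 = x ^+ 2 / 4 by field.
by field; rewrite f0 !gt_eqF.
Qed.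

Let phi_cvg r : phi n r @[n --> \oo] --> - (x ^+ 2 / 4).
Proof.
have i0 : n.+1%:R^-1 @[n --> \oo] --> (0 : R) by exact: cvg_harmonic.
have h : (1 - r%:R * n.+1%:R^-1) * (1 + (2 * gam + r%:R) * n.+1%:R^-1) *
    - (n.+1%:R ^+ 2 * chord2 (x / n.+1%:R) / 4) @[n --> \oo] -->
    (1 - r%:R * 0) * (1 + (2 * gam + r%:R) * 0) * - (x ^+ 2 / 4).
  apply: cvgM; last first.
    by apply: cvgN; apply: cvgM; [exact: chord2_scaling|exact: cvg_cst].
  apply: cvgM.
    by apply: cvgB; [exact: cvg_cst|apply: cvgM => //; exact: cvg_cst].
  by apply: cvgD; [exact: cvg_cst|apply: cvgM => //; exact: cvg_cst].
move: h; rewrite !mulr0 subr0 addr0 !mul1r; apply: cvg_trans.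
apply: near_eq_cvg; exists r => // n /= rn.
rewrite /phi /y natrB; last exact: leqW.
by field; rewrite nat1r pnatr_eq0.
Qed.

Let S_cvg : cvgn (series b) /\ \sum_(m < n.+2) a n m @[n --> \oo] --> limn (series b).
Proof.
have [B hB] : exists B : R, forall n, n.+1%:R ^+ 2 * y n <= B.
  have : cvgn (fun n => n.+1%:R ^+ 2 * chord2 (x / n.+1%:R)).
    by apply/cvg_ex; exists (x ^+ 2); exact: chord2_scaling.
  move=> /cvg_seq_bounded [M [_ hM]]; exists ((M + 1) / 4) => n.
  have := hM (M + 1); rewrite ltrDl ltr01 => /(_ isT n I) h.
  rewrite /y mulrA ler_pM2r ?invr_gt0//.
  exact: le_trans (ler_norm _) h.
have y0 n : 0 <= y n by rewrite divr_ge0// chord2_ge0.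
have B0 : 0 <= B by rewrite (le_trans _ (hB 0%N))// mulr_ge0// sqr_ge0.
(* With p = n + 1 >= 1 one has (p - r) (2 gam + p + r) <= (1 + 2 gam) p^2, and [B] bounds p^2 times
   [y n]. *)
pose q := (1 + 2 * gam) * B.
have q0 : 0 <= q by rewrite mulr_ge0// addr_ge0// mulr_ge0// ltW.
have phiq n r : `|phi n r| <= q.
  rewrite /phi normrM normrN (ger0_norm (y0 n)) ger0_norm; last first.
    by rewrite mulr_ge0// !addr_ge0// mulr_ge0// ltW.
  apply: (@le_trans _ _ ((1 + 2 * gam) * n.+1%:R ^+ 2 * y n)); last first.
    by rewrite -mulrA ler_wpM2l// addr_ge0// mulr_ge0// ltW.
  rewrite ler_wpM2r//.
  have [rn|nr] := leqP r n.+1; last first.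
    rewrite (_ : (n.+1 - r = 0)%N) ?mul0r; last by apply/eqP; rewrite subn_eq0 ltnW.
    by rewrite mulr_ge0 ?sqr_ge0// addr_ge0// mulr_ge0// ltW.
  rewrite natrB//.
  have n1 : 1 <= n.+1%:R :> R by rewrite ler1n.
  have r0 : 0 <= r%:R :> R by [].
  have g0 := ltW gam0.
  have h1 : 0 <= gam * r%:R by rewrite mulr_ge0.
  have h2 : gam * n.+1%:R <= gam * n.+1%:R * n.+1%:R by rewrite ler_peMr// mulr_ge0.
  have h3 : 0 <= r%:R * r%:R :> R by rewrite mulr_ge0.
  move: (n.+1%:R) (r%:R) n1 r0 h1 h2 h3 => p s n1 r0 h1 h2 h3.
  rewrite -subr_ge0 (_ : _ - _ = 2 * (gam * p * p - gam * p) + 2 * (gam * s) + s * s); last by ring.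
  by rewrite !addr_ge0// mulr_ge0// subr_ge0.
(* The first factor is at least 1/2 and the later ones at least 1, whence the constant 2 in the
   majorant. *)
have poch_ge m : 2^-1 <= poch (gam + 2^-1) m.
  case: m => [|m]; first by rewrite /poch big_ord0; lra.
  rewrite /poch big_ord_recl addr0.
  rewrite -[leLHS]mulr1 ler_pM//; first by rewrite lerDr ltW.
  elim: m => [|m IH]; first by rewrite big_ord0.
  rewrite big_ord_recr /= -[leLHS]mulr1 ler_pM//.
  rewrite /bump /= natrD addrA.
  by have := gam0; have : 0 <= m%:R :> R by []; lra.
have aM n m : `|a n m| <= 2 * exp_coeff q m.
  rewrite aE normrM normr_prod normfV.
  have p0 := poch_gt0 m gh0.
  have f0 : 0 < m`!%:R :> R by rewrite ltr0n fact_gt0.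
  rewrite (@ger0_norm _ (_ * _)); last by rewrite mulr_ge0// ltW.
  rewrite ler_pdivrMr ?mulr_gt0//.
  rewrite /exp_coeff /=.
  rewrite (_ : 2 * (q ^+ m / m`!%:R) * (m`!%:R * poch (gam + 2^-1) m) =
     q ^+ m * (2 * poch (gam + 2^-1) m)); last by field; rewrite gt_eqF.
  rewrite (@le_trans _ _ (q ^+ m))//.
    rewrite -[m in leRHS]card_ord -prodr_const; apply: ler_prod => r _.
    by rewrite normr_ge0 phiq.
  rewrite ler_peMr ?exprn_ge0//.
  by have := poch_ge m; lra.
have ab m : a n m @[n --> \oo] --> b m.
  rewrite bE; under eq_fun do rewrite aE; apply: cvgM; last exact: cvg_cst.
  by apply: (@cvg_bigprod _ _ _ _ (fun (r : 'I_m) n => phi n r)) => r _; exact: phi_cvg.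
have cM : cvgn (series (fun m => 2 * exp_coeff q m)).
  have := is_cvg_series_exp_coeff q => h.
  have -> : series (fun m => 2 * exp_coeff q m) = fun n => 2 * series (exp_coeff q) n.
    by apply/funext => n; rewrite /series /= mulr_sumr.
  move: h => /cvg_ex[l hl]; apply/cvg_ex; exists (2 * l).
  by apply: cvgM; [exact: cvg_cst|exact: hl].
(* [tannery] sums n + 1 terms and the sum here has n + 2, so the index is shifted; the value at 0 is
   a filler. *)
pose a' n m := if n is k.+1 then a k m else 0.
have [] := @tannery R a' b (fun m => 2 * exp_coeff q m).
- by move=> m; rewrite -(cvg_shiftS (fun n => a' n m)); exact: ab.
- move=> [|n] m /=; last exact: aM.
  by rewrite normr0 mulr_ge0// exp_coeff_ge0.
- exact: cM.
- move=> cb h; split => //.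
  by move: h; rewrite -(cvg_shiftS (fun n => \sum_(m < n.+1) a' n m)).
Qed.

(** The prefactor tends to Gamma gam / Gamma (2 gam), and the sum to Gamma (gam + 1/2) times the
    Bessel series; duplication turns the three Gamma values into sqrt pi and a power of 2. *)
Lemma gegenbauer_cvg :
  n.+1%:R `^ (- gam) * (poch (2 * gam) n.+1 / poch gam n.+1 *
   \sum_(m < n.+2) 'C(n.+1, m)%:R * (- (chord2 (x / n.+1%:R) / 4)) ^+ m *
     (poch (2 * gam + n.+1%:R) m / poch (gam + 2^-1) m)) @[n --> \oo] -->
  pi `^ 2^-1 * twox_besselJ (gam - 2^-1) x.
Proof.
have gam20 : 0 < 2 * gam by rewrite mulr_gt0.
have [cb hS] := S_cvg.
have G1 := Gamma_gt0 gam0; have G2 := Gamma_gt0 gam20; have G3 := Gamma_gt0 gh0.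
have hP : n.+1%:R `^ (- gam) * (poch (2 * gam) n.+1 / poch gam n.+1) @[n --> \oo] -->
    (Gamma (2 * gam))^-1 / (Gamma gam)^-1.
  have -> : (fun n => n.+1%:R `^ (- gam) * (poch (2 * gam) n.+1 / poch gam n.+1)) =
    (fun n => (poch (2 * gam) n.+1 / (n`!%:R * n.+1%:R `^ (2 * gam))) /
              (poch gam n.+1 / (n`!%:R * n.+1%:R `^ gam))).
    apply/funext => n; have n0 : 0 < n.+1%:R :> R by rewrite ltr0n.
    have -> : n.+1%:R `^ (2 * gam) = n.+1%:R `^ gam * n.+1%:R `^ gam.
      by rewrite -powRD ?(gt_eqF n0) ?implybT// mulr_natl mulr2n.
    rewrite powRN.
    have p1 : 0 < n.+1%:R `^ gam :> R by rewrite powR_gt0.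
    have p2 := poch_gt0 n.+1 gam0.
    have p3 : n`!%:R != 0 :> R by rewrite pnatr_eq0 -lt0n fact_gt0.
    by field; rewrite p3 !gt_eqF.
  apply: cvgM; first exact: poch_cvg.
  apply: (cvgV _ (poch_cvg gam0)); exact: invr_neq0 (lt0r_neq0 G1).
have limbE : limn (series b) = Gamma (gam + 2^-1) * limn (series (bessel_coef (gam - 2^-1) x)).
  have e : series b = fun n => Gamma (gam + 2^-1) * series (bessel_coef (gam - 2^-1) x) n.
    by apply/funext => n; rewrite /series /= mulr_sumr.
  (* Convergence of the Bessel series is recovered from that of [b], so that [limn] is a genuine
     limit and the constant can be taken out of it. *)
  have e' : series (bessel_coef (gam - 2^-1) x) = fun n => (Gamma (gam + 2^-1))^-1 * series b n.
    by apply/funext => n; rewrite e mulKf// gt_eqF.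
  have h : series (bessel_coef (gam - 2^-1) x) @ \oo --> (Gamma (gam + 2^-1))^-1 * limn (series b).
    by rewrite e'; apply: cvgM => //; exact: cvg_cst.
  by rewrite (cvg_lim _ h)// mulrA divff ?mul1r// gt_eqF.
have -> : pi `^ 2^-1 * twox_besselJ (gam - 2^-1) x =
    (Gamma (2 * gam))^-1 / (Gamma gam)^-1 * limn (series b).
  rewrite limbE /twox_besselJ /bessel_entire powR12_sqrt ?pi_ge0// !mulrA.
  congr (_ * _); rewrite invrK.
  have D := Gamma_duplication gam0.
  have p2 : 0 < 2 `^ (2 * gam) :> R by rewrite powR_gt0.
  (* One factor comes from [bessel_entire] and one from [twox_besselJ]; together they give the power
     of 2 in the duplication formula. *)
  have e : 2 `^ (- (gam - 2^-1)) * 2 `^ (- (gam - 2^-1)) = 2 / 2 `^ (2 * gam) :> R.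
    rewrite -powRD ?pnatr_eq0 ?implybT//.
    have -> : - (gam - 2^-1) + - (gam - 2^-1) = 1 - 2 * gam by field.
    by rewrite powRB ?powRr1// pnatr_eq0 implybT.
  rewrite -mulrA e.
  move: (Gamma (2 * gam)) (Gamma gam) (Gamma (gam + 2^-1)) G2 D => g2 g1 g3 G2 D.
  apply: (mulIf (lt0r_neq0 G2)); apply: (mulIf (lt0r_neq0 p2)).
  transitivity (2 * Num.sqrt pi * g2); first by field; rewrite gt_eqF.
  by rewrite -D; field; rewrite gt_eqF.
under eq_fun do rewrite mulrA.
by apply: cvgM; [exact: hP|exact: hS].
Qed.

End limit.

(** The normalising constant of the ensemble is the inverse of Dyson's average, so the two cancel.
    The n phases e^(-ix/n) multiply to e^(-ix), which uses n > 0. *)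
Lemma circular_expectationE {R : realType} (beta x : R) (n : nat) : 0 < beta -> (0 < n)%N ->
  circular_expectation beta (fun e : n.-tuple R[i] =>
    char_poly_circ e (expi (x / n%:R)) * (char_poly_circ e (expi (- x / n%:R)))^*) =
  (poch (2 * (2 / beta)) n / poch (2 / beta) n *
   \sum_(m < n.+1) 'C(n, m)%:R * (- (chord2 (x / n%:R) / 4)) ^+ m *
     (poch (2 * (2 / beta) + n%:R) m / poch (2 / beta + 2^-1) m))%:C * expi (- x).
Proof.
move=> beta0 n0; have lam0 : 0 < beta / 2 by rewrite divr_gt0.
pose h (t : n.-tuple R) := \prod_(j < n) (chord2 (tnth t j) - chord2 (x / n%:R)) *
  cwt 0 (beta / 2) 0 t.
have bh : bmeas h.
  apply: bmeasM; last by apply: bmeas_cwt; rewrite // lexx ler01.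
  apply: bmeas_prod => j _; apply: bmeasB; last exact: bmeas_cst.
  exact: (nice_chord2_tnth _).1.
rewrite /circular_expectation.
rewrite (_ : (fun t : n.-tuple R => _) = fun t => expi (- x) * (h t)%:C); last first.
  apply/funext => t /=; rewrite mulNr char_polyM vandermonde_cwt divfK ?pnatr_eq0 -?lt0n//.
  by rewrite -mulrA -rmorphM.
have -> : torus_integral (fun t => expi (- x) * (h t)%:C) = expi (- x) * (tint h)%:C.
  rewrite torus_integralE; apply: complex_eq; rewrite !cparts /= !mulr0.
    rewrite subr0 -tintZ//; congr tint; apply/funext => t.
    by rewrite /= ?cparts /= ?mulr0 ?subr0.
  rewrite add0r -tintZ//; congr tint; apply/funext => t.
  by rewrite /= ?cparts /= ?mulr0 ?add0r.
rewrite mulrCA mulrC -rmorphM; congr (_%:C * _).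
have G1 : 0 < Gamma (1 + beta / 2) by rewrite Gamma_gt0// addr_gt0.
have G2 : 0 < Gamma (1 + beta / 2 * n%:R) by rewrite Gamma_gt0// ltr_wpDr// mulr_ge0// ltW.
rewrite tint_chord_sum// tint_cwt_dyson// invf_div.
rewrite [beta / 2 + 1]addrC [beta / 2 * n%:R + 1]addrC.
move: (Gamma (1 + beta / 2)) (Gamma (1 + beta / 2 * n%:R)) G1 G2 => g1 g2 G1 G2.
set rho := poch _ n / poch _ n; set S := \sum_(m < _) _.
have KF : g1 ^+ n / g2 * (g2 / g1 ^+ n) = 1 by field; rewrite expf_neq0 !gt_eqF.
transitivity (g1 ^+ n / g2 * (g2 / g1 ^+ n) * (rho * S)); first by ring.
by rewrite KF mul1r.
Qed.

Lemma cvg_real_complex {R : realType} (u : nat -> R) (l : R) (c : R[i]) :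
  u @ \oo --> l -> (fun n => (u n)%:C * c : R[i]^o) @ \oo --> (l%:C * c : R[i]^o).
Proof.
move=> ul; apply/cvgrPdist_lt => e e0.
(* A positive element of [R[i]] has imaginary part 0, so the radius is a real number. *)
have [e' e'0 ee] : exists2 e' : R, 0 < e' & e = e'%:C.
  case: e e0 => a b; rewrite ltcE /= => /andP[/eqP -> a0].
  by exists a.
have c'E : `|c| = (complex.Re `|c|)%:C by rewrite normc_def.
have c'0 : 0 <= complex.Re `|c| by rewrite normc_def /= sqrtr_ge0.
(* The summand 1 keeps the denominator positive when [c = 0]. *)
have d0 : 0 < e' / (complex.Re `|c| + 1) by rewrite divr_gt0// ltr_wpDl.
have /cvgrPdist_lt /(_ _ d0) := ul.
apply: filterS => n hn.
rewrite -mulrBl -rmorphB normrM [X in X * _]normc_def /= expr0n /= addr0 sqrtr_sqr c'E.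
rewrite -rmorphM ee ltcR.
apply: (@le_lt_trans _ _ (`|l - u n| * (complex.Re `|c| + 1))).
  by rewrite ler_wpM2l// lerDl.
by rewrite -ltr_pdivlMr// ltr_wpDl.
Qed.

Theorem theorem1p1 (R : realType) (beta : R) (hbeta : 0 < beta) (x : R) :
  let gamma := 2 / beta in
  (fun n : nat =>
     (n%:R `^ (- gamma))%:C *
     circular_expectation beta (fun e : n.-tuple R[i] =>
       char_poly_circ e (expi (x / n%:R)) *
       (char_poly_circ e (expi (- x / n%:R)))^*) : R[i]^o) @ \oo -->
  ((pi `^ 2^-1)%:C * (twox_besselJ (gamma - 2^-1) x)%:C * expi (- x) : R[i]^o).
Proof.
move=> gamma; have gam0 : 0 < gamma by rewrite divr_gt0.
(* The term n = 0, where x / n has only a default value, is dropped; the sequence then has the index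
   n + 1 of [gegenbauer_cvg]. *)
rewrite -rmorphM -(cvg_shiftS (_ : nat -> R[i]^o)).
apply: cvg_trans (@cvg_real_complex R _ _ (expi (- x)) (@gegenbauer_cvg R gamma x gam0)).
apply: near_eq_cvg; apply: nearW => n; rewrite [RHS]/=.
by rewrite circular_expectationE// [RHS]mulrA -rmorphM.
Qed.
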